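(* Let $n\ge3$, let $\alpha,\beta\in\mathbb R^n$ each have pairwise distinct coordinates, and let $w\in\mathbb R^{2n}$. If $w\notin L_{\alpha,\beta}$, then $D_w$ has at least $2n-2$ non-real projective zeros, counted with multiplicity. Equality holds if and only if $w\in\Sigma_{n-1}\setminus L_{\alpha,\beta}$. In this case $C_w$ is absolutely irreducible, its normalization is $\mathbf P^1_{\mathbb R}$, and its only complex singular point is the ordinary $(n-1)$-fold point in its real collision fiber.
   Context: Finite free additive convolution: for $p(x)=\sum_{k=0}^n(-1)^ka_kx^{n-k}$ and $q(x)=\sum_{k=0}^n(-1)^kb_kx^{n-k}$ with $a_0=b_0=1$, set $(p\boxplus_n q)(x)=\sum_{k=0}^n(-1)^kc_kx^{n-k}$ with $c_k=\sum_{i+j=k}\frac{(n-i)!(n-j)!}{n!(n-k)!}a_ib_j$. $P_\alpha(x)=\prod_{i=1}^n(x-\alpha_i)$. For $w=u\oplus v\in\mathbb R^{2n}$, $h_w(x,y,t)=(P_{y\alpha+tu}\boxplus_nP_{y\beta+tv})(x)$, a real form of degree $n$, monic in $x$, with only real $x$-roots for real $(y,t)$; $C_w=\{h_w=0\}\subset\mathbf P^2_{\mathbb R}$. $D_w(y,t)=\operatorname{Disc}_xh_w(x,y,t)$, a nonzero binary form of degree $n(n-1)$; its projective zeros are the points $[y:t]\in\mathbf P^1(\mathbb C)$ where it vanishes. $L_{\alpha,\beta}=\operatorname{span}\{\mathbf 1_n\oplus0,\ 0\oplus\mathbf 1_n,\ \alpha^\circ\oplus\beta^\circ\}$, where $\mathbf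 1_n$ is the all-ones vector and $\rho^\circ=\rho-\left(\frac1n\sum_i\rho_i\right)\mathbf 1_n$. $\Sigma_r$ is the set of $w\in\mathbb R^{2n}$ for which some $[y:t]\in\mathbf P^1(\mathbb R)$ makes $h_w(\cdot,y,t)$ have a root of multiplicity at least $r$. There is at most one $[y:t]\in\mathbf P^1(\mathbb R)$ at which $h_w(\cdot,y,t)$ has a repeated root; the fiber of $C_w$ over it is the real collision fiber. An ordinary $m$-fold point is one whose lowest-degree homogeneous term in local affine coordinates is a product of $m$ pairwise nonproportional linear forms. Absolutely irreducible means irreducible over $\mathbb C$. *)

(* Defs.v *)
From HB Require Import structures.
From mathcomp Require Import all_boot all_order all_algebra.
From mathcomp Require Import complex mpoly.
From mathcomp Require Import reals.

Set Implicit Arguments.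
Unset Strict Implicit.
Unset Printing Implicit Defensive.

Import Order.TTheory GRing.Theory Num.Theory.

Local Open Scope ring_scope.
Local Open Scope complex_scope.

Section FiniteFreeConvolution.
Variables (K : fieldType) (A : comAlgType K) (n : nat).

(* a_k in p = \sum_(k <= n) (-1)^k a_k X^(n-k) *)
Definition signed_coef (p : {poly A}) (k : nat) : A := (-1) ^+ k * p`_(n - k).

Definition ffconv_coef (p q : {poly A}) (k : nat) : A :=
  \sum_(i < k.+1)
    ((n - i)`!%:R * (n - (k - i))`!%:R / (n`!%:R * (n - k)`!%:R) : K)
      *: (signed_coef p i * signed_coef q (k - i)).

Definition ffconv (p q : {poly A}) : {poly A} :=
  \sum_(k < n.+1) ((-1) ^+ k * ffconv_coef p q k) *: 'X^(n - k).

Definition poly_of_roots (rho : 'I_n -> A) : {poly A} :=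
  \prod_(i < n) ('X - (rho i)%:P).

End FiniteFreeConvolution.

(* Discriminant of a monic polynomial. *)
Definition monic_disc (A : comNzRingType) (p : {poly A}) : A :=
  (-1) ^+ 'C((size p).-1, 2) * resultant p p^`().

Definition irreducible_mpoly (K : fieldType) (m : nat) (f : {mpoly K[m]}) :=
  [/\ f != 0, f \isn't a GRing.unit
    & forall g h, f = g * h -> g \is a GRing.unit \/ h \is a GRing.unit].

Section PlaneCurves.
Variable K : fieldType.
Implicit Types (f : {mpoly K[3]}) (P : 'rV[K]_3).

(* Homogeneous coordinates are in the order (x, y, t). *)
Definition proj_pt (x y t : K) : 'rV[K]_3 := \row_j tnth [tuple x; y; t] j.

Definition singular_point f P :=
  [/\ P != 0, f.@[P 0] = 0 & forall i, (f^`M(i)).@[P 0] = 0].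

(* f in the affine coordinates X_j / X_i - P_j / P_i, j != i, of the chart
   X_i != 0; these vanish at P. *)
Definition local_equation (i : 'I_3) f P : {mpoly K[2]} :=
  f \mPo [tuple (if unlift i j is Some k
                  then (P 0 j / P 0 i)%:MP + 'X_(k : 'I_2) else 1
                  : {mpoly K[2]}) | j < 3].

Definition ordinary_point (m : nat) f P :=
  exists2 i : 'I_3, P 0 i != 0 &
    let g := local_equation i f P in
    [/\ forall d, (d < m)%N -> pihomog mdeg d g = 0,
        pihomog mdeg m g != 0
      & exists l : 'I_m -> {mpoly K[2]},
          [/\ forall a, l a \is 1.-homog,
              forall a b, a != b -> forall c, l a != c *: l b
            & pihomog mdeg m g = \prod_(a < m) l a]].

End PlaneCurves.

Section RealForms.
Variable R : realType.

Definition complexify (m : nat) (f : {mpoly R[m]}) : {mpoly R[i][m]} :=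
  map_mpoly (real_complex R) f.

Definition absolutely_irreducible (m : nat) (f : {mpoly R[m]}) :=
  irreducible_mpoly (complexify f).

(* Number of non-real zeros in P^1(C), with multiplicity, of a nonzero binary
   form D(y, t). As [1 : 0] is real, they all lie in the chart t = 1, where
   [z : 1] has the multiplicity of the root z of D('X, 1). *)
Definition nonreal_zeros (D : {mpoly R[2]}) : nat :=
  let d : {poly R[i]} :=
    mmap (fun c : R => (c%:C)%:P) (tnth [tuple 'X; 1]) D in
  count (fun z : R[i] => complex.Im z != 0)
        (sval (closed_field_poly_normal d)).

Definition has_root_mult (r : nat) (p : {poly R}) :=
  exists x : R, ('X - x%:P) ^+ r %| p.

(* For h irreducible: the normalization of the curve {h = 0} in P^2_R is
   isomorphic to P^1_R, i.e. there is a birational morphism F from P^1_R to the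
   curve. F is given by three binary forms of equal degree without common
   complex zero; its inverse G, a rational map to P^1_R, by two ternary forms
   of equal degree. The last two clauses say that G o F = id on P^1_R and
   F o G = id on the curve. As P^1_R is normal and a non-constant morphism from
   P^1_R to a curve is finite, such an F is the normalization morphism. *)
Definition normalization_is_P1 (h : {mpoly R[3]}) :=
  exists (d e : nat) (F : 3.-tuple {mpoly R[2]}) (G : 2.-tuple {mpoly R[3]}),
    [/\ (forall i, tnth F i \is d.-homog) /\ (forall k, tnth G k \is e.-homog),
        forall v : 'rV[R[i]]_2, v != 0 ->
          exists i, (complexify (tnth F i)).@[v 0] != 0,
        h \mPo F = 0,
        exists2 H : {mpoly R[2]}, H != 0 &
          forall k, tnth G k \mPo F = H * 'X_k
      & forall i j, exists Q : {mpoly R[3]},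
          (tnth F i \mPo G) * 'X_j - (tnth F j \mPo G) * 'X_i = Q * h].

End RealForms.

Section Pencil.
Variables (R : realType) (n : nat).
Implicit Types (alpha beta : 'rV[R]_n) (w : 'rV[R]_(n + n)).

(* h_w as a polynomial in x over R[y, t], with y = 'X_0 and t = 'X_1. *)
Definition hpoly alpha beta w : {poly {mpoly R[2]}} :=
  let y : {mpoly R[2]} := 'X_0 in
  let t : {mpoly R[2]} := 'X_1 in
  ffconv n
    (poly_of_roots (fun i => alpha 0 i *: y + lsubmx w 0 i *: t))
    (poly_of_roots (fun i => beta 0 i *: y + rsubmx w 0 i *: t)).

(* The same polynomial as a ternary form in (x, y, t). *)
Definition hform alpha beta w : {mpoly R[3]} :=
  (map_poly (fun c => c \mPo [tuple 'X_1; 'X_2]) (hpoly alpha beta w)).['X_0].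

Definition hfiber alpha beta w (y t : R) : {poly R} :=
  map_poly (meval (tnth [tuple y; t])) (hpoly alpha beta w).

Definition Ddisc alpha beta w : {mpoly R[2]} :=
  monic_disc (hpoly alpha beta w).

Definition centered (rho : 'rV[R]_n) : 'rV[R]_n :=
  rho - const_mx (n%:R^-1 * \sum_i rho 0 i).

Definition Lspace alpha beta : {vspace 'rV[R]_(n + n)} :=
  <<[:: row_mx (const_mx 1) 0; row_mx 0 (const_mx 1);
        row_mx (centered alpha) (centered beta)]>>%VS.

Definition in_Sigma alpha beta (r : nat) w :=
  exists y t : R,
    (y, t) != (0, 0) /\ has_root_mult r (hfiber alpha beta w y t).

Definition real_collision_fiber alpha beta w (y t : R) :=
  [/\ (y, t) != (0, 0), has_root_mult 2 (hfiber alpha beta w y t)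
    & forall y' t' : R, (y', t') != (0, 0) ->
        has_root_mult 2 (hfiber alpha beta w y' t') -> y' * t = y * t'].

End Pencil.

(* Main.v *)
(** For p = \prod_i (X - a_i) and deg q <= n, n! (p [+]_n q) is the sum of
    q^(n-k)(0) p^(k), and dividing p by X - a amounts to replacing q by its polar
    derivative n q - (X + a) q'.  Induction on the a_i with Laguerre's theorem gives
    the boundary case of Grace's theorem: if q has its roots in the closed lower
    half-plane, not all real, and the pairing of p and q vanishes, then some real a
    has mult_a(p) + mult_(-a)(q) > n.  Applied to translates of q and of q + i q',
    it shows that p [+]_n q is real-rooted when p and q are, and that a root c of
    multiplicity m >= 2 comes from roots a + b = c with
    mult_a(p) + mult_b(q) = n + m.  As alpha and beta are injective, at most one real
    fiber has a repeated root, and a root of multiplicity n forces w into L.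

    Blowing up a root c of multiplicity m of the collision fiber, the local equation
    is a finite free convolution of polynomials with simple real roots, hence the m
    branches through c have distinct real slopes.  So the discriminant vanishes
    there to order exactly \sum m (m - 1) over the roots of the fiber; its degree is
    n (n - 1), and for w outside L the order is at most (n - 1) (n - 2), with
    equality iff some m = n - 1.

    If m = n - 1, one of the two root vectors is constant in the collision fiber and
    the other one has a single exceptional entry.  In the coordinates
    X = x - c t, Y = y - y0 t the form is then k t S(X, Y) + T(X, Y), where S and T
    are products of real linear forms of degrees n - 1 and n, S without repeated
    factor; moving the exceptional root off the real axis, Grace's theorem shows
    that S and T are coprime.  The rest can be read off from this equation. *)
Require Import Defs.
From HB Require Import structures.
From mathcomp Require Import all_boot all_order all_algebra.
From mathcomp Require Import complex mpoly.
From mathcomp Require Import reals.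
From mathcomp Require Import polyorder polyrcf.
From mathcomp Require boolp.
From mathcomp Require Import zify ring lra.

Set Implicit Arguments.
Unset Strict Implicit.
Unset Printing Implicit Defensive.

Import Order.TTheory GRing.Theory Num.Theory.

Local Open Scope ring_scope.
Local Open Scope complex_scope.

(** * Convolution in terms of derivatives *)

(** The perturbation q + i q' packs a repeated root into one vanishing pairing. With H the
    convolution of p and q, the pairing of p with the translate of q + i q' by c is H(c) + i H'(c),
    and at a real zero the multiplicity of q + i q' is one less than that of q. So Grace's bound,
    multiplicity above n, becomes at least n + 2. The order of the discriminant is found without
    power series for the branches. For small t > 0 each branch is only located, to any precision, by
    the intermediate value theorem, and two-sided bounds by powers of t fix the order. This uses
    that all n roots are real: the n located roots fill the fiber. The same bounds at t = 0, where
    the roots are simple, give the degree n (n - 1). Every real zero of the discriminant is a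
    collision fiber, so the non-real zeros number n (n - 1) minus the order there, and 2 n - 2 is n
    (n - 1) - (n - 1) (n - 2). *)

Section DerivConvolution.
Variable A : comNzRingType.
Implicit Types (p q : {poly A}) (n k : nat) (a : A).

(** Free of division, so it makes sense over rings of polynomials and commutes with every ring
    morphism ([map_dconv]): one formula serves the forms in y and t, their fibers and the
    blow-ups. *)
Definition dconv n p q := \sum_(k < n.+1) q^`(n - k).[0] *: p^`(k).

Lemma dconv_is_linearr n p : linear (dconv n p).
Proof.
move=> a q1 q2; rewrite /dconv scaler_sumr -big_split /=.
by apply: eq_bigr => k _; rewrite linearP /= !hornerE scalerDl scalerA.
Qed.
HB.instance Definition _ n p :=
  GRing.isLinear.Build A {poly A} {poly A} *:%R (dconv n p)
    (dconv_is_linearr n p).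

Lemma dconvZl n a p q : dconv n (a *: p) q = a *: dconv n p q.
Proof.
by rewrite /dconv scaler_sumr; apply: eq_bigr => k _; rewrite linearZ /= !scalerA mulrC.
Qed.

Lemma derivn_mulXsub p a k :
  (('X - a%:P) * p)^`(k).[0] = p^`(k.-1).[0] *+ k - a * p^`(k).[0].
Proof.
case: k => [|k]; first by rewrite !derivn0 hornerM hornerXsubC mulr0n !sub0r mulNr.
have -> : ('X - a%:P) * p = (p * 'X + 0%:P) - a *: p.
  by rewrite mulrBl ['X * _]mulrC mul_polyC polyC0 addr0.
by rewrite derivnB derivnMXaddC derivnZ !hornerE hornerMn.
Qed.

(* The polar derivative n q - (X + a) q' takes over the role of the factor X - a. *)
Lemma dconv_XsubC n a p q : (size p <= n.+1)%N ->
  (dconv n.+1 (('X - a%:P) * p) q).[0]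
  = (dconv n p (n.+1%:R *: q - ('X + a%:P) * q^`())).[0].
Proof.
move=> szp; rewrite /dconv !horner_sum.
under eq_bigr do rewrite hornerZ derivn_mulXsub mulrBr.
rewrite sumrB big_ord_recl /= mulr0n mulr0 add0r [X in _ - X]big_ord_recr /=.
rewrite -derivnS (poly.derivn_poly0 szp) horner0 !mulr0 addr0 -sumrB; apply: eq_bigr => k _ /=.
have -> : ('X + a%:P) * q^`() = ('X - (- a)%:P) * q^`() by rewrite polyCN opprK.
rewrite hornerZ derivnB derivnZ hornerD hornerN hornerZ derivn_mulXsub.
rewrite -!derivSn subSS; have kn : (k <= n)%N by rewrite -ltnS.
rewrite mulNr opprK subSn //; set d := q^`(_.+1).[0].
have -> : q^`((n - k).-1.+1).[0] *+ (n - k) = q^`(n - k).[0] *+ (n - k).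
  by case: (n - k)%N => [|j] //=; rewrite !mulr0n.
rewrite -[k in _ *+ bump _ k]/(k : nat) /bump /= add1n.
have -> : n.+1%:R = k.+1%:R + (n - k)%:R :> A by rewrite -natrD addSn subnKC.
rewrite -mulr_natr -[_ *+ (n - k)]mulr_natr.
by ring.
Qed.

Lemma dconv_deriv n p q : (size p <= n.+1)%N -> (size q <= n.+1)%N ->
  dconv n p q^`() = (dconv n p q)^`().
Proof.
move=> szp szq; rewrite /dconv raddf_sum /= big_ord_recl big_ord_recr /= subn0 subnn.
rewrite -derivSn (poly.derivn_poly0 szq) horner0 scale0r add0r derivZ -derivnS.
rewrite (poly.derivn_poly0 szp) scaler0 addr0; apply: eq_bigr => k _ /=.
by rewrite derivZ -derivnS -derivSn /bump add1n subnSK.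
Qed.

Lemma dconv_compXaddl n p q a :
  dconv n (p \Po ('X + a%:P)) q = dconv n p q \Po ('X + a%:P).
Proof.
rewrite /dconv raddf_sum /=; apply: eq_bigr => k _; rewrite comp_polyZ; congr (_ *: _).
elim: (k : nat) => [|j IH]; first by rewrite !derivn0.
by rewrite !derivnS IH deriv_comp derivD derivX derivC addr0 mulr1.
Qed.

Lemma derivn_compZX p a k :
  (p \Po (a *: 'X))^`(k) = a ^+ k *: (p^`(k) \Po (a *: 'X)).
Proof.
elim: k => [|k IH]; first by rewrite !derivn0 scale1r.
rewrite !derivnS IH derivZ deriv_comp derivZ derivX exprS mulrC -scalerA.
by rewrite -scalerAl mul1r !scalerA mulrC.
Qed.

Lemma dconv_compZX n p q a :
  dconv n (p \Po (a *: 'X)) (q \Po (a *: 'X)) = a ^+ n *: (dconv n p q \Po (a *: 'X)).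
Proof.
rewrite /dconv raddf_sum /= scaler_sumr; apply: eq_bigr => k _.
rewrite !derivn_compZX comp_polyZ !scalerA hornerZ horner_comp !hornerE.
by rewrite mulrAC -exprD subnK // -ltnS.
Qed.

End DerivConvolution.

(** * Multiplicities under derivative and polar derivative *)

Section Multiplicity.
Variable F : numFieldType.
Implicit Types (p q : {poly F}) (x : F).

Lemma mup_spec x q : q != 0 ->
  exists2 s, ~~ root s x & q = s * ('X - x%:P) ^+ mup x q.
Proof.
move=> q0; have [m [s]] := multiplicity_XsubC q x; rewrite q0 /= => sx qE.
by exists s => //; rewrite {2}qE mupMr // mup_XsubCX eqxx.
Qed.

Lemma mup_gt0 x q : q != 0 -> (0 < mup x q)%N = root q x.
Proof. by move=> q0; rewrite -XsubC_dvd // dvdp_XsubCl. Qed.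

Lemma mup_addl x p q : p != 0 -> q != 0 -> (mup x p < mup x q)%N ->
  mup x (p + q) = mup x p.
Proof.
move=> p0 q0 lt_pq.
have ndvd : ~~ (('X - x%:P) ^+ (mup x p).+1 %| p + q).
  by rewrite dvdp_addl -?mup_geq // ltnn.
have pq0 : p + q != 0 by apply: contraNneq ndvd => ->; rewrite dvdp0.
apply/eqP; rewrite eqn_leq mup_leq // ndvd mup_geq // dvdp_add // -mup_geq //.
exact: ltnW.
Qed.

Lemma mupZ x c p : c != 0 -> mup x (c *: p) = mup x p.
Proof. by move=> c0; rewrite -mul_polyC mupMr // rootC. Qed.

Lemma mup_deriv x q : q != 0 -> root q x ->
  q^`() != 0 /\ mup x q = (mup x q^`()).+1.
Proof.
move=> q0 qx; have [s sx qE] := mup_spec x q0.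
have: (0 < mup x q)%N by rewrite mup_gt0.
case Dm: (mup x q) => [//|m] _; rewrite {}Dm in qE.
set t := s^`() * ('X - x%:P) + m.+1%:R *: s.
have -> : q^`() = t * ('X - x%:P) ^+ m.
  rewrite qE derivM deriv_exp derivXsubC mul1r /t mulrDl exprS mulrA; congr (_ + _).
  by rewrite -scalerAl scaler_nat -mulrnAr.
have tx : ~~ root t x.
  rewrite rootE hornerD hornerM hornerZ hornerXsubC.
  by rewrite subrr mulr0 add0r mulf_neq0 // pnatr_eq0.
split; last by rewrite mupMr ?mup_XsubCX ?eqxx.
rewrite mulf_neq0 ?expf_neq0 ?polyXsubC_eq0 //.
by apply: contraNneq tx => ->; rewrite root0.
Qed.

Definition polar n (a : F) q := n%:R *: q - ('X + a%:P) * q^`().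

Lemma polarZ n a c q : polar n a (c *: q) = c *: polar n a q.
Proof. by rewrite /polar derivZ -scalerAr scalerBr !scalerA mulrC. Qed.

(** Away from the pole - a, the summand (X + a) q' has multiplicity one less than n q at the root,
    and therefore decides. *)
Lemma mup_polar n a x q : q != 0 -> root q x -> x != - a ->
  mup x q = (mup x (polar n a q)).+1.
Proof.
move=> q0 qx xa; have [q'0 mq] := mup_deriv q0 qx; rewrite mq; congr S.
have Xa0 : ~~ root ('X + a%:P) x.
  by rewrite rootE !hornerE addr_eq0.
have Xa_neq0 : 'X + a%:P != 0 by apply: contraNneq Xa0 => ->; rewrite root0.
have mX : mup x (- (('X + a%:P) * q^`())) = mup x q^`().
  by rewrite -mulNr mupMr // rootN.
rewrite /polar addrC; case: n => [|n]; first by rewrite scale0r addr0.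
rewrite mup_addl ?scaler_eq0 ?oppr_eq0 ?mulf_neq0 ?pnatr_eq0 //.
by rewrite mX mupZ ?pnatr_eq0 // mq.
Qed.

(** With q = s (X + a)^b the polar derivative is ((n - b) s - (X + a) s') (X + a)^b, whose first
    factor takes the value (n - b) s(-a) at - a. For b = n the degree bound makes s constant and the
    polar derivative zero, which is excluded. *)
Lemma mup_polar_pole n a q : (size q <= n.+1)%N -> q != 0 -> polar n a q != 0 ->
  root q (- a) -> (mup (- a) (polar n a q) <= mup (- a) q)%N.
Proof.
move=> szq q0; have [s sx] := mup_spec (- a) q0; rewrite polyCN opprK.
move Db: (mup (- a) q) => b qE.
have s0 : s != 0 by apply: contraNneq sx => ->; rewrite root0.
have -> : polar n a q = (n%:R *: s - b%:R *: s - ('X + a%:P) * s^`()) * ('X + a%:P) ^+ b.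
  rewrite /polar qE derivM deriv_exp derivD derivX derivC addr0 mul1r.
  case: b {Db qE} => [|b]; first by rewrite scale0r subr0 mulr0n mulr0 addr0 expr0 !mulr1.
  rewrite /= -!scaler_nat -!mul_polyC exprS; ring.
have szb : (size s + b <= n.+1)%N.
  rewrite qE size_Mmonic ?monic_exp ?monicXaddC // in szq.
  by move: szq; rewrite -[a]opprK polyCN size_exp_XsubC addnS.
have mXa : mup (- a) (('X + a%:P) ^+ b) = b.
  by rewrite -[a in 'X + a%:P]opprK polyCN mup_XsubCX eqxx.
have [bn|bn] := eqVneq b n.
  have /size_poly1P[c c0 ->] : size s == 1%N.
    by move: (size_poly_gt0 s); rewrite s0; lia.
  by rewrite bn subrr derivC mulr0 subr0 mul0r eqxx.
move=> nz _; rewrite mupMr ?mXa // rootE !hornerE addNr mul0r subr0 -mulrBl.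
by rewrite mulf_neq0 // subr_eq0 eqr_nat eq_sym.
Qed.
End Multiplicity.

(** * Laguerre's theorem and the boundary case of Grace's theorem *)

Lemma deriv_prod_XsubC (F : fieldType) (l : seq F) (z : F) : z \notin l ->
  (\prod_(r <- l) ('X - r%:P))^`().[z]
  = (\prod_(r <- l) ('X - r%:P)).[z] * \sum_(r <- l) (z - r)^-1.
Proof.
elim: l => [|r l IH]; first by rewrite !big_nil derivC hornerC mulr0.
rewrite inE negb_or => /andP[zr zl]; rewrite !big_cons derivM derivXsubC mul1r.
rewrite hornerD !hornerM hornerXsubC {}IH // mulrDr.
by rewrite mulrAC mulfV ?subr_eq0 // mul1r mulrA.
Qed.

Section Grace.
Variable R : rcfType.
Local Notation C := R[i].
Local Notation Re := (@complex.Re R).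
Local Notation Im := (@complex.Im R).

Lemma complex_ReD (x y : C) : Re (x + y) = Re x + Re y. Proof. by case: x y => [? ?] []. Qed.
Lemma complex_ImD (x y : C) : Im (x + y) = Im x + Im y. Proof. by case: x y => [? ?] []. Qed.

Lemma complex_Re_sum (I : Type) (l : seq I) (f : I -> C) :
  Re (\sum_(x <- l) f x) = \sum_(x <- l) Re (f x).
Proof. exact: (big_morph Re complex_ReD). Qed.
Lemma complex_Im_sum (I : Type) (l : seq I) (f : I -> C) :
  Im (\sum_(x <- l) f x) = \sum_(x <- l) Im (f x).
Proof. exact: (big_morph Im complex_ImD). Qed.

Lemma sum_lt0 (l : seq C) (f : C -> R) :
  {in l, forall r, f r <= 0} -> {r | r \in l & f r < 0} -> \sum_(r <- l) f r < 0.
Proof.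
move=> f_le0 [r rl fr]; rewrite (big_rem r) //=.
apply: ltr_wnDr => //; rewrite big_seq; apply: sumr_le0 => x /mem_rem.
exact: f_le0.
Qed.

Definition sqn (z : C) : R := Re z ^+ 2 + Im z ^+ 2.

Lemma sqn_gt0 z : z != 0 -> 0 < sqn z.
Proof.
case: z => x y; rewrite eq_complex /= negb_and /sqn /= => /orP[h|h].
  by rewrite ltr_wpDr ?sqr_ge0 // exprn_even_gt0.
by rewrite ltr_wpDl ?sqr_ge0 // exprn_even_gt0.
Qed.

Lemma complex_ReV z : Re z^-1 = Re z / sqn z. Proof. by case: z. Qed.
Lemma complex_ImV z : Im z^-1 = - Im z / sqn z. Proof. by case: z => x y /=; rewrite mulNr. Qed.

(* The points w = 1 / (z - r), Im r <= 0, fill the disc (or half-plane)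
   Im z * |w|^2 + Im w <= 0, whose boundary contains 1 / (z + a). *)
Lemma disc_inv (y : R) z : z != 0 ->
  y * sqn z^-1 + Im z^-1 = (y - Im z) / sqn z.
Proof.
move=> z0; have nz : sqn z != 0 by rewrite gt_eqF // sqn_gt0.
by rewrite [sqn z^-1]/sqn complex_ReV complex_ImV; rewrite /sqn in nz *; field.
Qed.

(** A zero z of the polar derivative outside [l] makes w0 = 1 / (z + a) the mean of the points 1 /
    (z - r). These all lie in the disc (a half-plane for real z) with w0 on its boundary, and one of
    them is interior, so w0 cannot be their mean. *)
Lemma laguerre (l : seq C) (a : R) (z : C) :
  {in l, forall r, Im r <= 0} -> {r | r \in l & Im r < 0} -> 0 <= Im z ->
  root (polar (size l) a%:C (\prod_(r <- l) ('X - r%:P))) z -> z \in l.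
Proof.
move=> l_le0 l_lt0 z_ge0; apply: contraLR => zl; set q := \prod_(r <- l) _.
have qz : q.[z] != 0.
  by have := root_prod_XsubC l z; rewrite rootE -/q (negPf zl) => ->.
rewrite rootE /polar !hornerE deriv_prod_XsubC // -/q.
set S := \sum_(r <- l) _; have -> : (size l)%:R * q.[z] - (z + a%:C) * (q.[z] * S)
  = q.[z] * ((size l)%:R - (z + a%:C) * S) by ring.
rewrite mulf_neq0 //; apply/eqP => /subr0_eq nE.
have n0 : (size l)%:R != 0 :> C.
  by case: l_lt0 => r; case: (l) => //= *; rewrite pnatr_eq0.
have za : z + a%:C != 0 by apply: contraNneq n0 => za; rewrite nE za mul0r.
pose w0 := (z + a%:C)^-1.
have SE : S = (size l)%:R * w0 by rewrite nE /w0 mulrAC mulfV // mul1r.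
have w0E : Im z * sqn w0 + Im w0 = 0.
  by rewrite /w0 disc_inv // complex_ImD /= addr0 subrr mul0r.
(* The tangent line at w0: [psi] is affine, zero at w0, and equals the function defining the disc
   minus Im z times the squared distance to w0. *)
pose psi w := 2 * Im z * (Re w * Re w0 + Im w * Im w0) + Im w - Im z * sqn w0.
have psiE w : psi w = Im z * sqn w + Im w - Im z * ((Re w - Re w0) ^+ 2 + (Im w - Im w0) ^+ 2).
  by rewrite /psi /sqn; ring.
have psi_le r : r \in l -> psi (z - r)^-1 <= Im r / sqn (z - r).
  move=> rl; have zr : z - r != 0 by rewrite subr_eq0; apply: contraNneq zl => ->.
  rewrite psiE disc_inv //; have -> : Im z - Im (z - r) = Im r.
    by case: (z) (r) => [? ?] [? ?] /=; ring.
  by rewrite gerBl mulr_ge0 // addr_ge0 // sqr_ge0.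
have : \sum_(r <- l) psi (z - r)^-1 < 0.
  apply: le_lt_trans (_ : \sum_(r <- l) Im r / sqn (z - r) < 0).
    by rewrite !big_seq; apply: ler_sum.
  have sqn_gt r : r \in l -> 0 < sqn (z - r).
    by move=> rl; rewrite sqn_gt0 // subr_eq0; apply: contraNneq zl => ->.
  apply: sum_lt0 => [r rl|]; first by rewrite pmulr_lle0 ?invr_gt0 ?sqn_gt ?l_le0.
  by case: l_lt0 => r rl r0; exists r => //; rewrite pmulr_llt0 ?invr_gt0 ?sqn_gt.
have nC (w : C) : Re ((size l)%:R * w) = (size l)%:R * Re w /\ Im ((size l)%:R * w) = (size l)%:R * Im w.
  rewrite !mulr_natl; elim: (size l) => [|m [IH1 IH2]]; first by rewrite !mulr0n.
  by rewrite !mulrSr complex_ReD complex_ImD IH1 IH2.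
have [SRe SIm] := nC w0; rewrite -SE /S complex_Re_sum complex_Im_sum in SRe SIm.
rewrite /psi; set B := Im z * sqn w0.
have -> : \sum_(r <- l) (2 * Im z * (Re (z - r)^-1 * Re w0 + Im (z - r)^-1 * Im w0)
     + Im (z - r)^-1 - B) = 2 * Im z * Re w0 * \sum_(r <- l) Re (z - r)^-1
   + (2 * Im z * Im w0 + 1) * \sum_(r <- l) Im (z - r)^-1 - (size l)%:R * B.
  have -> : (size l)%:R * B = \sum_(r <- l) B.
    by rewrite big_const_seq count_predT iter_addr_0 mulr_natl.
  rewrite !mulr_sumr -!big_split -sumrB /=; apply: eq_bigr => r _; ring.
rewrite SRe SIm /B; set N := (size l)%:R.
have -> : 2 * Im z * Re w0 * (N * Re w0) + (2 * Im z * Im w0 + 1) * (N * Im w0)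
   - N * (Im z * sqn w0) = N * (Im z * sqn w0 + Im w0) by rewrite /sqn; ring.
by rewrite w0E mulr0 ltxx.
Qed.
End Grace.

(** With n = [size l], the X^n terms cancel and the coefficient of X^(n-1) is - (n a + sum of the
    roots). *)
Lemma size_polar (F : numFieldType) (l : seq F) (a : F) : l != [::] ->
  (size l)%:R * a + \sum_(r <- l) r != 0 ->
  size (polar (size l) a (\prod_(r <- l) ('X - r%:P))) = size l.
Proof.
case: l => [//|r0 l] _; set s := r0 :: l; set q := \prod_(r <- s) _ => nz.
have szq : size q = (size s).+1 by rewrite size_prod_XsubC.
have q_lead : q`_(size s) = 1.
  by have /monicP := monic_prod_XsubC s xpredT id; rewrite /lead_coef szq.
have coefE i : (polar (size s) a q)`_i
    = (size s)%:R * q`_i - (i%:R * q`_i + a * (q`_i.+1 *+ i.+1)).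
  rewrite /polar coefB coefZ mulrDl coefD coefCM coef_deriv mulrC coefXM.
  by case: i => [|i] /=; rewrite ?coefXM ?coefMX ?coef_deriv /= ?mul0r ?mulr_natl // mulrC mulr_natr.
apply/eqP; rewrite eqn_leq; apply/andP; split.
  apply/leq_sizeP => j; rewrite leq_eqVlt coefE => /orP[/eqP <-|ltj].
    by rewrite [q`__.+1]nth_default ?szq // mul0rn mulr0 addr0 subrr.
  by rewrite ![q`__]nth_default ?szq //= ?mul0rn ?mulr0 ?addr0 ?subrr // ltnW.
rewrite ltnNge; apply: contra nz => /leq_sizeP/(_ (size l) (leqnn _)) /eqP.
rewrite coefE (coefPn_prod_XsubC (ps := s)) // q_lead -mulr_natl mulr1 /=.
set S := \sum_(j <- _) j => h; rewrite -oppr_eq0 -(eqP h) -natr1.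
by apply/eqP; ring.
Qed.

Lemma count_leq_size (T : eqType) (s1 s2 : seq T) :
  (forall x, (count_mem x s1 <= count_mem x s2)%N) -> (size s1 <= size s2)%N.
Proof.
by move=> /count_subseqP[s ss /perm_size ->]; apply: size_subseq.
Qed.

Section GraceBoundary.
Variable R : rcfType.
Local Notation C := R[i].
Local Notation Im := (@complex.Im R).

Definition cprod (s : seq R) : {poly C} := \prod_(a <- s) ('X - a%:C%:P).

Lemma size_cprod s : size (cprod s) = (size s).+1.
Proof. exact: size_prod_XsubC. Qed.

Lemma dconv_cprod_cons a s q :
  (dconv (size s).+1 (cprod (a :: s)) q).[0]
  = (dconv (size s) (cprod s) (polar (size s).+1 a%:C q)).[0].
Proof. by rewrite /cprod big_cons dconv_XsubC ?size_cprod. Qed.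

(** Each polar step sends c (X - b)^n to - c n (a + b) (X - b)^(n-1), so the pairing is a nonzero
    multiple of the product of the factors a + b. *)
Lemma dconv_exp_XsubC s (b c : C) : c != 0 ->
  (dconv (size s) (cprod s) (c *: ('X - b%:P) ^+ size s)).[0] = 0 ->
  exists2 a, a \in s & b = - a%:C.
Proof.
elim: s c => [|a s IH] c c0 /=.
  rewrite /dconv big_ord_recl big_ord0 /cprod big_nil expr0 subnn !derivn0 !hornerE.
  by move=> /eqP; rewrite (negPf c0).
have [->|ba] := eqVneq b (- a%:C); first by exists a => //; rewrite inE eqxx.
rewrite dconv_cprod_cons.
have -> : polar (size s).+1 a%:C (c *: ('X - b%:P) ^+ (size s).+1)
    = (- (c * (size s).+1%:R * (a%:C + b))) *: ('X - b%:P) ^+ size s.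
  rewrite polarZ /polar deriv_exp derivXsubC mul1r /= -scaler_nat -!mul_polyC.
  by rewrite exprS; rewrite !(polyCM, polyCD, polyCN); ring.
case/IH => [|a' a's ->]; last by exists a' => //; rewrite inE a's orbT.
by rewrite oppr_eq0 !mulf_neq0 ?pnatr_eq0 // addrC addr_eq0.
Qed.

(** Removing a from the sequence replaces q by its polar derivative f, whose roots stay in the
    closed lower half-plane and whose real roots are roots of q. If f has a non-real root, the
    induction hypothesis applies. Otherwise counting roots forces f to be a multiple of a power of X
    + a, and the vanishing pairing shows that a occurs again in the rest of the sequence. *)
Lemma grace_boundary (s : seq R) (q : {poly C}) :
  size q = (size s).+1 -> (forall z, root q z -> Im z <= 0) ->
  (exists z, root q z /\ Im z < 0) -> (dconv (size s) (cprod s) q).[0] = 0 ->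
  exists a : R, (size s < count_mem a s + mup (- a%:C) q)%N.
Proof.
elim: s q => [|a s IH] q szq q_le0 [rho [q_rho rho_lt0]].
  by have/eqP/size_poly1P[c c0 qc] := szq; rewrite qc rootC (negPf c0) in q_rho.
have [l qE] := closed_field_poly_normal q; set c := lead_coef q in qE.
have q0 : q != 0 by rewrite -size_poly_eq0 szq.
have c0 : c != 0 by rewrite lead_coef_eq0.
set g := \prod_(z <- l) ('X - z%:P) in qE.
have szl : size l = (size s).+1.
  by apply: succn_inj; rewrite -(size_prod_XsubC _ id) -[RHS]szq qE size_scale.
have rootq z : root q z = (z \in l) by rewrite qE rootZ // root_prod_XsubC.
have mupq z : mup z q = count_mem z l by rewrite qE mupZ // mu_prod_XsubC.
rewrite /= dconv_cprod_cons; set f := polar _ _ q.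
have l_le0 : {in l, forall r, Im r <= 0} by move=> r; rewrite -rootq => /q_le0.
have l_lt0 : {r | r \in l & Im r < 0} by exists rho; rewrite -?rootq.
have fE : f = c *: polar (size l) a%:C g by rewrite /f qE polarZ szl.
(* The sum of the roots of q has negative imaginary part, so it cannot cancel the real number n a:
   the degree drops by exactly one. *)
have szf : size f = (size s).+1.
  rewrite fE size_scale // size_polar ?szl //; first by rewrite -size_eq0 szl.
  apply: contraTneq (sum_lt0 l_le0 l_lt0) => /(congr1 Im) /=.
  rewrite -szl mulr_natl complex_ImD -(complex_Im_sum l id).
  have -> : Im (a%:C *+ size l) = 0.
    by elim: (size l) => [//|k IHk]; rewrite mulrS complex_ImD IHk /= addr0.
  by rewrite add0r => ->; rewrite ltxx.
have f0 : f != 0 by rewrite -size_poly_eq0 szf.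
have f_root z : root f z -> 0 <= Im z -> root q z.
  by rewrite fE rootZ // rootq => /laguerre h z0; apply: h.
have f_le0 z : root f z -> Im z <= 0.
  by move=> fz; rewrite leNgt; apply/negP => z0; move: (q_le0 z (f_root z fz (ltW z0))); rewrite leNgt z0.
have [m fm] := closed_field_poly_normal f; set d := lead_coef f in fm.
have d0 : d != 0 by rewrite lead_coef_eq0.
have rootf z : root f z = (z \in m) by rewrite fm rootZ // root_prod_XsubC.
have mupf z : mup z f = count_mem z m by rewrite fm mupZ // mu_prod_XsubC.
have szm : size m = size s.
  by apply: succn_inj; rewrite -(size_prod_XsubC _ id) -szf fm size_scale.
have f_pole : root q (- a%:C) -> (mup (- a%:C) f <= mup (- a%:C) q)%N.
  by move=> qa; rewrite mup_polar_pole ?szq.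
(* A witness for f becomes one for q: at the pole the gain of one is the entry a itself, elsewhere
   the multiplicity of the root rises by one from f to q. *)
have finish b : (size s < count_mem b s + mup (- b%:C) f)%N ->
    exists a', ((size s).+1 < (a == a') + count_mem a' s + mup (- a'%:C) q)%N.
  move=> hb; exists b; have fb : root f (- b%:C).
    rewrite -mup_gt0 // lt0n; apply: contraTneq hb => ->.
    by rewrite addn0 -leqNgt count_size.
  have qb : root q (- b%:C) by apply: f_root => //=; rewrite oppr0.
  have [abE|ab] := eqVneq a b.
    rewrite add1n ltnS; apply: leq_trans hb _; rewrite leq_add2l -abE f_pole //.
    by rewrite abE.
  have bE : - b%:C != - a%:C by rewrite eqr_opp; apply: contraNneq ab => /complexI ->.
  by rewrite add0n (mup_polar (size s).+1 q0 qb bE) -/f addnS ltnS.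
case: (boolP (all (fun z => Im z == 0) m)) => [/allP m_real | /allPn[z zm z0]] ap0; last first.
  have [|b] := IH f szf f_le0 _ ap0; last exact: finish.
  by exists z; rewrite rootf zm lt_neqAle z0 f_le0 // rootf.
have rho_m : rho \notin m.
  by apply: contraTN rho_lt0 => /m_real /eqP ->; rewrite ltxx.
(* A root x0 of f other than - a is counted once more in q, and q also has the non-real root rho:
   together with the roots of f this exceeds the degree of q. *)
have m_a : m = nseq (size s) (- a%:C).
  rewrite -szm; apply/all_pred1P/allP => x0 x0m /=; apply: contraTT isT => x0a.
  have: (size (x0 :: rho :: m) <= size l)%N; last by rewrite /= szl szm; lia.
  apply: count_leq_size => x; rewrite /= -!mupq.
  have m_q y : y \in m -> root q y.
    by move=> ym; rewrite f_root ?rootf //(eqP (m_real _ ym)).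
  have [xrho|xrho] := eqVneq rho x.
    rewrite -xrho; case: eqVneq => [x0rho|_].
      by rewrite -x0rho x0m in rho_m.
    by move/count_memPn: rho_m => ->; rewrite mupq addn0 -mupq mup_gt0.
  have [x0x|x0x] := eqVneq x0 x.
    by rewrite -x0x add0n (mup_polar (size s).+1 q0 (m_q _ x0m) x0a) -/f mupf add1n.
  rewrite !add0n -mupf; have [xm|xm] := boolP (x \in m); last first.
    by rewrite mupf (count_memPn xm).
  have [xa|xa] := eqVneq x (- a%:C); first by rewrite xa; apply: f_pole; rewrite -xa m_q.
  by rewrite (mup_polar (size s).+1 q0 (m_q _ xm) xa) -/f.
have fpow : f = d *: ('X - (- a%:C)%:P) ^+ size s.
  by rewrite fm m_a big_nseq -Monoid.iteropE.
have [b bs /eqP] : exists2 b, b \in s & - a%:C = - b%:C.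
  by apply: (dconv_exp_XsubC d0); rewrite -fpow.
rewrite eqr_opp => /eqP/complexI ab; apply: (finish a).
rewrite fpow mupZ // mup_XsubCX eqxx ab -[X in (X < _)%N]add0n ltn_add2r.
by rewrite -has_count has_pred1.
Qed.
End GraceBoundary.

Lemma ffact_add_fact i j : ((i + j) ^_ i * j`! = (i + j)`!)%N.
Proof. by rewrite -{2}(addKn i j) ffact_fact ?leq_addr. Qed.

(** * Symmetry and lowering of the degree *)

Section DerivConvolutionSymmetry.
Variable A : comNzRingType.
Implicit Types (p q : {poly A}) (n k : nat) (a : A).

Lemma horner0_derivn p k : p^`(k).[0] = p`_k *+ k`!.
Proof. by rewrite horner_coef0 coef_derivn addn0 ffactnn. Qed.

Lemma coef_dconv n p q j : (size p <= n.+1)%N -> (j <= n)%N ->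
  (dconv n p q)`_j
  = \sum_(k < (n - j).+1) q`_(n - k) * p`_(k + j) *+ ((n - k)`! * (k + j) ^_ k).
Proof.
move=> szp jn; rewrite /dconv coef_sum -(big_mkord xpredT
  (fun k => (q^`(n - k).[0] *: p^`(k))`_j)) -(big_mkord xpredT
  (fun k => q`_(n - k) * p`_(k + j) *+ ((n - k)`! * (k + j) ^_ k))).
rewrite (big_cat_nat (n := (n - j).+1)) //=; last by rewrite ltnS leq_subr.
rewrite [X in _ + X]big_nat_cond [X in _ + X]big1 ?addr0 => [|k]; last first.
  rewrite andbT coefZ coef_derivn => /andP[jk _]; rewrite nth_default ?mul0rn ?mulr0 //.
  by apply: leq_trans szp _; lia.
apply: eq_bigr => k _; rewrite coefZ coef_derivn horner0_derivn.
by rewrite mulrnAl mulrnAr mulrnA -mulrnA mulnC mulrnA.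
Qed.

(** In the coefficient of X^j the weight is (n - k)! (k + j)! / j!, invariant under k -> n - j - k,
    the reversal that exchanges p and q. *)
Lemma dconvC n p q : (size p <= n.+1)%N -> (size q <= n.+1)%N ->
  dconv n p q = dconv n q p.
Proof.
move=> szp szq; apply/polyP => j; have [jn|nj] := leqP j n; last first.
  rewrite /dconv !coef_sum !big1 // => k _; rewrite coefZ coef_derivn nth_default ?mul0rn ?mulr0 //;
  by [apply: leq_trans szp _; lia|apply: leq_trans szq _; lia].
rewrite !coef_dconv // (reindex_inj rev_ord_inj) /=; apply: eq_bigr => k _.
have kj : (k <= n - j)%N by rewrite -ltnS.
have -> : (n - (n - j - k) = k + j)%N by lia.
rewrite mulrC (_ : n - k = n - j - k + j)%N; last by lia.
congr (_ *+ _); apply/eqP; rewrite -(eqn_pmul2r (fact_gt0 j)).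
by rewrite -!mulnA !ffact_add_fact mulnC.
Qed.

Lemma size_dconv_le n p q : (size (dconv n p q) <= size p)%N.
Proof.
apply: (leq_trans (size_sum _ _ _)); apply/bigmax_leqP => k _.
apply: (leq_trans (size_scale_leq _ _)).
elim: (k : nat) => [//|i IH]; rewrite derivnS; apply: leq_trans IH.
exact: leq_trans (size_poly _ _) (leq_pred _).
Qed.

Lemma size_comp_XaddC_le n p a :
  (size p <= n.+1)%N -> (size (p \Po ('X + a%:P)) <= n.+1)%N.
Proof.
move=> szp; apply: (leq_trans (size_comp_poly_leq _ _)).
by rewrite size_XaddC muln1 ltnS; move: szp; case: (size p).
Qed.

Lemma dconv_compXaddr n p q a : (size p <= n.+1)%N -> (size q <= n.+1)%N ->
  dconv n p (q \Po ('X + a%:P)) = dconv n p q \Po ('X + a%:P).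
Proof.
move=> szp szq.
by rewrite dconvC ?size_comp_XaddC_le // dconv_compXaddl dconvC.
Qed.

(** Only the indices n - b <= k <= a contribute. A convolution in degree n of polynomials of lower
    degree is thus one in degree m of their derivatives; clusters of fewer than n roots are treated
    this way. *)
Lemma dconv_low n (a b m : nat) p q : (a <= n)%N -> (b <= n)%N -> (a + b = n + m)%N ->
  (size p <= a.+1)%N -> (size q <= b.+1)%N ->
  dconv n p q = dconv m p^`(n - b) q^`(n - a).
Proof.
move=> an bn abE szp szq; rewrite /dconv -(big_mkord xpredT
  (fun k => q^`(n - k).[0] *: p^`(k))) -(big_mkord xpredT
  (fun k => q^`(n - a)^`(m - k).[0] *: p^`(n - b)^`(k))).
rewrite (big_cat_nat (n := (n - b)%N)) //=; last by lia.
rewrite [X in X + _]big_nat_cond [X in X + _]big1 ?add0r => [|k]; last first.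
  rewrite andbT => /andP[_ kb]; rewrite poly.derivn_poly0 ?horner0 ?scale0r //.
  by apply: leq_trans szq _; lia.
rewrite (big_cat_nat (n := a.+1)) //=; last by lia.
rewrite [X in _ + X]big_nat_cond [X in _ + X]big1 ?addr0 => [|k]; last first.
  rewrite andbT => /andP[ak _]; rewrite [p^`(_)]poly.derivn_poly0 ?scaler0 //.
  exact: leq_trans szp _.
rewrite -{1}[(n - b)%N]add0n big_addn (_ : a.+1 - (n - b) = m.+1)%N; last by lia.
rewrite !big_nat; apply: eq_bigr => k /andP[_ km].
by rewrite /derivn -!iterD; congr (_.[0] *: _); congr iter; lia.
Qed.

Lemma lead_coef_dconv n p q : (size p <= n.+1)%N ->
  (dconv n p q)`_n = p`_n * q`_n *+ n`!.
Proof.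
move=> szp; rewrite coef_dconv // subnn big_ord1 subn0 add0n ffactn0 muln1.
by rewrite mulrC.
Qed.

End DerivConvolutionSymmetry.

Lemma map_dconv (A B : comNzRingType) (f : {rmorphism A -> B}) n p q :
  map_poly f (dconv n p q) = dconv n (map_poly f p) (map_poly f q).
Proof.
rewrite /dconv rmorph_sum /=; apply: eq_bigr => k _.
by rewrite !derivn_map map_polyZ -[0 in RHS](rmorph0 f) horner_map.
Qed.

(** * Real-rootedness and repeated roots *)

Section RealRoots.
Variable R : rcfType.
Local Notation C := R[i].
Local Notation Im := (@complex.Im R).
Local Notation Re := (@complex.Re R).
Implicit Types (s : seq R) (p q : {poly R}) (c : R).
Local Notation mapC := (map_poly (real_complex R)).

Definition rprod (F : fieldType) (s : seq F) : {poly F} := \prod_(a <- s) ('X - a%:P).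

Lemma map_rprod s : mapC (rprod s) = cprod s.
Proof.
rewrite /rprod rmorph_prod /=; apply: eq_bigr => a _.
by rewrite rmorphB /= map_polyX map_polyC.
Qed.

Lemma size_rprod (F : fieldType) (s : seq F) : size (rprod s) = (size s).+1.
Proof. exact: size_prod_XsubC. Qed.

Lemma rprod_neq0 (F : fieldType) (s : seq F) : rprod s != 0.
Proof. by rewrite -size_poly_eq0 size_rprod. Qed.

Lemma rprod_comp (F : fieldType) (s : seq F) (c : F) :
  rprod s \Po ('X + c%:P) = rprod [seq b - c | b <- s].
Proof.
rewrite /rprod rmorph_prod big_map /=; apply: eq_bigr => a _.
by rewrite comp_polyB comp_polyX comp_polyC polyCB; ring.
Qed.

Lemma cprodE s : cprod s = rprod [seq a%:C | a <- s].
Proof. by rewrite /rprod big_map. Qed.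

Lemma root_cprod s z : root (cprod s) z = (z \in [seq a%:C | a <- s]).
Proof. by rewrite cprodE root_prod_XsubC. Qed.

(** Translating by a root w with Im w > 0 moves all roots of [cprod s'] strictly below the real
    axis, so that [grace_boundary] would require more than n equal entries in [s]. Conjugation
    settles the other half-plane. *)
Lemma dconv_real_rooted s s' z : size s = size s' ->
  root (dconv (size s) (cprod s) (cprod s')) z -> Im z = 0.
Proof.
move=> szE; suff pos w : root (dconv (size s) (cprod s) (cprod s')) w -> Im w <= 0.
  move=> zr; apply/eqP; rewrite eq_le pos //=.
  have /pos : root (dconv (size s) (cprod s) (cprod s')) z^*; last by case: (z) => x y /=; rewrite oppr_le0.
  move: zr; rewrite -complex_root_conj -!map_rprod -!map_dconv -map_poly_comp.
  suff -> : map_poly (conjc \o real_complex R) (dconv (size s) (rprod s) (rprod s'))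
    = mapC (dconv (size s) (rprod s) (rprod s')) by [].
  by apply: eq_map_poly => x /=; rewrite oppr0.
move=> wr; rewrite leNgt; apply/negP => w_gt0.
pose q := cprod s' \Po ('X + w%:P).
have qE : q = rprod [seq b - w | b <- [seq a%:C | a <- s']] by rewrite /q cprodE rprod_comp.
have q_root z' : root q z' -> Im z' < 0.
  rewrite qE root_prod_XsubC -map_comp => /mapP[b _ ->].
  by move: w_gt0; case: (w) => x y /=; rewrite sub0r oppr_lt0.
have szq : size q = (size s).+1 by rewrite qE size_rprod !size_map szE.
have q0 : (dconv (size s) (cprod s) q).[0] = 0.
  rewrite dconv_compXaddr ?size_cprod ?szE // horner_comp !hornerE.
  by apply/eqP; rewrite -szE.
case: (posnP (size s)) => [s0|s_gt0].
  move: wr; rewrite s0 /dconv big_ord1 (size0nil s0) /cprod big_nil.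
  have -> : s' = [::] by apply: size0nil; rewrite -szE.
  by rewrite big_nil !derivn0 hornerE scale1r (negPf (root1 _)).
have [|r qr] := closed_rootP q _; first by rewrite szq eqSS -lt0n.
have [||a] := grace_boundary szq _ _ q0.
- by move=> z' /q_root /ltW.
- by exists r; split=> //; apply: q_root.
rewrite mupNroot ?addn0 ?ltnNge ?count_size //.
by apply/negP => /q_root /=; rewrite oppr0 ltxx.
Qed.

Lemma real_rooted_split p : (forall z : C, root (mapC p) z -> Im z = 0) ->
  exists s, p = lead_coef p *: rprod s.
Proof.
move=> p_real; have [l lE] := closed_field_poly_normal (mapC p).
have [p0|p0] := eqVneq p 0; first by exists [::]; rewrite p0 lead_coef0 scale0r.
have lc0 : lead_coef (mapC p) != 0 by rewrite lead_coef_eq0 map_poly_eq0.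
exists [seq Re z | z <- l]; apply: (map_inj_poly (f := real_complex R)) => //.
  exact: complexI.
rewrite map_polyZ /= map_rprod -lead_coef_map /= {1}lE; congr (_ *: _).
rewrite /cprod big_map !big_seq; apply: eq_bigr => z zl.
have : Im z = 0 by apply: p_real; rewrite lE rootZ // root_prod_XsubC.
by case: (z) => x y /= ->.
Qed.

Lemma dconv_double_root s s' c : size s = size s' -> s != [::] ->
  root (dconv (size s) (rprod s) (rprod s')) c ->
  root (dconv (size s) (rprod s) (rprod s'))^`() c ->
  exists a, ((size s).+2 <= count_mem a s + count_mem (c - a)%R s')%N.
Proof.
move=> szE s0 H0 H1; set n := size s.
have n_gt0 : (0 < n)%N by rewrite lt0n size_eq0.
pose t := [seq b - c | b <- s']; pose q1 := cprod t; pose q := q1 + 'i%C *: q1^`().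
have szt : size t = n by rewrite size_map.
have q1E : q1 = mapC (rprod s' \Po ('X + c%:P)) by rewrite rprod_comp map_rprod.
have szq1 : size q1 = n.+1 by rewrite size_cprod szt.
have szq1' : (size q1^`() <= n)%N.
  by rewrite -ltnS -szq1 lt_size_deriv // -size_poly_eq0 szq1.
have szq : size q = n.+1.
  rewrite size_polyDl ?szq1 //; apply: leq_ltn_trans (size_scale_leq _ _) _.
  by rewrite ltnS.
have i0 : 'i%C != 0 :> C by rewrite eq_complex /= oner_eq0 andbF.
have szp : size (cprod s) = n.+1 by rewrite size_cprod.
have q0 : (dconv n (cprod s) q).[0] = 0.
  have hE p : (mapC (p \Po ('X + c%:P))).[0] = (p.[c])%:C.
    by rewrite -[0 in LHS](rmorph0 (real_complex R)) horner_map horner_comp !hornerE.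
  rewrite /q linearD linearZ /= dconv_deriv ?szp ?szq1 // q1E -map_rprod -map_dconv.
  rewrite dconv_compXaddr ?size_rprod -?szE // hornerD hornerZ deriv_map deriv_comp.
  rewrite derivD derivX derivC addr0 mulr1 !hE (eqP H1) (eqP H0).
  by rewrite !rmorph0 mulr0 addr0.
(* A zero z of q with Im z > 0 would give q1'/q1 the value i there, whereas this logarithmic
   derivative has imaginary part <= 0 in the upper half-plane. *)
have q_le0 z : root q z -> Im z <= 0.
  move=> qz; rewrite leNgt; apply/negP => z_gt0.
  have zt : z \notin [seq a%:C | a <- t].
    by apply: contraTN z_gt0 => /mapP[b _ ->]; rewrite ltxx.
  have q1z : q1.[z] != 0 by have := root_cprod t z; rewrite (negPf zt) rootE => ->.
  move: qz; rewrite rootE hornerD hornerZ /q1 cprodE deriv_prod_XsubC //.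
  rewrite -/(rprod _) -cprodE -/q1 mulrCA -{1}[q1.[z]]mulr1 -mulrDr mulf_eq0 (negPf q1z) /=.
  set S := \sum_(r <- _) _ => /eqP /(congr1 Re); rewrite complex_ReD mulrC ReiNIm => /= /eqP.
  rewrite subr_eq0 => /eqP S1; suff : Im S <= 0 by rewrite -S1 ler10.
  rewrite /S complex_Im_sum big_map; apply: sumr_le0 => b _; rewrite complex_ImV mulNr oppr_le0.
  have -> : Im (z - b%:C) = Im z by case: (z) => x y /=; rewrite subr0.
  by rewrite divr_ge0 ?(ltW z_gt0) // addr_ge0 // sqr_ge0.
have q_neq0 : q != 0 by rewrite -size_poly_eq0 szq.
(* The coefficient of X^(n-1) in q is that of q1 plus i n, so the imaginary parts of the roots of q
   sum to - n. *)
have q_nonreal : exists z, root q z /\ Im z < 0.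
  have [l lE] := closed_field_poly_normal q.
  have lc : lead_coef q = 1.
    rewrite lead_coefDl; first exact/monicP/monic_prod_XsubC.
    by rewrite szq1; apply: leq_ltn_trans (size_scale_leq _ _) _; rewrite ltnS.
  rewrite lc scale1r in lE.
  have szl : size l = n by apply: succn_inj; rewrite -(size_prod_XsubC _ id) -lE.
  have : q`_n.-1 = - (\sum_(b <- t) b%:C) + 'i%C * n%:R.
    rewrite coefD coefZ coef_deriv (prednK n_gt0) -/q1.
    have <- : (size [seq a%:C | a <- t]).-1 = n.-1 by rewrite size_map szt.
    rewrite {1}/q1 cprodE coefPn_prod_XsubC ?size_map -?szE -?lt0n // big_map.
    congr (_ + _ * _).
    have /monicP : q1 \is monic by exact: monic_prod_XsubC.
    by rewrite /lead_coef szq1 => ->.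
  rewrite lE -szl coefPn_prod_XsubC ?szl -?lt0n // => /(congr1 Im).
  have ImN (z : C) : Im (- z) = - Im z by case: z.
  rewrite complex_ImD !ImN mulrC ImiRe !complex_Im_sum [X in - X + _]big1 // oppr0 add0r.
  have -> : Re n%:R = n%:R :> R by rewrite -[n%:R in LHS](rmorph_nat (real_complex R)).
  move=> SE; case: (boolP (has (fun z => Im z < 0) l)) => [/hasP[z zl z0]|].
    by exists z; rewrite root_prod_XsubC.
  rewrite -all_predC => /allP l_ge0; have : 0 <= \sum_(z <- l) Im z.
    by rewrite big_seq; apply: sumr_ge0 => z /l_ge0 /=; rewrite -leNgt.
  by rewrite -oppr_le0 SE lern0 => /eqP n0; rewrite n0 in n_gt0.
have [a ha] := grace_boundary szq q_le0 q_nonreal q0.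
exists a; have qa : root q (- a%:C).
  rewrite -mup_gt0 // lt0n; apply: contraTneq ha => ->.
  by rewrite addn0 -leqNgt count_size.
have q1_neq0 : q1 != 0 by rewrite -size_poly_eq0 szq1.
have q1a : root q1 (- a%:C).
  move: qa; rewrite !rootE hornerD hornerZ q1E deriv_map.
  have -> : - a%:C = (- a)%:C by rewrite rmorphN.
  rewrite !horner_map /= => /eqP/(congr1 Re); rewrite complex_ReD mulrC ReiNIm /= oppr0 addr0.
  by move=> ->.
have [q1'_neq0 mq1] := mup_deriv q1_neq0 q1a.
(* The multiplicity in q is that of q1', one below that of q1; this is the second unit in
   [(size s).+2]. *)
have mq : mup (- a%:C) q = mup (- a%:C) q1^`().
  rewrite /q addrC mup_addl ?scaler_eq0 ?negb_or ?i0 // !mupZ //.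
  by rewrite mq1.
suff -> : count_mem (c - a)%R s' = (mup (- a%:C) q).+1 by rewrite addnS.
rewrite mq -mq1 /q1 cprodE mu_prod_XsubC -map_comp count_map; apply: eq_count => b /=.
by rewrite -rmorphN /= (inj_eq (@complexI R)) subr_eq addrC.
Qed.
End RealRoots.

(** * Polynomials with simple real roots *)

Section SimpleReal.
Variable R : rcfType.
Local Notation C := R[i].
Local Notation Im := (@complex.Im R).
Implicit Types (s : seq R) (p q : {poly R}) (c : R).
Local Notation mapC := (map_poly (real_complex R)).

(** The zero polynomial qualifies, with [s] empty; non-vanishing is always carried separately. *)
Definition simple_real p := exists2 s, uniq s & p = lead_coef p *: rprod s.

Lemma simple_realI p : p != 0 -> (forall z : C, root (mapC p) z -> Im z = 0) ->
  (forall c, root p c -> ~~ root p^`() c) -> simple_real p.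
Proof.
move=> p0 /real_rooted_split[s pE] p_simple; exists s => //.
have lc0 : lead_coef p != 0 by rewrite lead_coef_eq0.
have mupE x : mup x p = count_mem x s by rewrite pE mupZ // mu_prod_XsubC.
apply: count_mem_uniq => x; rewrite -mupE.
have <- : root p x = (x \in s) by rewrite pE rootZ // root_prod_XsubC.
have [px|px] := boolP (root p x); last by rewrite mupNroot.
by have [p'0 ->] := mup_deriv p0 px; rewrite mupNroot ?p_simple.
Qed.

(** This is the derivative of q'/q multiplied by q^2. At a critical point that is not a root it
    makes q'' nonzero. *)
Lemma deriv2_prod_XsubC (l : seq R) (z : R) : z \notin l ->
  let q := rprod l in
  q^`()^`().[z] * q.[z] - q^`().[z] ^+ 2 = - q.[z] ^+ 2 * \sum_(r <- l) (z - r)^-1 ^+ 2.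
Proof.
elim: l => [|r l IH]; first by move=> _; rewrite /rprod !big_nil !derivC !hornerC; ring.
rewrite inE negb_or /rprod !big_cons -/(rprod l) => /andP[zr /IH /=].
set q := rprod l; set S := \sum_(_ <- _) _ => E; set d := z - r.
have d0 : d != 0 by rewrite subr_eq0.
have -> : (('X - r%:P) * q).[z] = d * q.[z] by rewrite hornerM hornerXsubC.
have -> : (('X - r%:P) * q)^`().[z] = q.[z] + d * q^`().[z].
  by rewrite derivM derivXsubC mul1r hornerD hornerM hornerXsubC.
have -> : (('X - r%:P) * q)^`()^`().[z] = 2 * q^`().[z] + d * q^`()^`().[z].
  rewrite derivM derivXsubC mul1r derivD derivM derivXsubC mul1r addrA -mulr2n.
  by rewrite hornerD hornerM hornerXsubC hornerMn mulr_natl.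
have -> : - (d * q.[z]) ^+ 2 * (d^-1 ^+ 2 + S) = - q.[z] ^+ 2 + d ^+ 2 * (- q.[z] ^+ 2 * S).
  by field.
by rewrite -E; ring.
Qed.

(** Off the roots of p the imaginary part of p'/p is - Im z times a positive sum, so p' has only
    real zeros. Such a zero is not a root of p, whose roots are simple, and it is simple by
    [deriv2_prod_XsubC]. *)
Lemma simple_real_deriv p : (1 < size p)%N -> simple_real p -> simple_real p^`().
Proof.
move=> szp [s s_uniq pE]; set c := lead_coef p in pE.
have p0 : p != 0 by rewrite -size_poly_gt0 ltnW.
have c0 : c != 0 by rewrite lead_coef_eq0.
have szs : (0 < size s)%N by move: szp; rewrite pE size_scale // size_rprod.
have p'0 : p^`() != 0.
  by rewrite -size_poly_gt0 size_deriv; case: (size p) szp => // -[].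
apply: simple_realI => // [z|x px'].
  rewrite pE derivZ map_polyZ rootZ ?map_poly_eq0 ?fmorph_eq0 // -deriv_map map_rprod cprodE.
  have [|zs] := boolP (z \in [seq a%:C | a <- s]); first by move=> /mapP[a _ ->].
  rewrite rootE deriv_prod_XsubC // mulf_eq0 -rootE root_prod_XsubC (negPf zs) /=.
  move=> /eqP/(congr1 Im); rewrite complex_Im_sum big_map /=.
  under eq_bigr => a _ do rewrite complex_ImV.
  have -> : \sum_(a <- s) - Im (z - a%:C) / sqn (z - a%:C)
     = - (Im z * \sum_(a <- s) (sqn (z - a%:C))^-1).
    rewrite mulr_sumr -sumrN; apply: eq_bigr => a _.
    by case: (z) => x y /=; rewrite subr0 mulNr.
  move/eqP; rewrite oppr_eq0 mulf_eq0 => /orP[/eqP //|].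
  rewrite gt_eqF //; case: s szs zs {s_uniq pE} => [//|a s] _ zs; rewrite big_cons ltr_pwDl //.
    rewrite invr_gt0 sqn_gt0 // subr_eq0; apply: contraNneq zs => ->.
    by rewrite inE eqxx.
  by apply: sumr_ge0 => b _; rewrite invr_ge0 addr_ge0 // sqr_ge0.
have [px|px] := boolP (root p x).
  have := mup_deriv p0 px; have -> : mup x p = (x \in s).
    by rewrite pE mupZ // mu_prod_XsubC count_uniq_mem.
  move=> [_ ]; have : (0 < mup x p^`())%N by rewrite mup_gt0.
  by case: (mup _ _) => // k _; case: (x \in s).
have xs : x \notin s by move: px; rewrite pE rootZ // root_prod_XsubC.
have := deriv2_prod_XsubC xs; rewrite /=.
have p'x : (rprod s)^`().[x] = 0 by apply/eqP; rewrite -rootE -(rootZ _ _ c0) -derivZ -pE.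
rewrite p'x expr0n /= subr0 => E; apply/negP; rewrite pE !derivZ rootZ // => /rootP E0.
move: E; rewrite E0 mul0r => /esym/eqP; rewrite mulf_eq0 oppr_eq0 sqrf_eq0.
have -> /= : (rprod s).[x] == 0 = false by apply/negbTE; rewrite -rootE root_prod_XsubC.
apply/negP; rewrite gt_eqF //; case: s szs xs {s_uniq pE p'x E0} => [//|a s] _ xs.
rewrite big_cons ltr_pwDl //; last by apply: sumr_ge0 => b _; rewrite sqr_ge0.
rewrite exprn_even_gt0 //= invr_eq0 subr_eq0; apply: contraNneq xs => ->.
by rewrite inE eqxx.
Qed.

Lemma simple_real_derivn p k : (k < size p)%N -> simple_real p -> simple_real p^`(k).
Proof.
move=> + ps; elim: k => [|k IH] kp; first by rewrite derivn0.
rewrite derivnS; apply: simple_real_deriv; last by apply: IH; apply: ltnW.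
have : (size p^`(k) = size p - k)%N.
  by elim: (k) => [|j IHj]; rewrite ?subn0 // derivnS size_deriv IHj subnS.
by move=> ->; lia.
Qed.

Lemma size_derivn p k : size p^`(k) = (size p - k)%N.
Proof. by elim: k => [|j IHj]; rewrite ?subn0 // derivnS size_deriv IHj subnS. Qed.

(** After reduction to degree m both factors have simple real roots. A repeated root of the
    convolution would need two multiplicities with sum at least m + 2 >= 3, but each is at most
    1. *)
Lemma dconv_simple n a b m p q : (a <= n)%N -> (b <= n)%N -> (a + b = n + m)%N ->
  size p = a.+1 -> size q = b.+1 -> simple_real p -> simple_real q ->
  size (dconv n p q) = m.+1 /\ simple_real (dconv n p q).
Proof.
move=> an bn abE szp szq ps qs.
rewrite (dconv_low an bn abE) ?szp ?szq //.
have : simple_real p^`(n - b) by apply: simple_real_derivn => //; lia.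
have : simple_real q^`(n - a) by apply: simple_real_derivn => //; lia.
have : size p^`(n - b) = m.+1 by rewrite size_derivn szp; lia.
have : size q^`(n - a) = m.+1 by rewrite size_derivn szq; lia.
move: p^`(n - b) q^`(n - a) => {szp szq ps qs p q} p q szq szp [t t_uniq qE] [s s_uniq pE].
set c := lead_coef p in pE; set d := lead_coef q in qE.
have c0 : c != 0 by rewrite lead_coef_eq0 -size_poly_eq0 szp.
have d0 : d != 0 by rewrite lead_coef_eq0 -size_poly_eq0 szq.
have szs : size s = m by apply: succn_inj; rewrite -size_rprod -szp pE size_scale.
have szt : size t = m by apply: succn_inj; rewrite -size_rprod -szq qE size_scale.
set H := dconv m (rprod s) (rprod t).
have -> : dconv m p q = (d * c) *: H.
  by rewrite {1}qE linearZ /= {1}pE dconvZl scalerA.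
have dc0 : d * c != 0 by rewrite mulf_neq0.
have szH : size H = m.+1.
  apply/eqP; rewrite eqn_leq; apply/andP; split.
    by apply: leq_trans (size_dconv_le _ _ _) _; rewrite size_rprod szs.
  rewrite ltnNge; apply/negP => /leq_sizeP/(_ m (leqnn _))/eqP.
  rewrite lead_coef_dconv ?size_rprod ?szs // mulrn_eq0 eqn0Ngt fact_gt0 /= mulf_eq0.
  have lc (u : seq R) : size u = m -> (rprod u)`_m = 1.
    by move=> <-; have /monicP := monic_prod_XsubC u xpredT id; rewrite /lead_coef size_rprod.
  by rewrite !lc // oner_eq0.
have H0 : H != 0 by rewrite -size_poly_eq0 szH.
rewrite size_scale // szH; split=> //.
have [u u_uniq uE] : simple_real H; last first.
  by exists u => //; rewrite {1}uE lead_coefZ scalerA.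
apply: simple_realI => // [z|x Hx].
  rewrite /H map_dconv !map_rprod -szs; apply: dconv_real_rooted; by rewrite szs szt.
have m_gt0 : (0 < m)%N.
  rewrite lt0n; apply: contraTneq Hx => m0.
  have /eqP/size_poly1P[e e0 He] : size H = 1%N by rewrite szH m0.
  by rewrite He rootC.
apply/negP => Hx'; have [||||a'] := @dconv_double_root _ s t x.
- by rewrite szs szt.
- by rewrite -size_eq0 szs -lt0n.
- by rewrite szs.
- by rewrite szs.
by rewrite szs !count_uniq_mem //; case: (a' \in s); case: (_ \in t); lia.
Qed.
End SimpleReal.

(** * Branches at a repeated root *)

Lemma poly_eq_off0 (F : numFieldType) (p q : {poly F}) :
  (forall x, x != 0 -> p.[x] = q.[x]) -> p = q.
Proof.
move=> pq; apply/eqP; rewrite -subr_eq0; set r := p - q.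
apply: contraT => r0; pose l := [seq i.+1%:R : F | i <- iota 0 (size r)].
have : (size l < size r)%N.
  apply: max_poly_roots => //; last first.
    rewrite map_inj_uniq ?iota_uniq // => i j /eqP.
    by rewrite eqr_nat eqSS => /eqP.
  apply/allP => x /mapP[i _ ->].
  by rewrite rootE /r hornerD hornerN pq ?subrr ?pnatr_eq0.
by rewrite size_map size_iota ltnn.
Qed.

Lemma horner2 (F : comNzRingType) (G : {poly {poly F}}) (x t : F) :
  (map_poly (horner_eval t) G).[x] = G.[x%:P].[t].
Proof.
have -> : x = horner_eval t x%:P by rewrite /horner_eval hornerC.
by rewrite horner_map /= /horner_eval hornerC.
Qed.

Lemma horner2_lin (F : comNzRingType) (t : F) (c : {poly F}) :
  map_poly (horner_eval t) ('X%:P * 'X + c%:P) = t%:P * 'X + (c.[t])%:P.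
Proof. by rewrite rmorphD rmorphM /= map_polyX !map_polyC /= /horner_eval hornerX. Qed.

Section Localization.
Variables (R : rcfType) (n : nat).
Implicit Types (A B al be : 'I_n -> R) (a b c x t : R).

(** The outer variable is x, the inner one t: the roots move along lines in the (t, x)-plane. *)
Definition linefam A al : {poly {poly R}} :=
  \prod_(i < n) ('X - ((A i)%:P + al i *: 'X)%:P).

Definition convfam A B al be := dconv n (linefam A al) (linefam B be).

Definition fiberpoly A al t : {poly R} := \prod_(i < n) ('X - (A i + t * al i)%:P).

Lemma linefamE A al t : map_poly (horner_eval t) (linefam A al) = fiberpoly A al t.
Proof.
rewrite /linefam rmorph_prod; apply: eq_bigr => i _ /=.
rewrite rmorphB /= map_polyX map_polyC /= /horner_eval !hornerE.
by rewrite [t * _]mulrC.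
Qed.

Lemma convfamE A B al be t : map_poly (horner_eval t) (convfam A B al be)
  = dconv n (fiberpoly A al t) (fiberpoly B be t).
Proof. by rewrite /convfam map_dconv !linefamE. Qed.

(** Strict transform under x = a + t x': a line through (0, a) loses a factor t and leaves x' minus
    its slope, the other lines are merely rewritten. *)
Definition blowup A al a : {poly {poly R}} :=
  \prod_(i < n) (if A i == a then 'X - (al i)%:P%:P
                 else 'X%:P * 'X + ((a - A i)%:P - al i *: 'X)%:P).

Lemma size_fiberpoly A al t : size (fiberpoly A al t) = n.+1.
Proof. by rewrite size_prod_XsubC /index_enum -enumT size_enum_ord. Qed.

Lemma blowupE A al a t :
  fiberpoly A al t \Po ('X + a%:P) \Po (t *: 'X)
  = t ^+ #|[pred i | A i == a]| *: map_poly (horner_eval t) (blowup A al a).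
Proof.
have -> : t ^+ #|[pred i | A i == a]| = \prod_(i < n) (if A i == a then t else 1).
  by rewrite -prodr_const big_mkcond.
rewrite /fiberpoly /blowup -[RHS]mul_polyC !rmorph_prod -big_split /=.
apply: eq_bigr => i _; rewrite !comp_polyB !comp_polyX !comp_polyC.
rewrite comp_polyD comp_polyX comp_polyC; case: eqP => [->|_].
  rewrite rmorphB /= map_polyX map_polyC /= /horner_eval !hornerC.
  by rewrite -!mul_polyC polyCD polyCM; ring.
rewrite horner2_lin mul1r -!mul_polyC !hornerE.
by rewrite !(polyCD, polyCM, polyCN); ring.
Qed.

(** Translations add under convolution and the common scaling by t costs t^n. The two clusters
    supply t^(n + m), which leaves t^m. *)
Lemma local_blowup A B al be a b m t x :
  (#|[pred i | A i == a]| + #|[pred j | B j == b]| = n + m)%N -> t != 0 ->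
  (dconv n (fiberpoly A al t) (fiberpoly B be t)).[a + b + t * x]
  = t ^+ m * (dconv n (blowup A al a) (blowup B be b)).[x%:P].[t].
Proof.
move=> abE t0; rewrite -horner2 map_dconv.
set P := fiberpoly A al t; set Q := fiberpoly B be t.
have := dconv_compZX n (P \Po ('X + a%:P)) (Q \Po ('X + b%:P)) t.
rewrite !blowupE dconvZl linearZ /= scalerA -exprD abE.
rewrite dconv_compXaddl dconv_compXaddr ?size_fiberpoly // exprD -scalerA.
move=> /(scalerI (expf_neq0 n t0))/(congr1 (horner^~ x)).
by rewrite hornerZ !horner_comp !hornerE => ->; congr (_.[_]); ring.
Qed.
End Localization.

Section LocalModel.
Variables (R : rcfType) (n : nat).
Implicit Types (A B al be : 'I_n -> R) (a b c x t : R).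

Lemma rprod_codom (F : fieldType) (f : 'I_n -> F) :
  rprod (codom f) = \prod_(i < n) ('X - (f i)%:P).
Proof. by rewrite /rprod codomE big_map enumT. Qed.

Lemma size_codomI (T : Type) (f : 'I_n -> T) : size (codom f) = n.
Proof. by rewrite size_codom card_ord. Qed.

Lemma count_codom (T : eqType) (f : 'I_n -> T) (a : T) :
  count_mem a (codom f) = #|[pred i | f i == a]|.
Proof. by rewrite codomE count_map -size_filter cardE enumT. Qed.

Lemma fiberpolyE A al t : fiberpoly A al t = rprod (codom (fun i => A i + t * al i)).
Proof. by rewrite rprod_codom. Qed.

Lemma fiberpoly0 A al : fiberpoly A al 0 = rprod (codom A).
Proof. by rewrite rprod_codom; apply: eq_bigr => i _; rewrite mul0r addr0. Qed.

Definition cluster A al a := rprod [seq al i | i <- enum [pred i | A i == a]].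

Lemma blowup0 A al a : map_poly (horner_eval 0) (blowup A al a)
  = (\prod_(i < n | A i != a) (a - A i)) *: cluster A al a.
Proof.
rewrite /blowup rmorph_prod (bigID (fun i => A i == a)) /= mulrC -mul_polyC rmorph_prod.
congr (_ * _).
  apply: eq_bigr => i /negPf ->; rewrite horner2_lin.
  by rewrite polyC0 mul0r add0r hornerD hornerN hornerZ hornerX hornerC mulr0 subr0.
rewrite /cluster /rprod big_map big_enum /=; apply: eq_big => i //= ->.
by rewrite rmorphB /= map_polyX map_polyC /= /horner_eval hornerC.
Qed.

Lemma prod_sub_neq0 A a : \prod_(i < n | A i != a) (a - A i) != 0.
Proof. by apply/prodf_neq0 => i; rewrite subr_eq0 eq_sym. Qed.

Lemma size_cluster A al a : size (cluster A al a) = #|[pred i | A i == a]|.+1.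
Proof. by rewrite size_rprod size_map -cardE. Qed.

Lemma card_pred_le A a : (#|[pred i | A i == a]| <= n)%N.
Proof. by rewrite -[X in (_ <= X)%N](card_ord n) max_card. Qed.

Lemma mup_shift (F : fieldType) (p g : {poly F}) (c : F) m :
  p \Po ('X + c%:P) = 'X^m * g -> g.[0] != 0 -> mup c p = m.
Proof.
move=> pE g0; have -> : p = ('X - c%:P) ^+ m * (g \Po ('X - c%:P)).
  by rewrite -[LHS](comp_polyXaddC_K _ c) pE comp_polyM rmorphXn /= comp_polyX.
by rewrite mupMl ?mup_XsubCX ?eqxx // rootE horner_comp !hornerE subrr.
Qed.

(** Complements [dconv_double_root] by the exact multiplicity. Blowing up with all slopes zero gives
    H(a + b + t) = t^m g(t), where g(0) is a nonzero multiple of the value at 1 of the convolution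
    of two pure powers. *)
Lemma dconv_exact_mult A B a b m :
  (count_mem a (codom A) + count_mem b (codom B) = n + m)%N ->
  mup (a + b) (dconv n (rprod (codom A)) (rprod (codom B))) = m.
Proof.
rewrite !count_codom => abE; set H := dconv _ _ _.
pose z := fun _ : 'I_n => 0 : R.
pose g := (dconv n (blowup A z a) (blowup B z b)).[1%:P].
apply: (@mup_shift _ H g).
  apply: poly_eq_off0 => t t0; rewrite horner_comp !hornerE.
  have zE (f : 'I_n -> R) : codom (fun i => f i + t * z i) = codom f.
    by apply: eq_codom => i; rewrite mulr0 addr0.
  have := local_blowup z z 1 abE t0; rewrite !fiberpolyE !zE -/H -/g => <-.
  by congr (_.[_]); rewrite /= mulr1 [RHS]addrC addrA.
rewrite /g -horner2 map_dconv !blowup0 dconvZl linearZ /= !hornerZ.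
rewrite !mulf_neq0 ?prod_sub_neq0 //.
have clE (f : 'I_n -> R) x : cluster f z x = 'X^#|[pred i | f i == x]|.
  rewrite /cluster /rprod big_map (eq_bigr (fun=> 'X)) => [|i _]; last by rewrite subr0.
  rewrite big_const_seq count_predT -cardE.
  by rewrite -Monoid.iteropE.
rewrite !clE; set k := #|_| in abE *; set l := #|_| in abE *.
rewrite (dconv_low (a := k) (b := l) (m := m)) ?size_polyXn ?card_pred_le //.
rewrite !derivnXn; have -> : (k - (n - l) = m)%N.
  by have := card_pred_le B b; rewrite -/l; lia.
have -> : (l - (n - k) = m)%N by have := card_pred_le A a; rewrite -/k; lia.
rewrite -!scaler_nat dconvZl linearZ /= !hornerZ !mulf_neq0 ?pnatr_eq0 -?lt0n ?ffact_gt0 //.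
- by lia.
- by lia.
rewrite /dconv horner_sum big_ord_recl big1 => [|i _].
  rewrite addr0 subn0 derivn0 derivnXn subnn ffactnn hornerZ !hornerE.
  by rewrite expr1n mulr1 hornerMn hornerE pnatr_eq0 -lt0n fact_gt0.
rewrite derivnXn /= /bump add1n hornerZ hornerMn hornerXn subKn; last by case: i.
by rewrite expr0n /= mul0rn mul0r.
Qed.

Lemma simple_real_root p : p != 0 -> simple_real p -> exists u : seq R,
  [/\ uniq u, size u = (size p).-1
    & forall x, x \in u -> root p x /\ ~~ root p^`() x].
Proof.
move=> p0 [u u_uniq pE]; have c0 : lead_coef p != 0 by rewrite lead_coef_eq0.
exists u; split=> //; first by rewrite pE size_scale // size_rprod.
move=> x xu; have px : root p x by rewrite pE rootZ // root_prod_XsubC.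
split=> //; have [p'0] := mup_deriv p0 px; rewrite -mup_gt0 //.
by rewrite {1}pE mupZ // mu_prod_XsubC count_uniq_mem // xu => -[<-].
Qed.

(** [G] is the equation after blowing up the root c, and [u] lists the slopes of its m branches. At
    a repeated root they come from the convolution of two clusters, simple by [dconv_simple]. At a
    simple root a first-order expansion suffices; injective slopes are therefore requested at
    repeated roots only, which lets the lemma apply to the fiber at infinity, where slopes may
    coincide. *)
Lemma local_model A B al be c (H := convfam A B al be)
    (H0 := map_poly (horner_eval 0) H) (m := mup c H0) :
  (0 < n)%N -> (root H0^`() c -> injective al /\ injective be) -> H0 != 0 -> root H0 c ->
  exists (G : {poly {poly R}}) (u : seq R),
    [/\ uniq u, size u = m,
        forall x, x \in u -> root (map_poly (horner_eval 0) G) x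
           /\ ~~ root (map_poly (horner_eval 0) G)^`() x
      & forall t x, t != 0 ->
          (map_poly (horner_eval t) H).[c + t * x] = t ^+ m * G.[x%:P].[t]].
Proof.
move=> n_gt0 albe_inj nzH0 H0c.
have m_gt0 : (0 < m)%N by rewrite mup_gt0.
have H0E : H0 = dconv n (rprod (codom A)) (rprod (codom B)).
  by rewrite /H0 convfamE !fiberpoly0.
have [H0'c|H0'c] := boolP (root H0^`() c).
  have [al_inj be_inj] := albe_inj H0'c.
  have n0 : codom A != [::] by rewrite -size_eq0 size_codomI -lt0n.
  have := @dconv_double_root _ (codom A) (codom B) c.
  rewrite !size_codomI -H0E => /(_ erefl n0 H0c H0'c)[a hab].
  pose m' := (count_mem a (codom A) + count_mem (c - a)%R (codom B) - n)%N.
  have abE : (count_mem a (codom A) + count_mem (c - a)%R (codom B) = n + m')%N.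
    by rewrite /m'; lia.
  have mE : m = m'.
    by rewrite -(dconv_exact_mult abE) -H0E subrKC.
  pose G := dconv n (blowup A al a) (blowup B be (c - a)).
  pose G0 := dconv n (cluster A al a) (cluster B be (c - a)).
  rewrite -mE !count_codom in abE.
  have simple_cl (f g : 'I_n -> R) x : injective g -> simple_real (cluster f g x).
    move=> g_inj; exists [seq g i | i <- enum [pred i | f i == x]].
      by rewrite map_inj_uniq ?enum_uniq.
    by rewrite lead_coef_prod_XsubC scale1r.
  have [szG0 G0s] := dconv_simple (card_pred_le A a) (card_pred_le B (c - a)) abE
    (size_cluster A al a) (size_cluster B be (c - a)) (simple_cl _ _ _ al_inj)
    (simple_cl _ _ _ be_inj).
  have G0_neq0 : G0 != 0 by rewrite -size_poly_eq0 szG0.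
  have [u [u_uniq szu u_root]] := simple_real_root G0_neq0 G0s.
  exists G, u; split=> // [|x xu|t x t0]; first by rewrite szu szG0.
    rewrite /G map_dconv !blowup0 dconvZl linearZ /= !derivZ !rootZ ?prod_sub_neq0 //.
    exact: u_root.
  by rewrite -(local_blowup al be x abE t0) convfamE; congr (_.[_ + _]); ring.
have [H0'0 mE] := mup_deriv nzH0 H0c.
have m1 : m = 1%N by rewrite /m mE mupNroot.
rewrite {}m1 {mE m m_gt0}.
(* H = W (x - c) + H(c), and H(c) = k t; the substitution x = c + t x' leaves t (x' W + k). *)
have [W WE] : exists W, H = W * ('X - c%:P%:P) + (H.[c%:P])%:P.
  have /factor_theorem[W WE] : root (H - (H.[c%:P])%:P) c%:P.
    by rewrite rootE hornerD hornerN hornerC subrr.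
  by exists W; rewrite -WE subrK.
have [k kE] : exists k, H.[c%:P] = k * 'X.
  have /factor_theorem[k] : root H.[c%:P] 0 by move: H0c; rewrite /root horner2.
  by rewrite subr0 => ->; exists k.
exists ('X * (W \Po ('X%:P * 'X + c%:P%:P)) + k%:P).
set G := _ + _; have G0E : map_poly (horner_eval 0) G = (W.[c%:P].[0])%:P * 'X + (k.[0])%:P.
  rewrite /G rmorphD rmorphM /= map_polyX map_polyC /= map_comp_poly.
  by rewrite horner2_lin /horner_eval hornerC mul0r add0r comp_polyCr horner2 mulrC.
have Wc : H0^`().[c] = W.[c%:P].[0].
  rewrite /H0 deriv_map horner2 WE derivD derivM derivC addr0 derivXsubC mulr1.
  by rewrite hornerD hornerM hornerXsubC subrr mulr0 add0r.
rewrite rootE Wc in H0'c; exists [:: - k.[0] / W.[c%:P].[0]]; split=> // [x|t x t0].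
  rewrite inE G0E => /eqP ->; rewrite !rootE !hornerE derivD derivM !derivC derivX.
  by rewrite !hornerE /= mulrAC mulfV // mul1r addNr.
rewrite horner2 WE kE !hornerE horner_comp !hornerE /=.
have -> : W.['X * x%:P + c%:P].[t] = W.[(c + t * x)%:P].[t].
  rewrite -horner2 -[LHS]/(horner_eval t _) -horner_map /= /horner_eval !hornerE.
  by rewrite addrC.
by rewrite expr1; ring.
Qed.
End LocalModel.

(** * Two-sided estimates for small positive t *)

Section OrderEstimate.
Variable R : rcfType.
Implicit Types (x y t d : R).

(** At a simple root G(., 0) changes sign; the opposite signs at two nearby points persist for small
    t, and the intermediate value theorem applies for each t separately. *)
Lemma near_root (G : {poly {poly R}}) x d : 0 < d ->
  root (map_poly (horner_eval 0) G) x -> ~~ root (map_poly (horner_eval 0) G)^`() x ->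
  exists2 t0, 0 < t0 & forall t, 0 < t < t0 ->
    exists2 y, `|y - x| <= d & root (map_poly (horner_eval t) G) y.
Proof.
move=> d_gt0; set G0 := map_poly _ G => /factor_theorem[g gE].
rewrite gE derivM derivXsubC mulr1 rootE hornerD hornerM hornerXsubC subrr mulr0 add0r => gx.
have [e e_gt0 ge] := poly_cont x g (e := `|g.[x]|) ltac:(by rewrite normr_gt0).
pose f := Num.min d (e / 2).
have f_gt0 : 0 < f by rewrite lt_min d_gt0 divr_gt0.
have f_e : f < e by rewrite gt_min; apply/orP; right; lra.
have G0E s : `|s| = f -> 0 < g.[x] * g.[x + s].
  move=> sf; have := ge (x + s); rewrite addrAC subrr add0r sf => /(_ f_e).
  move: gx; rewrite neq_lt => /orP[g_lt0|g_gt0].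
    rewrite (ltr0_norm g_lt0) ltr_norml => /andP[h1 h2]; nra.
  rewrite (gtr0_norm g_gt0) ltr_norml => /andP[h1 h2]; nra.
pose F := G.[(x - f)%:P] * G.[(x + f)%:P].
have F0 : F.[0] < 0.
  rewrite hornerM -!horner2 -/G0 gE !hornerM !hornerXsubC.
  have h1 := G0E f (gtr0_norm f_gt0).
  have h2 := G0E (- f); rewrite normrN gtr0_norm // in h2; have {}h2 := h2 erefl.
  have h3 : 0 < g.[x - f] * g.[x + f].
    have : 0 < (g.[x] * g.[x + f]) * (g.[x] * g.[x - f]) by rewrite mulr_gt0.
    have gx2 : 0 < g.[x] ^+ 2 by rewrite exprn_even_gt0.
    have -> : (g.[x] * g.[x + f]) * (g.[x] * g.[x - f]) = g.[x] ^+ 2 * (g.[x - f] * g.[x + f]) by ring.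
    by rewrite pmulr_rgt0.
  have -> : g.[x - f] * (x - f - x) * (g.[x + f] * (x + f - x))
    = - (f * f * (g.[x - f] * g.[x + f])) by ring.
  by rewrite oppr_lt0 mulr_gt0 // mulr_gt0.
have [t0 t0_gt0 Ft0] := poly_cont 0 F (e := - F.[0]) ltac:(by rewrite oppr_gt0).
exists t0 => // t /andP[t_gt0 tt0]; have := Ft0 t; rewrite subr0 gtr0_norm // => /(_ tt0).
rewrite ltr_norml => /andP[_ Ft]; have {}Ft : F.[t] < 0 by lra.
have xf : x - f <= x + f by rewrite lerD2l; lra.
have [|y y_in yr] := @polyrcf.poly_ivt _ (map_poly (horner_eval t) G) (x - f) (x + f) xf.
  by rewrite !horner2 -hornerM ltW.
exists y => //; move: y_in; rewrite in_itv /= => /andP[y1 y2].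
apply: le_trans (_ : f <= d); last by rewrite ge_min lexx.
by rewrite ler_norml; apply/andP; split; lra.
Qed.

Lemma not_small (a b t0 : R) : 0 < a -> 0 < t0 ->
  ~ (forall t, 0 < t < t0 -> a <= b * t).
Proof.
move=> a0 t00 h; have b_gt0 : 0 < b.
  have := h (t0 / 2); have -> : 0 < t0 / 2 < t0 by apply/andP; split; lra.
  move=> /(_ isT) h2; rewrite ltNge; apply/negP => b0; nra.
pose t := Num.min (t0 / 2) (a / (2 * b)).
have t1 : t <= t0 / 2 by rewrite ge_min lexx.
have t2 : t <= a / (2 * b) by rewrite ge_min lexx orbT.
have t_gt0 : 0 < t by rewrite lt_min !divr_gt0 // mulr_gt0.
have /h : 0 < t < t0 by rewrite t_gt0 /=; lra.
have : b * t <= a / 2.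
  have -> : a / 2 = b * (a / (2 * b)) by field; rewrite gt_eqF.
  by rewrite ler_pM2l.
lra.
Qed.

(** Same order of growth as t tends to 0 from the right; comparison with a power of t determines an
    order of vanishing ([comparable_pow]). *)
Definition comparable_near0 (f g : R -> R) := exists k K t0 : R,
  [/\ 0 < k, 0 < K, 0 < t0 & forall t, 0 < t < t0 -> k * g t <= f t <= K * g t].

Lemma comparable_pow (e : {poly R}) (M N : nat) : e.[0] != 0 ->
  comparable_near0 (fun t => t ^+ M * `|e.[t]|) (fun t => t ^+ N) -> M = N.
Proof.
move=> e0 [k [K [t0 [k_gt0 K_gt0 t0_gt0 ktK]]]].
have n0 : 0 < `|e.[0]| / 2 by rewrite divr_gt0 ?normr_gt0.
have [t1 t1_gt0 et1] := poly_cont 0 e n0.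
pose s := Num.min (Num.min t0 t1) 1.
have s_gt0 : 0 < s by rewrite !lt_min t0_gt0 t1_gt0 ltr01.
have near t : 0 < t < s ->
    [/\ 0 < t, t <= 1, k * t ^+ N <= t ^+ M * (2 * `|e.[0]|) & t ^+ M * (`|e.[0]| / 2) <= K * t ^+ N].
  rewrite !lt_min => /andP[t_gt0 /andP[/andP[tt0 tt1] t_lt1]].
  have /andP[h1 h2] : k * t ^+ N <= t ^+ M * `|e.[t]| <= K * t ^+ N by apply: ktK; rewrite t_gt0.
  have := et1 t; rewrite subr0 gtr0_norm // => /(_ tt1) h3.
  have tM : 0 < t ^+ M by rewrite exprn_gt0.
  split=> //; first exact: ltW.
    apply: le_trans h1 _; rewrite ler_pM2l //.
    have := ler_normD e.[0] (e.[t] - e.[0]); rewrite subrKC; lra.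
  apply: le_trans _ h2; rewrite ler_pM2l //.
  have := ler_normD e.[t] (e.[0] - e.[t]); rewrite subrKC [`|e.[0] - e.[t]|]distrC; lra.
have pow_le t i : 0 < t -> t <= 1 -> t ^+ i.+1 <= t.
  by move=> t_gt0 t1'; rewrite -[X in _ <= X]expr1 ler_wiXn2l // ltW.
have [MN|NM|//] := ltngtP M N; exfalso.
  apply: (not_small (b := K) n0 s_gt0) => t /near[t_gt0 t_le1 _].
  have -> : N = (M + (N - M).-1.+1)%N by lia.
  rewrite exprD [K * _]mulrCA ler_pM2l ?exprn_gt0 // => h.
  by apply: le_trans h _; rewrite ler_pM2l // pow_le.
apply: (not_small (b := 2 * `|e.[0]|) k_gt0 s_gt0) => t /near[t_gt0 t_le1 + _].
have -> : M = (N + (M - N).-1.+1)%N by lia.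
rewrite exprD mulrC -mulrA ler_pM2l ?exprn_gt0 // => h.
by apply: le_trans h _; rewrite mulrC ler_pM2l ?pow_le // mulr_gt0 ?normr_gt0.
Qed.

Lemma mup_comparable (p : {poly R}) y N :
  comparable_near0 (fun t => `|p.[y + t]|) (fun t => t ^+ N) ->
  p != 0 /\ mup y p = N.
Proof.
move=> h; have p0 : p != 0.
  case: h => k [K [t0 [k_gt0 K_gt0 t0_gt0 /(_ (t0 / 2))]]].
  have t_gt0 : 0 < t0 / 2 by rewrite divr_gt0.
  have -> : 0 < t0 / 2 < t0 by rewrite t_gt0 /=; lra.
  move=> /(_ isT)/andP[h _]; apply: contraTneq h => ->.
  by rewrite horner0 normr0 -ltNge mulr_gt0 // exprn_gt0.
split=> //; have [s sy pE] := mup_spec y p0; set m := mup y p in pE *.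
apply: (@comparable_pow (s \Po ('X + y%:P))).
  by rewrite horner_comp !hornerE -rootE.
case: h => k [K [t0 [k_gt0 K_gt0 t0_gt0 h]]]; exists k, K, t0; split=> // t tt0.
have := h t tt0; rewrite pE hornerM horner_exp hornerXsubC addrAC subrr add0r.
case/andP: tt0 => t_gt0 _; rewrite normrM normrX (gtr0_norm t_gt0) [`|s.[y + t]| * _]mulrC.
by rewrite horner_comp hornerD hornerX hornerC [t + y]addrC.
Qed.

(** A pair (c, x) stands for a branch leaving the root c with slope x. Branches from the same root
    separate like t because their slopes differ, those from different roots stay apart; the exponent
    is the boolean [p.1 == q.1] read as 1 or 0. *)
Lemma pair_estimate (p q : R * R) : p != q -> exists k K d t0 : R,
  [/\ 0 < k, 0 < K, 0 < d, 0 < t0 & forall t y z, 0 < t < t0 ->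
    `|y - p.2| <= d -> `|z - q.2| <= d ->
    k * t ^+ (p.1 == q.1) <= `|(p.1 + t * y) - (q.1 + t * z)| <= K * t ^+ (p.1 == q.1)].
Proof.
case: p q => [c x] [c' x'] /= neq; have [cc|cc] := eqVneq c c'.
  have xx : x != x' by apply: contraNneq neq => ->; rewrite cc.
  set D := `|x - x'|; have D_gt0 : 0 < D by rewrite normr_gt0 subr_eq0.
  (* Moving both slopes by at most D / 4 changes their distance D by at most D / 2. *)
  exists (D / 2), (2 * D), (D / 4), 1; split; rewrite ?ltr01 ?divr_gt0 ?mulr_gt0 //.
  move=> t y z /andP[t_gt0 _] hy hz; rewrite cc expr1.
  have -> : c' + t * y - (c' + t * z) = t * (y - z) by ring.
  rewrite normrM gtr0_norm // ![_ * t]mulrC !ler_pM2l //.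
  have h1 := ler_normD ((x - y) + (z - x')) (y - z).
  have h2 := ler_normD (x - y) (z - x'); have h3 := ler_normD ((y - x) + (x' - z)) (x - x').
  have h4 := ler_normD (y - x) (x' - z).
  rewrite (_ : _ + (y - z) = x - x') in h1; last by ring.
  rewrite (_ : _ + (x - x') = y - z) in h3; last by ring.
  rewrite -/D [`|x - y|]distrC [`|x' - z|]distrC in h1 h2 h3 h4.
  by apply/andP; split; lra.
set D := `|c - c'|; have D_gt0 : 0 < D by rewrite normr_gt0 subr_eq0.
set M := `|x - x'| + 2; have M_gt0 : 0 < M by rewrite ltr_wpDl.
(* M bounds |y - z| once both slopes move by at most 1, and the bound on t keeps t M at most D / 2,
   half the distance of the roots. *)
exists (D / 2), (2 * D), 1, (D / (2 * M)); split; rewrite ?ltr01 ?divr_gt0 ?mulr_gt0 //.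
move=> t y z /andP[t_gt0 tt0] hy hz; rewrite expr0 !mulr1.
have -> : c + t * y - (c' + t * z) = (c - c') + t * (y - z) by ring.
have tM : t * M <= D / 2.
  have -> : D / 2 = D / (2 * M) * M by field; rewrite gt_eqF.
  by rewrite ler_pM2r // ltW.
have h1 := ler_normD ((y - x) + (x' - z)) (x - x'); have h2 := ler_normD (y - x) (x' - z).
rewrite (_ : _ + (x - x') = y - z) in h1; last by ring.
rewrite [`|x' - z|]distrC in h2; have yz : `|y - z| <= M by rewrite /M; lra.
have tyz : `|t * (y - z)| <= D / 2.
  by apply: le_trans tM; rewrite normrM gtr0_norm // ler_pM2l.
have h3 := ler_normD (c - c') (t * (y - z)).
have h4 := ler_normD (c - c' + t * (y - z)) (- (t * (y - z))).
rewrite addrK normrN in h4.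
by rewrite -/D in h3 h4; apply/andP; split; lra.
Qed.

Lemma prod_estimate (l : seq ((R * R) * (R * R))) :
  all (fun pq => pq.1 != pq.2) l -> exists k K d t0 : R,
  [/\ 0 < k, 0 < K, 0 < d, 0 < t0 & forall t (psi : R * R -> R), 0 < t < t0 ->
    {in l, forall pq, `|psi pq.1 - pq.1.2| <= d /\ `|psi pq.2 - pq.2.2| <= d} ->
    let N := (\sum_(pq <- l) (pq.1.1 == pq.2.1))%N in
    k * t ^+ N
    <= \prod_(pq <- l) `|(pq.1.1 + t * psi pq.1) - (pq.2.1 + t * psi pq.2)| <= K * t ^+ N].
Proof.
elim: l => [_|[p q] l IH /= /andP[pq /IH[k [K [d [t0 [k0 K0 d0 t00 h]]]]]]].
  exists 1, 1, 1, 1; split=> // t psi _ _ /=.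
  by rewrite !big_nil expr0 mulr1 lexx.
have [k' [K' [d' [t0' [k0' K0' d0' t00' h']]]]] := pair_estimate pq.
exists (k' * k), (K' * K), (Num.min d' d), (Num.min t0' t0).
split; rewrite ?mulr_gt0 ?lt_min ?d0 ?t00 ?d0' ?t00' // => t psi.
rewrite lt_min => /andP[t_gt0 /andP[tt0' tt0]] hpsi.
have [|||h1 h2] := andP (h' t (psi p) (psi q) _ _ _).
- by rewrite t_gt0.
- by have [] := hpsi (p, q) (mem_head _ _); rewrite le_min => /andP[].
- by have [] := hpsi (p, q) (mem_head _ _); rewrite !le_min => _ /andP[].
have [||h3 h4] := andP (h t psi _ _).
- by rewrite t_gt0.
- move=> pq' pql; have [] := hpsi pq'; first by rewrite inE pql orbT.
  by rewrite !le_min => /andP[_ ->] /andP[_ ->].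
rewrite /= !big_cons /= exprD; apply/andP; split.
  rewrite mulrACA; apply: ler_pM => //; rewrite mulr_ge0 // ?exprn_ge0 // ltW //.
by rewrite mulrACA; apply: ler_pM => //; rewrite prodr_ge0.
Qed.

End OrderEstimate.

(** * Order of the discriminant at the collision fiber *)

Section ResultantRoots.
Variable F : fieldType.

(** Paired with the powers of x, a row of the Sylvester matrix evaluates a shifted copy of p or of
    q. *)
Lemma Sylvester_row (p q : {poly F}) (x : F) : p != 0 -> q != 0 ->
  (forall i : 'I_(size q).-1,
    \sum_j Sylvester_mx p q (lshift _ i) j * x ^+ j = x ^+ i * p.[x]) /\
  (forall i : 'I_(size p).-1,
    \sum_j Sylvester_mx p q (rshift _ i) j * x ^+ j = x ^+ i * q.[x]).
Proof.
move=> p0 q0; have szp : (0 < size p)%N by rewrite size_poly_gt0.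
have szq : (0 < size q)%N by rewrite size_poly_gt0.
have rowE (r : {poly F}) (k i : nat) : (i + size r <= k)%N ->
    \sum_(j < k) (r`_(j - i) *+ (i <= j)%N) * x ^+ j = x ^+ i * r.[x].
  move=> ik; rewrite -(hornerXn x i) -hornerM (@horner_coef_wide _ k); last first.
    by apply: leq_trans (size_polyMleq _ _) _; rewrite size_polyXn addSn.
  by apply: eq_bigr => j _; rewrite coefXnM ltnNge if_neg -mulrb.
split=> i; have i_lt := ltn_ord i.
  rewrite -(rowE p ((size q).-1 + (size p).-1)%N); last by lia.
  by apply: eq_bigr => j _; rewrite Sylvester_mxE; case: split_ordP => k; [move/lshift_inj <-|move/eqP; rewrite eq_lrshift].
rewrite -(rowE q ((size q).-1 + (size p).-1)%N); last by lia.
apply: eq_bigr => j _; rewrite Sylvester_mxE; case: split_ordP => k.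
  by move/eqP; rewrite eq_rlshift.
by move=> /rshift_inj <-.
Qed.

Lemma det_Vandermonde_row_mx m n (a : 'rV[F]_m) (b : 'rV[F]_n) :
  \det (Vandermonde (m + n) (row_mx a b)) =
  \det (Vandermonde m a) * \det (Vandermonde n b) * \prod_i \prod_j (b 0 j - a 0 i).
Proof.
rewrite !det_Vandermonde big_split_ord /= mulrAC; congr (_ * _); last first.
  apply: eq_bigr => i _; rewrite big_split_ord /= big1 ?mul1r => [|j]; last first.
    by rewrite ltnNge ltnW // ltn_addr.
  by apply: eq_big => j; rewrite ?ltn_add2l // !row_mxEr.
rewrite -big_split /=; apply: eq_bigr => i _; rewrite big_split_ord /=; congr (_ * _).
  by apply: eq_bigr => j _; rewrite !row_mxEl.
by apply: eq_big => j; rewrite ?ltn_addr // row_mxEl row_mxEr.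
Qed.

(* The extra points r make the Sylvester matrix times a Vandermonde matrix
   block triangular. *)
Lemma resultant_rprod_aux (p q : {poly F}) (r : 'rV[F]_(size q).-1)
    (l : 'rV[F]_(size p).-1) : p != 0 -> q != 0 -> (forall j, p.[l 0 j] = 0) ->
  resultant p q * \det (Vandermonde _ (row_mx r l)) =
  (\det (Vandermonde _ r) * \prod_i p.[r 0 i])
  * (\det (Vandermonde _ l) * \prod_i q.[l 0 i]).
Proof.
move=> p0 q0 pl; rewrite /resultant -det_mulmx.
have Srow x := Sylvester_row x p0 q0.
pose D k (a : 'rV[F]_k) (f : {poly F}) := Vandermonde k a *m diag_mx (\row_j f.[a 0 j]).
have detD k (a : 'rV[F]_k) f : \det (D k a f) = \det (Vandermonde k a) * \prod_i f.[a 0 i].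
  by rewrite det_mulmx det_diag; congr (_ * _); apply: eq_bigr => i _; rewrite mxE.
have -> : Sylvester_mx p q *m Vandermonde _ (row_mx r l)
   = block_mx (D _ r p) 0 (\matrix_(i, j) (r 0 j ^+ i * q.[r 0 j])) (D _ l q).
  apply/matrixP => i j; rewrite mxE.
  under eq_bigr do rewrite [Vandermonde _ _ _ _]mxE.
  rewrite -(splitK i) -(splitK j); case: (split i) => {}i; case: (split j) => {}j /=.
  - rewrite block_mxEul row_mxEl (Srow _).1 !mxE (bigD1 j) //= big1 ?addr0.
      by rewrite !mxE eqxx mulr1n.
    by move=> k kj; rewrite !mxE (negPf kj) mulr0n mulr0.
  - by rewrite block_mxEur row_mxEr (Srow _).1 pl mulr0 mxE.
  - by rewrite block_mxEdl row_mxEl (Srow _).2 mxE.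
  - rewrite block_mxEdr row_mxEr (Srow _).2 !mxE (bigD1 j) //= big1 ?addr0.
      by rewrite !mxE eqxx mulr1n.
    by move=> k kj; rewrite !mxE (negPf kj) mulr0n mulr0.
by rewrite det_lblock !detD.
Qed.
End ResultantRoots.

Lemma exists_fresh (R : realDomainType) (l : seq R) k :
  exists r : 'rV[R]_k, injective (r 0) /\ forall i, r 0 i \notin l.
Proof.
pose b := \sum_(x <- l) `|x| + 1.
exists (\row_(i < k) (b + i%:R)); split=> [i j|i].
  by rewrite !mxE => /addrI/eqP; rewrite eqr_nat => /eqP/val_inj.
rewrite mxE; apply/negP => bl; have : `|b + i%:R| <= \sum_(x <- l) `|x|.
  by rewrite (big_rem _ bl) /= lerDl sumr_ge0.
have b0 : 0 <= \sum_(x <- l) `|x| by rewrite sumr_ge0.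
have i0 : 0 <= i%:R :> R by rewrite ler0n.
by rewrite ger0_norm /b; lra.
Qed.

Lemma det_Vandermonde_neq0 (F : fieldType) n (a : 'rV[F]_n) :
  injective (a 0) -> \det (Vandermonde n a) != 0.
Proof.
move=> a_inj; rewrite det_Vandermonde; apply/prodf_neq0 => i _.
apply/prodf_neq0 => j ij; rewrite subr_eq0 (inj_eq a_inj).
by apply: contraTneq ij => ->; rewrite ltnn.
Qed.

(** In [resultant_rprod_aux] the Vandermonde factors cancel up to sign. The auxiliary points are
    distinct and off the roots of p, which makes the cancelled factors nonzero. *)
Lemma resultant_rprod (R : realFieldType) (l : seq R) (q : {poly R}) : uniq l -> q != 0 ->
  `|resultant (rprod l) q| = \prod_(x <- l) `|q.[x]|.
Proof.
move=> l_uniq q0; set p := rprod l; have szp : (size p).-1 = size l by rewrite size_rprod.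
have [r [r_inj rl]] := exists_fresh l (size q).-1.
pose a : 'rV[R]_(size p).-1 := \row_i l`_i.
have a_inj : injective (a 0).
  move=> i j; rewrite !mxE => /eqP; have := ltn_ord i; have := ltn_ord j.
  by rewrite {2 4}szp => jl il; rewrite nth_uniq // => /eqP/val_inj.
have prodl (f : R -> R) : \prod_i f (a 0 i) = \prod_(x <- l) f x.
  rewrite (big_nth 0) big_mkord -szp; apply: eq_bigr => i _; by rewrite mxE.
have pa j : p.[a 0 j] = 0.
  by apply/rootP; rewrite root_prod_XsubC mxE mem_nth // -szp.
have := resultant_rprod_aux r (rprod_neq0 l) q0 pa.
rewrite det_Vandermonde_row_mx prodl => /(congr1 Num.norm); rewrite !normrM.
set vr := `|\det (Vandermonde _ r)|; set va := `|\det (Vandermonde _ a)|; have vr0 : vr != 0 by rewrite normr_eq0 det_Vandermonde_neq0.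
have va0 : va != 0 by rewrite normr_eq0 det_Vandermonde_neq0.
have -> : `|\prod_i \prod_j (a 0 j - r 0 i)| = `|\prod_i p.[r 0 i]|.
  rewrite !normr_prod; apply: eq_bigr => i _; rewrite (prodl (fun x => x - r 0 i)).
  rewrite /p /rprod horner_prod !normr_prod; apply: eq_bigr => x _.
  by rewrite hornerXsubC distrC.
have pr0 : `|\prod_i p.[r 0 i]| != 0.
  rewrite normr_eq0; apply/prodf_neq0 => i _.
  by rewrite -rootE root_prod_XsubC.
move=> E; rewrite -normr_prod; apply: (mulIf (mulf_neq0 (mulf_neq0 vr0 va0) pr0)).
by rewrite E; ring.
Qed.

Lemma rprod_deriv_root (F : fieldType) (l : seq F) x : uniq l -> x \in l ->
  (rprod l)^`().[x] = \prod_(y <- l | y != x) (x - y).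
Proof.
move=> l_uniq xl; rewrite /rprod (bigD1_seq x) //= derivM derivXsubC mul1r.
rewrite hornerD hornerM hornerXsubC subrr mul0r addr0 horner_prod.
by apply: eq_bigr => y _; rewrite hornerXsubC.
Qed.

Lemma monic_disc_rprod (R : realFieldType) (l : seq R) : uniq l -> l != [::] ->
  `|monic_disc (rprod l)| = \prod_(x <- l) \prod_(y <- l | y != x) `|x - y|.
Proof.
move=> l_uniq l0; have q0 : (rprod l)^`() != 0.
  rewrite -size_poly_gt0 size_deriv size_rprod /= lt0n size_eq0 //.
rewrite /monic_disc normrM normrX normrN normr1 expr1n mul1r resultant_rprod //.
rewrite !big_seq; apply: eq_bigr => x xl.
by rewrite rprod_deriv_root // normr_prod.
Qed.

(** As c runs over [s] with repetition, this is the sum of m (m - 1) over the distinct entries, m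
    being the multiplicity. *)
Definition collision_order (T : eqType) (s : seq T) :=
  (\sum_(c <- s) (count_mem c s).-1)%N.

Section DiscOrder.
Variables (R : rcfType) (n : nat).
Hypothesis n_gt0 : (0 < n)%N.
Implicit Types (A B al be : 'I_n -> R) (a b c x t d : R).

Definition conv_at A B al be t : {poly R} :=
  n`!%:R^-1 *: dconv n (fiberpoly A al t) (fiberpoly B be t).

Lemma fact_neq0 : n`!%:R != 0 :> R.
Proof. by rewrite pnatr_eq0 -lt0n fact_gt0. Qed.

Lemma monic_dconv (p q : {poly R}) : p \is monic -> q \is monic ->
  size p = n.+1 -> size q = n.+1 ->
  n`!%:R^-1 *: dconv n p q \is monic /\ size (n`!%:R^-1 *: dconv n p q) = n.+1.
Proof.
move=> /monicP p1 /monicP q1 szp szq; set H := _ *: _.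
have Hn : H`_n = 1.
  rewrite coefZ lead_coef_dconv ?szp //; move: p1 q1; rewrite /lead_coef szp szq /= => -> ->.
  by rewrite mulr1 mulVf ?fact_neq0.
have szH : size H = n.+1.
  apply/eqP; rewrite eqn_leq; apply/andP; split.
    by rewrite -szp; apply: leq_trans (size_scale_leq _ _) (size_dconv_le _ _ _).
  by rewrite ltnNge; apply/negP => /leq_sizeP/(_ n (leqnn _))/eqP; rewrite Hn oner_eq0.
by split=> //; apply/monicP; rewrite /lead_coef szH.
Qed.

Lemma monic_conv_at A B al be t :
  conv_at A B al be t \is monic /\ size (conv_at A B al be t) = n.+1.
Proof.
by apply: monic_dconv; rewrite ?size_fiberpoly // /fiberpoly monic_prod_XsubC.
Qed.

Lemma conv_at_split A B al be t : exists s, size s = n /\ conv_at A B al be t = rprod s.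
Proof.
have [/monicP mon sz] := monic_conv_at A B al be t.
have [|s sE] := @real_rooted_split _ (conv_at A B al be t).
  move=> z; rewrite /conv_at map_polyZ rootZ ?fmorph_eq0 ?invr_neq0 ?fact_neq0 //.
  rewrite map_dconv !fiberpolyE !map_rprod => zr.
  by apply: (@dconv_real_rooted _ (codom (fun i => A i + t * al i))
    (codom (fun i => B i + t * be i))); rewrite ?size_codomI.
exists s; rewrite mon scale1r in sE; split=> //.
by apply: succn_inj; rewrite -sz sE size_rprod.
Qed.

Lemma uniform_near (T : eqType) (l : seq T) (P : T -> R -> Prop) :
  (forall p, p \in l -> exists2 t0, 0 < t0 & forall t, 0 < t < t0 -> P p t) ->
  exists2 t0, 0 < t0 & forall t, 0 < t < t0 -> forall p, p \in l -> P p t.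
Proof.
elim: l => [_|p l IH h]; first by exists 1.
have [t1 t1_gt0 h1] := h p (mem_head _ _).
have [|t2 t2_gt0 h2] := IH; first by move=> q ql; apply: h; rewrite inE ql orbT.
exists (Num.min t1 t2) => [|t]; first by rewrite lt_min t1_gt0.
rewrite lt_min => /andP[t_gt0 /andP[tt1 tt2]] q; rewrite inE => /predU1P[->|ql].
  by apply: h1; rewrite t_gt0.
by apply: h2 => //; rewrite t_gt0.
Qed.

(** Each element of [L] is a branch, given by its root at t = 0 and its slope. The distinct roots
    are added one at a time, each with the m slopes from [local_model]. *)
Lemma local_roots A B al be (s : seq R) :
  uniq s \/ (injective al /\ injective be) ->
  conv_at A B al be 0 = rprod s ->
  exists L : seq (R * R), [/\ uniq L, perm_eq (map fst L) s
    & forall p, p \in L -> forall d, 0 < d -> exists2 t0, 0 < t0 &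
        forall t, 0 < t < t0 ->
          exists y, `|y - p.2| <= d /\ root (conv_at A B al be t) (p.1 + t * y)].
Proof.
move=> s_inj sE; 
pose good (p : R * R) := forall d, 0 < d -> exists2 t0, 0 < t0 & forall t, 0 < t < t0 ->
  exists y, `|y - p.2| <= d /\ root (conv_at A B al be t) (p.1 + t * y).
pose H := convfam A B al be; have HE t : conv_at A B al be t = n`!%:R^-1 *: map_poly (horner_eval t) H.
  by rewrite /conv_at /H convfamE.
have nf : n`!%:R^-1 != 0 :> R by rewrite invr_neq0 ?fact_neq0.
set H0 := map_poly (horner_eval 0) H.
have H0_neq0 : H0 != 0.
  have : conv_at A B al be 0 != 0 by rewrite sE rprod_neq0.
  by rewrite HE scaler_eq0 negb_or => /andP[].
have mupE c : mup c H0 = count_mem c s by rewrite -(mupZ c _ nf) -HE sE mu_prod_XsubC.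
suff build cs : uniq cs -> {subset cs <= s} -> exists L : seq (R * R), [/\ uniq L,
    forall c, count_mem c (map fst L) = if c \in cs then count_mem c s else 0%N
    & forall p, p \in L -> good p].
  have [||L [L_uniq L_count L_good]] := build (undup s); rewrite ?undup_uniq //.
    by move=> c; rewrite mem_undup.
  exists L; split=> //; apply/allP => c _ /=; apply/eqP; rewrite L_count mem_undup.
  by case: ifPn => // /count_memPn ->.
elim: cs => [_ _|c cs IH /= /andP[c_cs cs_uniq] cs_s]; first by exists [::].
have [//||L [L_uniq L_count L_good]] := IH; first by move=> x xc; apply: cs_s; rewrite inE xc orbT.
have H0c : root H0 c by rewrite -mup_gt0 // mupE -has_count has_pred1 cs_s ?mem_head.
have inj_c : root H0^`() c -> injective al /\ injective be.
  case: s_inj => // s_uniq; have [H0'_neq0 mE] := mup_deriv H0_neq0 H0c.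
  rewrite -mup_gt0 //; have := mE; rewrite mupE count_uniq_mem //.
  by case: (mup _ _) => // k; case: (c \in s).
have [G [u [u_uniq szu u_root HG]]] := local_model n_gt0 inj_c H0_neq0 H0c.
exists ([seq (c, x) | x <- u] ++ L); split=> [|c'|p].
- rewrite cat_uniq L_uniq andbT map_inj_uniq ?u_uniq //=; last by move=> x y [].
  apply/hasPn => p pL; apply/mapP => -[x _ pE].
  have := L_count c; rewrite (negPf c_cs) => /eqP; rewrite -leqn0 leqNgt -has_count.
  by rewrite has_pred1 => /negP; apply; apply/mapP; exists p => //; rewrite pE.
- rewrite map_cat count_cat -map_comp L_count inE.
  have -> : count_mem c' [seq (fst \o pair c) i | i <- u] = ((c' == c) * size u)%N.
    rewrite count_map; have [->|c'c] := eqVneq c' c.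
      by rewrite mul1n -count_predT; apply: eq_count => x /=; rewrite eqxx.
    by apply/eqP; rewrite -leqn0 leqNgt -has_count; apply/hasPn => x _ /=; rewrite eq_sym.
  have [->|_] /= := eqVneq c' c; last by rewrite mul0n add0n.
  by rewrite (negPf c_cs) szu mupE mul1n addn0.
rewrite mem_cat => /orP[/mapP[x xu ->]|]; last exact: L_good.
move=> d d_gt0; have [G0x G0'x] := u_root x xu.
have [t0 t0_gt0 ht0] := near_root d_gt0 G0x G0'x.
exists t0 => // t tt0; have [y yx Gy] := ht0 t tt0; exists y; split=> //.
case/andP: tt0 => t_gt0 _; have t_neq0 : t != 0 by rewrite gt_eqF.
rewrite HE rootZ // rootE HG //.
by rewrite -horner2 (rootP Gy) mulr0.
Qed.

Lemma collision_orderE (L : seq (R * R)) (s : seq R) : uniq L -> perm_eq (map fst L) s ->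
  (\sum_(p <- L) \sum_(q <- L | q != p) (p.1 == q.1))%N = collision_order s.
Proof.
move=> L_uniq Ls; rewrite /collision_order -(perm_big _ Ls) big_map /= !big_seq.
apply: eq_bigr => p pL; rewrite -(permP Ls) count_map.
have -> : count (preim fst (pred1 p.1)) L = (\sum_(q <- L) (p.1 == q.1))%N.
  by rewrite -sum1_count [LHS]big_mkcond; apply: eq_bigr => q _ /=; rewrite eq_sym; case: eqP.
by rewrite [in RHS](bigD1_seq p) //= eqxx.
Qed.

(** The n branches yield n roots of the fiber at t, which the lower product estimate keeps distinct.
    They are thus all the roots, and the discriminant is, up to sign, the product of their
    differences. The exponent counts the ordered pairs of distinct branches leaving the same
    root. *)
Lemma disc_order A B al be (s : seq R) :
  uniq s \/ (injective al /\ injective be) ->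
  conv_at A B al be 0 = rprod s ->
  comparable_near0 (fun t => `|monic_disc (conv_at A B al be t)|)
                   (fun t => t ^+ collision_order s).
Proof.
move=> s_inj sE.
have [L [L_uniq Ls L_good]] := local_roots s_inj sE.
have szs : size s = n.
  by apply: succn_inj; rewrite -size_rprod -sE; have [] := monic_conv_at A B al be 0.
have szL : size L = n by rewrite -szs -(perm_size Ls) size_map.
pose PQ := [seq (p, q) | p <- L, q <- [seq q <- L | q != p]].
have PQP pq : pq \in PQ -> [/\ pq.1 \in L, pq.2 \in L & pq.1 != pq.2].
  case/allpairsPdep => p [q [pL]]; rewrite mem_filter => /andP[qp qL] ->.
  by rewrite /= eq_sym.
have inPQ p q : p \in L -> q \in L -> p != q -> (p, q) \in PQ.
  move=> pL qL pq; apply/allpairsPdep; exists p, q; split=> //.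
  by rewrite mem_filter eq_sym pq.
have [|k [K [d [t1 [k_gt0 K_gt0 d_gt0 t1_gt0 hPQ]]]]] := @prod_estimate _ PQ.
  by apply/allP => pq /PQP[].
have [t2 t2_gt0 ht2] := uniform_near (fun p pL => L_good p pL d d_gt0).
exists k, K, (Num.min t1 t2); split=> //; first by rewrite lt_min t1_gt0.
move=> t; rewrite lt_min => /andP[t_gt0 /andP[tt1 tt2]].
have : forall p : R * R, exists y, p \in L ->
    `|y - p.2| <= d /\ root (conv_at A B al be t) (p.1 + t * y).
  move=> p; have [pL|pL] := boolP (p \in L); last by exists 0.
  have [|y hy] := ht2 t _ p pL; first by rewrite t_gt0.
  by exists y.
case/boolp.choice => psi hpsi.
have [||] := andP (hPQ t psi _ _); first by rewrite t_gt0.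
  by move=> pq /PQP[p1 p2 _]; split; [have [] := hpsi _ p1|have [] := hpsi _ p2].
have -> : (\sum_(pq <- PQ) (pq.1.1 == pq.2.1))%N = collision_order s.
  rewrite -(collision_orderE L_uniq Ls) big_allpairs_dep; apply: eq_bigr => p _.
  by rewrite big_filter.
pose lam (p : R * R) := p.1 + t * psi p.
rewrite -[X in _ <= X]/(\prod_(pq <- PQ) `|lam pq.1 - lam pq.2|).
rewrite -[X in _ -> X <= _ -> _]/(\prod_(pq <- PQ) `|lam pq.1 - lam pq.2|).
move=> h1 h2; have lam_inj : {in L &, injective lam}.
  move=> p q pL qL lampq; apply/eqP; apply: contraTT h1 => pq; rewrite -ltNge.
  rewrite (big_rem _ (inPQ _ _ pL qL pq)) /= lampq subrr normr0 mul0r.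
  by rewrite mulr_gt0 // exprn_gt0.
have l_uniq : uniq (map lam L) by rewrite map_inj_in_uniq.
have [/monicP mon sz] := monic_conv_at A B al be t.
have HE : conv_at A B al be t = rprod (map lam L).
  rewrite (@all_roots_prod_XsubC _ (conv_at A B al be t) (map lam L)) ?mon ?scale1r //.
  - by rewrite sz size_map szL.
  - by apply/allP => x /mapP[p pL ->]; have [] := hpsi p pL.
  - by rewrite uniq_rootsE.
suff -> : `|monic_disc (conv_at A B al be t)| = \prod_(pq <- PQ) `|lam pq.1 - lam pq.2|.
  by rewrite h1.
rewrite HE monic_disc_rprod ?l_uniq //; last by rewrite -size_eq0 size_map szL -lt0n.
rewrite big_map big_allpairs_dep !big_seq; apply: eq_bigr => p pL.
rewrite big_map big_filter /= big_seq_cond [RHS]big_seq_cond; apply: eq_bigl => q.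
by case: (boolP (q \in L)) => //= qL; rewrite (inj_in_eq lam_inj).
Qed.
End DiscOrder.

(** * Real forms and their discriminants *)

(** The signs multiply to 1, and n! times the weight in [ffconv_coef] is the weight in [coef_dconv],
    a falling factorial being a quotient of factorials. *)
Lemma ffconvE (K : numFieldType) (A : comAlgType K) n (p q : {poly A}) :
  (size p <= n.+1)%N -> (size q <= n.+1)%N ->
  n`!%:R *: ffconv n p q = dconv n p q.
Proof.
move=> szp szq; apply/polyP => j; rewrite coefZ.
have cE : (ffconv n p q)`_j = if (j <= n)%N
    then (-1) ^+ (n - j) * ffconv_coef n p q (n - j) else 0.
  rewrite /ffconv coef_sum; case: leqP => jn.
    have jn' : (n - j < n.+1)%N by rewrite ltnS leq_subr.
    rewrite (bigD1 (Ordinal jn')) //= coefZ coefXn subKn // eqxx mulr1.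
    rewrite big1 ?addr0 // => k kj; rewrite coefZ coefXn; case: eqP => [jE|]; last by rewrite mulr0.
    by case/negP: kj; apply/eqP/val_inj => /=; rewrite jE subKn // -ltnS.
  rewrite big1 // => k _; rewrite coefZ coefXn; case: eqP => [jE|]; last by rewrite mulr0.
  by move: jn; rewrite jE ltnNge leq_subr.
rewrite cE; case: leqP => [jn|nj]; last first.
  rewrite mulr0 /dconv coef_sum big1 // => k _; rewrite coefZ coef_derivn nth_default ?mul0rn ?mulr0 //.
  by apply: leq_trans szp _; rewrite (leq_trans nj) // leq_addl.
rewrite coef_dconv // /ffconv_coef !mulr_sumr (reindex_inj rev_ord_inj) /=.
apply: eq_bigr => k _; set m := (n - j)%N.
have km : (k <= m)%N by rewrite -ltnS.
have mn : (m <= n)%N by apply: leq_subr.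
rewrite subSS subKn // /signed_coef.
have -> : (n - (m - k) = k + j)%N by rewrite /m; lia.
have -> : (n - m = j)%N by rewrite /m; lia.
have -> : (-1) ^+ (m - k) * p`_(k + j) * ((-1) ^+ k * q`_(n - k))
    = (-1) ^+ m * (q`_(n - k) * p`_(k + j)).
  by rewrite mulrACA -exprD subnK // [p`_ _ * _]mulrC.
rewrite -scalerAr [X in _ * (_ *: X)]mulrA -exprD addnn -muln2 exprM sqrr_sign mul1r -scalerAr.
rewrite [X in _ *: X]mulr_natl -!(@scaler_nat K) scalerA; congr (_ *: _).
have nf i : i`!%:R != 0 :> K by rewrite pnatr_eq0 -lt0n fact_gt0.
by rewrite -ffact_add_fact !natrM; field; rewrite !nf.
Qed.

Lemma ffconv_monic (K : numFieldType) (A : comAlgType K) n (p q : {poly A}) :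
  p \is monic -> q \is monic -> size p = n.+1 -> size q = n.+1 ->
  ffconv n p q \is monic /\ size (ffconv n p q) = n.+1.
Proof.
move=> /monicP p1 /monicP q1 szp szq; set h := ffconv n p q.
have nf : n`!%:R != 0 :> K by rewrite pnatr_eq0 -lt0n fact_gt0.
have inj : injective (fun x : A => n`!%:R * x).
  by move=> x y; rewrite /= !mulr_natl -!(@scaler_nat K) => /(scalerI nf).
have hE : n`!%:R *: h = dconv n p q by rewrite ffconvE ?szp ?szq.
have hn : h`_n = 1.
  apply: inj; rewrite -coefZ hE lead_coef_dconv ?szp //.
  by move: p1 q1; rewrite /lead_coef szp szq /= => -> ->; rewrite !mulr1.
have szh : size h = n.+1.
  apply/eqP; rewrite eqn_leq; apply/andP; split.
    apply/leq_sizeP => j nj; apply: inj; rewrite -coefZ hE mulr0.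
    by apply/(leq_sizeP _ _ _ j nj); rewrite -szp size_dconv_le.
  by rewrite ltnNge; apply/negP => /leq_sizeP/(_ n (leqnn _))/eqP; rewrite hn oner_eq0.
by split=> //; apply/monicP; rewrite /lead_coef szh.
Qed.

(** The shape of the Sylvester matrix depends on the sizes, so the morphism must preserve both
    degrees. *)
Lemma map_monic_resultant (A B : nzRingType) (f : {rmorphism A -> B}) (p q : {poly A}) :
  f (lead_coef p) != 0 -> f (lead_coef q) != 0 ->
  f (resultant p q) = resultant (map_poly f p) (map_poly f q).
Proof.
move=> nz_fp nz_fq; rewrite /resultant /Sylvester_mx !size_map_poly_id0 //.
rewrite -det_map_mx /= map_col_mx; congr (\det (col_mx _ _));
  by apply: map_lin1_mx => v; rewrite map_poly_rV rmorphM /= map_rVpoly.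
Qed.

Lemma lead_deriv (A : comNzRingType) (p : {poly A}) n : p \is monic ->
  size p = n.+2 -> n.+1%:R != 0 :> A -> lead_coef p^`() = n.+1%:R.
Proof.
move=> /monicP p1 szp n0; have pn : p^`()`_n = n.+1%:R.
  by move: p1; rewrite coef_deriv /lead_coef szp /= => ->.
have szp' : size p^`() = n.+1.
  apply/eqP; rewrite eqn_leq; apply/andP; split.
    by rewrite -ltnS -szp lt_size_deriv // -size_poly_eq0 szp.
  by rewrite ltnNge; apply/negP => /leq_sizeP/(_ n (leqnn _)) h; rewrite -pn h eqxx in n0.
by rewrite /lead_coef szp'.
Qed.

Lemma map_monic_disc (A B : comNzRingType) (f : {rmorphism A -> B}) (p : {poly A}) n :
  p \is monic -> size p = n.+2 -> n.+1%:R != 0 :> A -> n.+1%:R != 0 :> B ->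
  f (monic_disc p) = monic_disc (map_poly f p).
Proof.
move=> p_monic szp nA nB; rewrite /monic_disc rmorphM rmorphXn rmorphN rmorph1 /=.
have lp : f (lead_coef p) != 0 by rewrite (monicP p_monic) rmorph1 oner_eq0.
rewrite size_map_poly_id0 // map_monic_resultant ?deriv_map //.
by rewrite (lead_deriv p_monic szp nA) rmorph_nat.
Qed.

Section Bridge.
Variables (R : realType) (n : nat).
Implicit Types (alpha beta : 'rV[R]_n) (w : 'rV[R]_(n + n)).

Lemma size_poly_of_roots (K : fieldType) (A : comAlgType K) (rho : 'I_n -> A) :
  size (poly_of_roots rho) = n.+1.
Proof. by rewrite size_prod_XsubC /index_enum -enumT size_enum_ord. Qed.

Lemma map_hpoly (B : comNzRingType) (f : {rmorphism {mpoly R[2]} -> B}) alpha beta w :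
  n`!%:R *: map_poly f (hpoly alpha beta w) =
  dconv n
   (\prod_(i < n) ('X - (f (alpha 0 i)%:MP * f 'X_0 + f (lsubmx w 0 i)%:MP * f 'X_1)%:P))
   (\prod_(i < n) ('X - (f (beta 0 i)%:MP * f 'X_0 + f (rsubmx w 0 i)%:MP * f 'X_1)%:P)).
Proof.
rewrite -(rmorph_nat f) -map_polyZ ffconvE ?size_poly_of_roots // map_dconv.
congr (dconv n _ _); rewrite /poly_of_roots rmorph_prod; apply: eq_bigr => i _ /=;
by rewrite rmorphB /= map_polyX map_polyC /= rmorphD -!mul_mpolyC !rmorphM.
Qed.

Lemma mpoly_natr_neq0 m k : k.+1%:R != 0 :> {mpoly R[m]}.
Proof. by rewrite -mpolyC_nat mpolyC_eq0 pnatr_eq0. Qed.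

Lemma hfiberE alpha beta w y t : hfiber alpha beta w y t =
  n`!%:R^-1 *: dconv n
    (rprod (codom (fun i => alpha 0 i * y + lsubmx w 0 i * t)))
    (rprod (codom (fun i => beta 0 i * y + rsubmx w 0 i * t))).
Proof.
transitivity ((n`!%:R^-1 * n`!%:R) *: hfiber alpha beta w y t).
  by rewrite mulVf ?fact_neq0 // scale1r.
rewrite -scalerA /hfiber map_hpoly.
by rewrite !rprod_codom; congr (_ *: dconv n _ _); apply: eq_bigr => i _;
  rewrite /= !mevalC !mevalXU !(tnth_nth 0).
Qed.

Lemma hpoly_monic alpha beta w :
  hpoly alpha beta w \is monic /\ size (hpoly alpha beta w) = n.+1.
Proof.
by apply: ffconv_monic; rewrite ?size_poly_of_roots // /poly_of_roots monic_prod_XsubC.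
Qed.

Lemma Ddisc_eval alpha beta w y t : (0 < n)%N ->
  (Ddisc alpha beta w).@[tnth [tuple y; t]] = monic_disc (hfiber alpha beta w y t).
Proof.
move=> n_gt0; have [mon sz] := hpoly_monic alpha beta w.
rewrite /Ddisc (@map_monic_disc _ _ _ _ n.-1) //; first by rewrite sz; case: (n) n_gt0.
- exact: mpoly_natr_neq0.
- by rewrite pnatr_eq0.
Qed.

Definition dehom (D : {mpoly R[2]}) : {poly R} :=
  mmap (fun c : R => c%:P) (tnth [tuple 'X; 1]) D.

Lemma dehom_eval (D : {mpoly R[2]}) y : (dehom D).[y] = D.@[tnth [tuple y; 1]].
Proof.
rewrite /dehom /meval /mmap horner_sum; apply: eq_bigr => m _.
rewrite hornerM hornerC; congr (_ * _); rewrite /mmap1 horner_prod.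
apply: eq_bigr => i _; rewrite horner_exp; congr (_ ^+ _).
by rewrite !(tnth_nth 0); case: i => -[|[|//]] i_lt /=; rewrite ?hornerX ?hornerC.
Qed.

Lemma nonreal_zerosE (D : {mpoly R[2]}) : dehom D != 0 ->
  exists l : seq R[i], [/\ size (dehom D) = (size l).+1,
    nonreal_zeros D = count (fun z => complex.Im z != 0) l
    & forall y : R, count_mem y%:C l = mup y (dehom D)].
Proof.
move=> d0; rewrite /nonreal_zeros; set d := mmap _ _ D.
have dE : d = map_poly (real_complex R) (dehom D).
  rewrite /d /dehom /mmap rmorph_sum; apply: eq_bigr => m _.
  rewrite rmorphM /= map_polyC; congr (_ * _); rewrite /mmap1 rmorph_prod.
  apply: eq_bigr => i _; rewrite rmorphXn /=; congr (_ ^+ _).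
  by rewrite !(tnth_nth 0); case: i => -[|[|//]] i_lt /=; rewrite ?map_polyX ?rmorph1.
case: closed_field_poly_normal => l /= lE; exists l.
have d0' : d != 0 by rewrite dE map_poly_eq0.
have lc0 : lead_coef d != 0 by rewrite lead_coef_eq0.
split=> // [|y].
  by rewrite -(size_map_poly (real_complex R)) -dE lE size_scale // size_prod_XsubC.
rewrite -(mu_prod_XsubC y%:C l) -(mupZ _ _ lc0) -lE dE.
have [s sy ->] := mup_spec y d0.
rewrite rmorphM rmorphXn rmorphB /= map_polyX map_polyC /= mupMr.
  by rewrite !mup_XsubCX eqxx mupMr // mup_XsubCX eqxx.
by rewrite /root horner_map fmorph_eq0.
Qed.
End Bridge.

Lemma collision_order_full (T : eqType) (s : seq T) c : count_mem c s = size s ->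
  collision_order s = (size s * (size s).-1)%N.
Proof.
move=> cs; rewrite /collision_order big_seq (eq_bigr (fun=> (size s).-1)).
  by rewrite -big_seq big_const_seq count_predT iter_addn_0 mulnC.
move=> x xs; have /allP/(_ x xs)/eqP -> : all (pred1 c) s by rewrite all_count cs.
by rewrite cs.
Qed.

Lemma collision_order_almost (T : eqType) (s : seq T) c n : (2 < n)%N ->
  size s = n -> count_mem c s = n.-1 -> collision_order s = (n.-1 * n.-2)%N.
Proof.
move=> n3 szs cs; rewrite /collision_order (bigID (pred1 c)) /=.
rewrite [X in (X + _)%N](_ : _ = (n.-1 * n.-2)%N); last first.
  rewrite (eq_bigr (fun=> n.-2)) => [|x /eqP ->]; last by rewrite cs.
  by rewrite big_const_seq cs iter_addn_0 mulnC.
have one : count (predC (pred1 c)) s = 1%N.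
  by have := count_predC (pred1 c) s; rewrite cs szs; lia.
rewrite big1 ?addn0 // => x xc; apply/eqP; rewrite -leqn0 -ltnS.
have : (count_mem x s <= count (predC (pred1 c)) s)%N.
  by apply: sub_count => y /= /eqP ->.
by rewrite one; case: (count_mem x s) => [|[]].
Qed.

(** Each of the n entries contributes at most n - 3, and n (n - 3) = (n - 1) (n - 2) - 2. *)
Lemma collision_order_lt (T : eqType) (s : seq T) n : (2 < n)%N -> size s = n ->
  (forall c, (count_mem c s <= n.-2)%N) -> (collision_order s < n.-1 * n.-2)%N.
Proof.
move=> n3 szs cs; apply: (@leq_ltn_trans (n * (n - 3))%N).
  have -> : (n * (n - 3) = \sum_(c <- s) (n - 3))%N.
    by rewrite big_const_seq count_predT iter_addn_0 mulnC szs.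
  by apply: leq_sum => c _; have := cs c; lia.
by case: n n3 {szs cs} => [|[|[|n]]] //= _; rewrite subSS; nia.
Qed.

Lemma collision_order_uniq (T : eqType) (s : seq T) : uniq s -> collision_order s = 0%N.
Proof.
move=> s_uniq; rewrite /collision_order big1_seq // => c /= cs.
by rewrite count_uniq_mem // cs.
Qed.

Lemma collision_order_gt0 (T : eqType) (s : seq T) :
  (0 < collision_order s)%N -> exists c, (1 < count_mem c s)%N.
Proof.
move=> s_gt0; have [/hasP[c _ h]|] := boolP (has (fun c => 1 < count_mem c s)%N s).
  by exists c.
rewrite -all_predC => /allP h; suff : uniq s by move/collision_order_uniq => s0; rewrite s0 in s_gt0.
apply: count_mem_uniq => x; have [xs|/count_memPn //] := boolP (x \in s).
have := h x xs; rewrite /= -leqNgt; have : (0 < count_mem x s)%N by rewrite -has_count has_pred1.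
by case: (count_mem x s) => [|[]].
Qed.

Lemma monic_disc_neq0_uniq (R : realFieldType) (l : seq R) :
  l != [::] -> monic_disc (rprod l) != 0 -> uniq l.
Proof.
move=> l0; apply: contraR => l_nuniq; rewrite /monic_disc mulf_eq0 resultant_eq0.
apply/orP; right; have [c cl] : exists c, (1 < count_mem c l)%N.
  apply: collision_order_gt0; rewrite lt0n; apply: contraNneq l_nuniq.
  move=> /eqP; rewrite sum_nat_seq_eq0 => /allP h; apply: count_mem_uniq => x.
  have [xl|/count_memPn //] := boolP (x \in l); move: (h x xl) => /= /eqP.
  have : (0 < count_mem x l)%N by rewrite -has_count has_pred1.
  by case: (count_mem x l) => [|[]].
have p0 := rprod_neq0 l; rewrite -mu_prod_XsubC -/(rprod l) in cl.
have pc : root (rprod l) c by rewrite -mup_gt0 // (leq_trans _ cl).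
have [p'0 mE] := mup_deriv p0 pc.
have p'c : root (rprod l)^`() c by rewrite -mup_gt0 // -ltnS -mE.
have g0 : gcdp (rprod l) (rprod l)^`() != 0 by rewrite gcdp_eq0 negb_and p0.
apply: (@leq_trans (size ('X - c%:P))); first by rewrite size_XsubC.
by rewrite dvdp_leq // dvdp_gcd !dvdp_XsubCl pc.
Qed.

(** * Fibers with a repeated root *)

Section Collisions.
Variables (R : rcfType) (n : nat).
Hypothesis n_gt0 : (0 < n)%N.
Implicit Types (A B al be : 'I_n -> R) (a b c x t d : R).

Definition mconv A B : {poly R} := n`!%:R^-1 *: dconv n (rprod (codom A)) (rprod (codom B)).

Lemma conv_atE A B al be t :
  conv_at A B al be t = mconv (fun i => A i + t * al i) (fun i => B i + t * be i).
Proof. by rewrite /conv_at !fiberpolyE. Qed.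

Lemma mconv_split A B : exists s, size s = n /\ mconv A B = rprod s.
Proof.
have [s [szs sE]] := conv_at_split A B A B 0; exists s; split=> //.
by rewrite -sE /conv_at !fiberpoly0.
Qed.

Lemma mup_mconv A B c : mup c (mconv A B) = mup c (dconv n (rprod (codom A)) (rprod (codom B))).
Proof. by rewrite /mconv mupZ ?invr_neq0 ?fact_neq0. Qed.

Lemma mconv_cluster A B c : (1 < mup c (mconv A B))%N ->
  exists a, (count_mem a (codom A) + count_mem (c - a)%R (codom B) = n + mup c (mconv A B))%N.
Proof.
move=> m1; have [s [szs sE]] := mconv_split A B.
have H0 : mconv A B != 0 by rewrite sE rprod_neq0.
have H'0 : dconv n (rprod (codom A)) (rprod (codom B)) != 0.
  by move: H0; rewrite /mconv scaler_eq0 negb_or => /andP[].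
rewrite mup_mconv in m1 *; set H := dconv _ _ _ in m1 H'0 *.
have Hc : root H c by rewrite -mup_gt0 // ltnW.
have [H''0 mE] := mup_deriv H'0 Hc.
have Hc' : root H^`() c by rewrite -mup_gt0 // -ltnS -mE.
have [||||a] := @dconv_double_root _ (codom A) (codom B) c; rewrite ?size_codomI //.
  by rewrite -size_eq0 size_codomI -lt0n.
move=> h; exists a; set k := (count_mem a (codom A) + _)%N in h *.
have kE : k = (n + (k - n))%N by lia.
by rewrite {1}kE -(dconv_exact_mult kE) subrKC.
Qed.

Lemma cluster_mconv A B a b m :
  (count_mem a (codom A) + count_mem b (codom B) = n + m)%N -> mup (a + b) (mconv A B) = m.
Proof. by move=> h; rewrite mup_mconv; apply: dconv_exact_mult. Qed.

Lemma rprod_scale (l : seq R) k :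
  rprod [seq k * x | x <- l] \Po (k *: 'X) = k ^+ size l *: rprod l.
Proof.
rewrite /rprod big_map rmorph_prod /= -!mul_polyC.
elim: l => [|x l IH]; first by rewrite !big_nil expr0 polyC1 mulr1.
rewrite !big_cons IH /= exprS comp_polyB comp_polyX comp_polyC !polyCM.
by ring.
Qed.

Lemma mconv_scale A B k s : k != 0 -> mconv A B = rprod s ->
  mconv (fun i => k * A i) (fun i => k * B i) = rprod [seq k * x | x <- s].
Proof.
move=> k0 sE; have szs : size s = n.
  have [s' [szs' sE']] := mconv_split A B.
  by apply: succn_inj; rewrite -szs' -!size_rprod -sE sE'.
have comp_inj (p q : {poly R}) : p \Po (k *: 'X) = q \Po (k *: 'X) -> p = q.
  move=> pq; have : (p \Po (k *: 'X)) \Po (k^-1 *: 'X) = (q \Po (k *: 'X)) \Po (k^-1 *: 'X) by rewrite pq.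
  by rewrite -!comp_polyA comp_polyZ comp_polyX scalerA mulfV // scale1r !comp_polyXr.
apply: comp_inj; rewrite rprod_scale szs -sE /mconv comp_polyZ scalerA mulrC -scalerA.
congr (_ *: _); apply: (scalerI (expf_neq0 n k0)).
have cE (f : 'I_n -> R) : codom (fun i => k * f i) = [seq k * x | x <- codom f].
  by rewrite !codomE -map_comp.
rewrite -dconv_compZX !cE !rprod_scale !size_codomI dconvZl linearZ /=.
by rewrite scalerA.
Qed.

Lemma two_common (P Q : pred 'I_n) : (n.+1 < #|P| + #|Q|)%N ->
  exists i j, [/\ i != j, P i && P j & Q i && Q j].
Proof.
rewrite -cardUI => h; have := max_card [predU P & Q]; rewrite card_ord => hU.
have /card_gt1P[i [j [iI jI ij]]] : (1 < #|[predI P & Q]|)%N.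
  by rewrite -(ltn_add2l n) addn1; apply: leq_trans h _; rewrite leq_add2r.
move: iI jI; rewrite !inE => /andP[Pi Qi] /andP[Pj Qj].
by exists i, j; split=> //; apply/andP; split.
Qed.

(** Both points (y1, t1) and (y2, t2) lie in the kernel of the linear form with coefficients x1 - x2
    and u1 - u2, nonzero since x1 != x2. *)
Lemma det2_cancel (x1 x2 y1 y2 t1 t2 u1 u2 a b : R) : x1 != x2 ->
  x1 * y1 + u1 * t1 = a -> x2 * y1 + u2 * t1 = a ->
  x1 * y2 + u1 * t2 = b -> x2 * y2 + u2 * t2 = b -> y1 * t2 = y2 * t1.
Proof.
move=> x12 e1 e2 e3 e4.
have E : (x1 - x2) * (y1 * t2 - y2 * t1) = 0.
  have -> : (x1 - x2) * (y1 * t2 - y2 * t1)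
     = ((x1 * y1 + u1 * t1) - (x2 * y1 + u2 * t1)) * t2
     - ((x1 * y2 + u1 * t2) - (x2 * y2 + u2 * t2)) * t1 by ring.
  by rewrite e1 e2 e3 e4; ring.
by move/eqP: E; rewrite mulf_eq0 !subr_eq0 (negPf x12) => /eqP.
Qed.

Variables (al be u v : 'I_n -> R).
Hypotheses (al_inj : injective al) (be_inj : injective be).

Definition fib y t := mconv (fun i => al i * y + u i * t) (fun i => be i * y + v i * t).

(** Each repeated root takes at least n + 2 entries from the two root vectors. The four clusters
    have at least 2 n + 4 entries together, so the two in [al] or the two in [be] share two indices,
    and these determine [y : t]. *)
Lemma collision_unique y t c y' t' c' :
  (1 < mup c (fib y t))%N -> (1 < mup c' (fib y' t'))%N -> y * t' = y' * t.
Proof.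
move=> /[dup] h1 /mconv_cluster[a ha] /[dup] h2 /mconv_cluster[a' ha'].
rewrite !count_codom in ha ha'; rewrite -/(fib y t) -/(fib y' t') in ha ha'.
set m := mup c _ in h1 ha; set m' := mup c' _ in h2 ha'.
set I := [pred i | _] in ha; set J := [pred i | _ == (_ - _)] in ha.
set I' := [pred i | _] in ha'; set J' := [pred i | _ == (_ - _)] in ha'.
have [hI|hI] := ltnP n.+1 (#|I| + #|I'|).
  have [i [j [ij /andP[/eqP Ii /eqP Ij] /andP[/eqP I'i /eqP I'j]]]] := two_common hI.
  by apply: (det2_cancel _ Ii Ij I'i I'j); rewrite (inj_eq al_inj).
have hJ : (n.+1 < #|J| + #|J'|)%N by lia.
have [i [j [ij /andP[/eqP Ii /eqP Ij] /andP[/eqP I'i /eqP I'j]]]] := two_common hJ.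
by apply: (det2_cancel _ Ii Ij I'i I'j); rewrite (inj_eq be_inj).
Qed.

(** At t = 0 the entries within each root vector are distinct, so two clusters have at most 2
    entries together, short of n + 2. *)
Lemma fib_infinity y c : y != 0 -> (mup c (fib y 0) <= 1)%N.
Proof.
move=> y0; rewrite leqNgt; apply/negP => /[dup] h /mconv_cluster[a].
have cu (f g : 'I_n -> R) x : injective f -> (count_mem x (codom (fun i => f i * y + g i * 0)%R) <= 1)%N.
  move=> f_inj; rewrite count_uniq_mem ?leq_b1 // map_inj_uniq ?enum_uniq // => i j.
  by rewrite !mulr0 !addr0 => /(mulIf y0)/f_inj.
move=> ha; have := leq_add (cu al u a al_inj) (cu be v (c - a) be_inj).
by rewrite ha => hh; have := leq_trans (leq_add n_gt0 h) hh.
Qed.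
End Collisions.

Lemma mconv_ext (R : rcfType) n (A A' B B' : 'I_n -> R) :
  A =1 A' -> B =1 B' -> mconv A B = mconv A' B'.
Proof. by move=> AA BB; rewrite /mconv (eq_codom AA) (eq_codom BB). Qed.

Lemma span3P (K : fieldType) (V : vectType K) (e1 e2 e3 x : V) :
  reflect (exists a b c, x = a *: e1 + b *: e2 + c *: e3) (x \in <<[:: e1; e2; e3]>>%VS).
Proof.
rewrite !span_cons span_nil addv0; apply: (iffP memv_addP) => [[_ /vlineP[a ->] [y]]|].
  case/memv_addP => _ /vlineP[b ->] [_ /vlineP[c ->] ->] ->.
  by exists a, b, c; rewrite addrA.
move=> [a [b [c ->]]]; exists (a *: e1); first exact: memvZ (memv_line _).
exists (b *: e2 + c *: e3); last by rewrite addrA.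
by apply: memv_add; apply: memvZ; apply: memv_line.
Qed.

Lemma prod_diff_scale (R : realFieldType) (l : seq R) k : uniq l -> k != 0 ->
  \prod_(x <- [seq k * x | x <- l]) \prod_(y <- [seq k * x | x <- l] | y != x) `|x - y|
  = `|k| ^+ (size l * (size l).-1) * \prod_(x <- l) \prod_(y <- l | y != x) `|x - y|.
Proof.
move=> l_uniq k0; rewrite big_map mulnC exprM.
have -> : (`|k| ^+ (size l).-1) ^+ size l = \prod_(x <- l) `|k| ^+ (size l).-1.
  by rewrite big_const_seq count_predT iter_mulr_1.
rewrite -big_split /= !big_seq; apply: eq_bigr => x xl; rewrite big_map.
have -> : `|k| ^+ (size l).-1 = \prod_(y <- l | y != x) `|k|.
  rewrite big_const_seq iter_mulr_1; congr (_ ^+ _).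
  by have := count_predC (pred1 x) l; rewrite count_uniq_mem // xl add1n => <-.
rewrite -big_split /=; apply: eq_big => y; first by rewrite (inj_eq (mulfI k0)).
by rewrite -mulrBr normrM.
Qed.

(** * Counting the non-real zeros of the discriminant *)

Section Discriminant.
Variables (R : realType) (n : nat).
Hypothesis n_gt2 : (2 < n)%N.
Variables (alpha beta : 'rV[R]_n) (w : 'rV[R]_(n + n)).
Hypotheses (alpha_inj : injective (fun i => alpha 0 i))
  (beta_inj : injective (fun i => beta 0 i)).

Let n_gt0 : (0 < n)%N := ltnW (ltnW n_gt2).
Local Notation u := (fun i => lsubmx w 0 i).
Local Notation v := (fun i => rsubmx w 0 i).
Local Notation fibw := (fib (fun i => alpha 0 i) (fun i => beta 0 i) u v).
Local Notation d := (dehom (Ddisc alpha beta w)).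

Lemma hfiber_fib y t : hfiber alpha beta w y t = fibw y t.
Proof. exact: hfiberE. Qed.

Lemma dehom_fib y : d.[y] = monic_disc (fibw y 1).
Proof. by rewrite dehom_eval Ddisc_eval // hfiber_fib. Qed.

Lemma fib_split y t : exists s, size s = n /\ fibw y t = rprod s.
Proof. exact: mconv_split. Qed.

(** When y moves and t = 1 stays fixed, the slopes of the root lines are the entries of [alpha] and
    [beta], hence injective. *)
Lemma mup_dehom y s : fibw y 1 = rprod s -> d != 0 /\ mup y d = collision_order s.
Proof.
move=> sE; apply: mup_comparable.
pose A i := alpha 0 i * y + u i * 1; pose B i := beta 0 i * y + v i * 1.
have [|k [K [t0 [k_gt0 K_gt0 t0_gt0 h]]]] := @disc_order R n n_gt0 A B
    (fun i => alpha 0 i) (fun i => beta 0 i) s (or_intror (conj alpha_inj beta_inj)).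
  by rewrite conv_atE -sE; apply: mconv_ext => i; rewrite mul0r addr0.
exists k, K, t0; split=> // t /h; rewrite dehom_fib conv_atE.
rewrite (mconv_ext (A' := fun i => alpha 0 i * (y + t) + u i * 1)
  (B' := fun i => beta 0 i * (y + t) + v i * 1)) // => i; rewrite /A /B; ring.
Qed.

Lemma dehom_neq0 : d != 0.
Proof. by have [s [_ sE]] := fib_split 0 1; have [] := mup_dehom sE. Qed.

Lemma fib_scale y t k s : k != 0 -> fibw y t = rprod s ->
  fibw (k * y) (k * t) = rprod [seq k * x | x <- s].
Proof.
move=> k0 sE; rewrite -(mconv_scale k0 sE).
by apply: mconv_ext => i; ring.
Qed.

(** The degree is read off at infinity. The reversed polynomial e has e(t) = t^deg d(1/t) and e(0)
    != 0. Rescaling the fiber over [1 : t] to [1/t : 1] multiplies its discriminant by t^(- n (n -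
    1)), and for small t that discriminant stays between two positive bounds in absolute value
    because the fiber at t = 0 has simple roots. *)
Lemma size_dehom : size d = (n * n.-1).+1.
Proof.
have d0 := dehom_neq0; have szd : (0 < size d)%N by rewrite size_poly_gt0.
have [s [szs sE]] := fib_split 1 0.
have s_uniq : uniq s.
  apply: count_mem_uniq => x; have [xs|/count_memPn //] := boolP (x \in s).
  have : (count_mem x s <= 1)%N.
    by rewrite -mu_prod_XsubC -/(rprod s) -sE fib_infinity ?oner_neq0.
  have : (0 < count_mem x s)%N by rewrite -has_count has_pred1.
  by case: (count_mem x s) => [|[]].
have [|k [K [t0 [k_gt0 K_gt0 t0_gt0 h]]]] := @disc_order R n n_gt0 (fun i => alpha 0 i)
    (fun i => beta 0 i) u v s (or_introl s_uniq).
  by rewrite conv_atE -sE; apply: mconv_ext => i; ring.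
rewrite collision_order_uniq // in h.
pose e := \poly_(i < size d) d`_((size d).-1 - i).
have eE t : t != 0 -> e.[t] = t ^+ (size d).-1 * d.[t^-1].
  move=> t_neq0; rewrite /e horner_poly (horner_coef d) mulr_sumr.
  rewrite (reindex_inj rev_ord_inj) /=; apply: eq_bigr => i _.
  have subE m j : (j < m)%N -> (m.-1 - (m - j.+1) = j)%N /\ m.-1 = (m - j.+1 + j)%N by lia.
  have [-> ->] := subE _ _ (ltn_ord i).
  by rewrite exprD mulrACA -exprMn mulfV // expr1n mulr1 mulrC.
have e0 : e.[0] != 0.
  by rewrite horner_coef0 coef_poly szd subn0 -/(lead_coef d) lead_coef_eq0.
suff: (n * n.-1)%N = (size d).-1 by move=> ->; rewrite prednK.
apply: (comparable_pow e0); exists k, K, t0; split=> // t tt0.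
have /andP[t_gt0 _] := tt0; have t_neq0 : t != 0 by rewrite gt_eqF.
have := h t tt0; rewrite conv_atE expr0 !mulr1.
have [l [szl lE]] := fib_split 1 t.
rewrite (mconv_ext (A' := fun i => alpha 0 i * 1 + u i * t) (B' := fun i => beta 0 i * 1 + v i * t));
  [|by move=> i; ring|by move=> i; ring].
rewrite -[mconv _ _]/(fibw 1 t) lE => /andP[h1 h2].
have l0 : l != [::] by rewrite -size_eq0 szl -lt0n.
have l_uniq : uniq l.
  apply: monic_disc_neq0_uniq => //; rewrite -normr_gt0; exact: lt_le_trans h1.
have -> : t ^+ (n * n.-1) * `|e.[t]| = t ^+ (size d).-1 * `|monic_disc (rprod l)|.
  rewrite eE // normrM normrX gtr0_norm // mulrCA; congr (_ * _).
  have := fib_scale (invr_neq0 t_neq0) lE; rewrite mulr1 mulVf // => lE'.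
  rewrite dehom_fib lE' !monic_disc_rprod //; last 2 first.
  - by rewrite map_inj_uniq // => x y /(mulfI (invr_neq0 t_neq0)).
  - by rewrite -size_eq0 size_map szl -lt0n.
  rewrite prod_diff_scale ?invr_neq0 // szl normfV gtr0_norm // mulrA -exprMn mulfV //.
  by rewrite expr1n mul1r.
rewrite !(mulrC _ (t ^+ _)) !ler_pM2l ?exprn_gt0 //.
by rewrite h1 h2.
Qed.

Lemma in_LspaceP : reflect
  (exists y a b, (forall i, alpha 0 i * y + u i = a) /\ (forall i, beta 0 i * y + v i = b))
  (w \in Lspace alpha beta).
Proof.
apply: (iffP (span3P _ _ _ _)) => [[a [b [c wE]]]|[y [a [b [uE vE]]]]].
  exists (- c), (a - c * (n%:R^-1 * \sum_i alpha 0 i)), (b - c * (n%:R^-1 * \sum_i beta 0 i)).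
  split=> i; rewrite wE !linearD !linearZ /= ?(row_mxKl, row_mxKr) !mxE; ring.
exists (a - y * (n%:R^-1 * \sum_i alpha 0 i)), (b - y * (n%:R^-1 * \sum_i beta 0 i)), (- y).
rewrite -[LHS]hsubmxK !scale_row_mx !add_row_mx; congr row_mx; apply/rowP => i.
  by have := uE i; rewrite !mxE => <-; ring.
by have := vE i; rewrite !mxE => <-; ring.
Qed.

Lemma count_codom_full (f : 'I_n -> R) a :
  count_mem a (codom f) = n <-> forall i, f i = a.
Proof.
split=> [fa i|fa].
  have /allP : all (pred1 a) (codom f) by rewrite all_count fa size_codomI.
  by move=> /(_ (f i) (codom_f f i)) /eqP.
apply/eqP; rewrite -[X in _ == X](size_codomI f) -all_count; apply/allP => x.
by case/codomP => i ->; rewrite /= fa.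
Qed.

Lemma count_codom_le (f : 'I_n -> R) a : (count_mem a (codom f) <= n)%N.
Proof. by rewrite -[X in (_ <= X)%N](size_codomI f) count_size. Qed.

Lemma mup_rprod (s : seq R) c : mup c (rprod s) = count_mem c s.
Proof. exact: mu_prod_XsubC. Qed.

(** An n-fold root needs clusters whose sizes add up to 2 n, so both root vectors are constant in
    that fiber, which is the description of L in [in_LspaceP]. *)
Lemma full_collision : w \in Lspace alpha beta <->
  exists y s c, fibw y 1 = rprod s /\ count_mem c s = n.
Proof.
split=> [/in_LspaceP[y [a [b [uE vE]]]]|[y [s [c [sE cs]]]]].
  have [s [szs sE]] := fib_split y 1; exists y, s, (a + b); split=> //.
  rewrite -mup_rprod -sE; apply: cluster_mconv; congr (_ + _)%N.
    by apply/count_codom_full => i; rewrite mulr1.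
  by apply/count_codom_full => i; rewrite mulr1.
have mE : mup c (fibw y 1) = n by rewrite sE mup_rprod.
have [|a] := @mconv_cluster R n n_gt0 (fun i => alpha 0 i * y + u i * 1)
  (fun i => beta 0 i * y + v i * 1) c; first by rewrite -/(fibw y 1) mE ltnW.
rewrite -/(fibw y 1) mE => h; apply/in_LspaceP; exists y, a, (c - a).
have hA := count_codom_le (fun i => alpha 0 i * y + u i * 1) a.
have hB := count_codom_le (fun i => beta 0 i * y + v i * 1) (c - a).
have addn_full k l : (k <= n -> l <= n -> k + l = n + n -> k = n /\ l = n)%N by lia.
have [/count_codom_full eA /count_codom_full eB] := addn_full _ _ hA hB h.
by split=> i; [rewrite -(eA i) mulr1|rewrite -(eB i) mulr1].
Qed.

Lemma has_root_mult_count r y t s : fibw y t = rprod s ->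
  has_root_mult r (hfiber alpha beta w y t) <-> exists c, (r <= count_mem c s)%N.
Proof.
move=> sE; rewrite hfiber_fib sE; split=> -[c].
  by rewrite -mup_geq ?rprod_neq0 // mup_rprod => h; exists c.
by move=> h; exists c; rewrite -mup_geq ?rprod_neq0 // mup_rprod.
Qed.

Lemma count_scale (s : seq R) k c : k != 0 -> count_mem (k * c) [seq k * x | x <- s] = count_mem c s.
Proof.
by move=> k0; rewrite count_map; apply: eq_count => x /=; rewrite (inj_eq (mulfI k0)).
Qed.

Lemma collision_chart r y t : (1 < r)%N -> (y, t) != (0, 0) ->
  has_root_mult r (hfiber alpha beta w y t) -> t != 0 /\
  exists s c, fibw (y / t) 1 = rprod s /\ (r <= count_mem c s)%N.
Proof.
move=> r_gt1 yt; have [s [_ sE]] := fib_split y t.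
move/(has_root_mult_count _ sE) => [c cs].
have t0 : t != 0.
  apply/eqP => t0; rewrite t0 in yt sE; have y0 : y != 0.
    by apply: contraNneq yt => ->.
  have := @fib_infinity R n n_gt0 _ _ u v alpha_inj beta_inj y c y0.
  by rewrite sE mup_rprod leqNgt (leq_trans r_gt1 cs).
split=> //; exists [seq t^-1 * x | x <- s], (t^-1 * c).
rewrite count_scale ?invr_neq0 //; split=> //.
by rewrite -(fib_scale (invr_neq0 t0) sE) mulVf // mulrC.
Qed.

Lemma in_SigmaP r : (1 < r)%N -> in_Sigma alpha beta r w <->
  exists y s c, fibw y 1 = rprod s /\ (r <= count_mem c s)%N.
Proof.
move=> r_gt1; split=> [[y [t [yt /(collision_chart r_gt1 yt)[t0 [s [c h]]]]]]|].
  by exists (y / t), s, c.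
move=> [y [s [c [sE cs]]]]; exists y, 1; split; first by rewrite xpair_eqE oner_eq0 andbF.
by apply/(has_root_mult_count _ sE); exists c.
Qed.

Lemma collision_unique1 y s c y' s' c' : fibw y 1 = rprod s -> fibw y' 1 = rprod s' ->
  (1 < count_mem c s)%N -> (1 < count_mem c' s')%N -> y = y'.
Proof.
move=> sE sE'; rewrite -!mup_rprod -sE -sE' => h h'.
have := collision_unique n_gt0 alpha_inj beta_inj h h'.
by rewrite !mulr1.
Qed.

Lemma nonreal_none : (forall y s c, fibw y 1 = rprod s -> (count_mem c s <= 1)%N) ->
  nonreal_zeros (Ddisc alpha beta w) = (n * n.-1)%N.
Proof.
move=> none; have [l [szl -> mupl]] := nonreal_zerosE dehom_neq0.
have szl' : size l = (n * n.-1)%N by apply: succn_inj; rewrite -szl size_dehom.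
apply/eqP; rewrite -szl' -all_count; apply/allP => z zl; apply/negP => /eqP z_real.
have zE : z = (complex.Re z)%:C by case: (z) z_real => x y /= ->.
have [s [_ sE]] := fib_split (complex.Re z) 1; have [_ mE] := mup_dehom sE.
have : (0 < collision_order s)%N by rewrite -mE -mupl -zE -has_count has_pred1.
by case/collision_order_gt0 => c; rewrite ltnNge (none _ _ _ sE).
Qed.

(** A real root of the dehomogenized discriminant is the parameter of a repeated root, hence y by
    uniqueness; the real entries among its roots are copies of y. *)
Lemma nonreal_collision y s c : fibw y 1 = rprod s -> (1 < count_mem c s)%N ->
  (nonreal_zeros (Ddisc alpha beta w) + collision_order s)%N = (n * n.-1)%N.
Proof.
move=> sE cs; have [l [szl -> mupl]] := nonreal_zerosE dehom_neq0.
have szl' : size l = (n * n.-1)%N by apply: succn_inj; rewrite -szl size_dehom.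
have [_ <-] := mup_dehom sE; rewrite -szl' -mupl addnC.
rewrite -[RHS](count_predC (pred1 y%:C)); congr (_ + _)%N.
apply: eq_in_count => z zl /=; apply/idP/idP => [|zy].
  by apply: contraNN => /eqP ->.
apply: contraNneq zy => z_real.
have zE : z = (complex.Re z)%:C by case: (z) z_real => x x' /= ->.
have [s' [_ sE']] := fib_split (complex.Re z) 1; have [_ mE] := mup_dehom sE'.
have : (0 < collision_order s')%N by rewrite -mE -mupl -zE -has_count has_pred1.
case/collision_order_gt0 => c' cs'; rewrite zE.
by rewrite (collision_unique1 sE sE' cs cs').
Qed.

Lemma collision_le y s c : w \notin Lspace alpha beta -> fibw y 1 = rprod s ->
  (count_mem c s <= n.-1)%N.
Proof.
move=> wL sE; rewrite -ltnS prednK // ltn_neqAle; apply/andP; split.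
  by apply: contraNneq wL => cs; apply/full_collision; exists y, s, c.
have [s' [szs' sE']] := fib_split y 1.
have <- : size s = n by apply: succn_inj; rewrite -size_rprod -sE sE' size_rprod szs'.
exact: count_size.
Qed.

Theorem nonreal_bound : 
  (w \notin Lspace alpha beta ->
        (2 * n - 2 <= nonreal_zeros (Ddisc alpha beta w))%N) /\
  (nonreal_zeros (Ddisc alpha beta w) = (2 * n - 2)%N <->
        in_Sigma alpha beta (n - 1) w /\ w \notin Lspace alpha beta).
Proof.
have r_gt1 : (1 < n - 1)%N by lia.
(* The source of 2 n - 2: the degree of the discriminant minus the order of a collision of
   multiplicity n - 1. *)
have ordE k : (2 < k)%N -> (k * k.-1 = k.-1 * k.-2 + (2 * k - 2))%N.
  by case: k => [|[|[|k]]] // _; rewrite /= ; nia.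
have sz y s : fibw y 1 = rprod s -> size s = n.
  move=> sE; have [s' [szs' sE']] := fib_split y 1.
  by apply: succn_inj; rewrite -size_rprod -sE sE' size_rprod szs'.
have [[y [s [c [sE cs]]]]|none] := boolp.pselect (exists y s c, fibw y 1 = rprod s /\ (1 < count_mem c s)%N); last first.
  have none' : forall y s c, fibw y 1 = rprod s -> (count_mem c s <= 1)%N.
    by move=> y s c sE; rewrite leqNgt; apply/negP => cs; apply: none; exists y, s, c.
  rewrite (nonreal_none none') (ordE n n_gt2); split; first by rewrite leq_addl.
  split=> [|[/(in_SigmaP r_gt1)[y [s [c [sE cs]]]] _]].
    move/eqP; rewrite -[X in _ == X]add0n eqn_add2r muln_eq0.
    by case/orP => /eqP h; exfalso; move: h n_gt2; lia.
  by have := none' y s c sE; rewrite leqNgt (leq_trans r_gt1 cs).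
have NE := nonreal_collision sE cs; rewrite (ordE n n_gt2) in NE.
(* For w in L the n-fold root accounts for all n (n - 1) zeros, so equality is impossible. *)
have [wL|wL] := boolP (w \in Lspace alpha beta).
  split=> //; split=> [nrE|[]//]; exfalso.
  have [y' [s' [c' [sE' cs']]]] := full_collision.1 wL.
  have cs1 : (1 < count_mem c' s')%N by rewrite cs' ltnW.
  have yy := collision_unique1 sE' sE cs1 cs.
  move: sE'; rewrite yy sE => ss.
  have cs0 : count_mem c' s = n by rewrite -mup_rprod ss mup_rprod.
  have := collision_order_full (etrans cs0 (esym (sz _ _ sE))); rewrite (sz _ _ sE) (ordE n n_gt2).
  by move: NE; rewrite nrE; lia.
have c_le := fun c => collision_le c wL sE.
have [[c' cs']|lt] := boolp.pselect (exists c', count_mem c' s = n.-1).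
  have ordN := collision_order_almost n_gt2 (sz _ _ sE) cs'.
  have nrE : nonreal_zeros (Ddisc alpha beta w) = (2 * n - 2)%N by rewrite ordN in NE; lia.
  rewrite nrE; split=> //; split=> // _; split=> //; apply/(in_SigmaP r_gt1).
  by exists y, s, c'; split=> //; rewrite cs' subn1.
have ordN : (collision_order s < n.-1 * n.-2)%N.
  apply: collision_order_lt => // [|c']; first exact: sz sE.
  rewrite -ltnS prednK; last by lia.
  by rewrite ltn_neqAle c_le andbT; apply/eqP => cs'; apply: lt; exists c'.
split=> [_|]; first by lia.
split=> [|[/(in_SigmaP r_gt1)[y' [s' [c' [sE' cs']]]] _]]; first by lia.
have yy := collision_unique1 sE' sE (leq_trans r_gt1 cs') cs.
move: sE'; rewrite yy sE => ss; exfalso; apply: lt; exists c'.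
by apply/eqP; rewrite eqn_leq c_le -mup_rprod ss mup_rprod -subn1.
Qed.
End Discriminant.

(** * Normal form for a collision of multiplicity n - 1 *)

Section NormalForm.

Lemma coef_compZX (A : comNzRingType) (p : {poly A}) a i :
  (p \Po (a *: 'X))`_i = p`_i * a ^+ i.
Proof.
elim/poly_ind: p i => [|p c IH] i; first by rewrite comp_poly0 !coef0 mul0r.
rewrite comp_polyD comp_polyM comp_polyX comp_polyC -scalerAr !coefD coefZ !coefMX !coefC.
case: i => [|i] /=; first by rewrite mulr0 !add0r expr0 mulr1.
by rewrite IH !addr0 exprS mulrCA.
Qed.

Lemma compZX_inj (B : idomainType) (y : B) (p q : {poly B}) : y != 0 ->
  p \Po (y *: 'X) = q \Po (y *: 'X) -> p = q.
Proof.
move=> y0 pq; apply/polyP => i; apply: (mulIf (expf_neq0 i y0)).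
by rewrite -!coef_compZX pq.
Qed.

(** Homogenization of [rprod s] by y, with the scalars carried by [io] into a ring B that later
    contains the variables. *)
Definition hprod (F : fieldType) (B : comNzRingType) (io : F -> B) (y : B) (s : seq F) : {poly B} :=
  \prod_(x <- s) ('X - (io x * y)%:P).

Lemma hprod_comp (F : fieldType) (B : comNzRingType) (io : {rmorphism F -> B}) y s :
  hprod io y s \Po (y *: 'X) = y ^+ size s *: map_poly io (rprod s).
Proof.
rewrite /hprod /rprod -!mul_polyC; elim: s => [|x s IH].
  by rewrite !big_nil expr0 polyC1 mul1r !rmorph1.
have mapE p : map_poly io (('X - x%:P) * p) = ('X - (io x)%:P) * map_poly io p.
  by rewrite [LHS]rmorphM rmorphB /= map_polyX map_polyC.
rewrite !big_cons comp_polyM IH mapE /= exprS.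
by rewrite comp_polyB comp_polyX comp_polyC !polyCM; ring.
Qed.

Lemma dconv_hprod (F : fieldType) (B : idomainType) (io : {rmorphism F -> B}) y
    (s1 s2 s3 : seq F) k : y != 0 ->
  size s2 = size s3 -> dconv (size s1) (rprod s1) (rprod s2) = k *: rprod s3 ->
  dconv (size s1) (hprod io y s1) (hprod io y s2) = io k *: hprod io y s3.
Proof.
move=> y0 s23 E; apply: (compZX_inj y0); apply: (@mulfI _ (y ^+ size s1)%:P).
  by rewrite polyC_eq0 expf_neq0.
rewrite !mul_polyC -dconv_compZX !hprod_comp dconvZl linearZ /= -map_dconv E map_polyZ.
by rewrite comp_polyZ hprod_comp s23 !scalerA; congr (_ *: _); ring.
Qed.

Lemma hprod_shift (F : fieldType) (B : comNzRingType) (io : F -> B) y (s : seq F) (a : B) :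
  hprod io y s \Po ('X - a%:P) = \prod_(x <- s) ('X - (io x * y + a)%:P).
Proof.
rewrite /hprod rmorph_prod; apply: eq_bigr => x _ /=.
by rewrite comp_polyB comp_polyX comp_polyC polyCD; ring.
Qed.

Lemma size_hprod (F : fieldType) (B : comNzRingType) (io : F -> B) y (s : seq F) :
  size (hprod io y s) = (size s).+1.
Proof. exact: size_prod_XsubC. Qed.

Variables (R : rcfType) (n : nat).
Hypothesis n_gt2 : (2 < n)%N.
Let n_gt0 : (0 < n)%N := ltnW (ltnW n_gt2).
Local Notation C := R[i].

(* Moving the root b off the real axis, Grace's theorem excludes a common root. *)
Lemma no_common_root (s : seq R) (b : R) (t : seq R) x :
  size s = n -> uniq s -> uniq t -> size (b :: t) = n ->
  root (dconv n (rprod s) (rprod (b :: t))) x ->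
  root (dconv n (rprod s) (rprod t)) x -> False.
Proof.
move=> szs s_uniq t_uniq szt H0 K0.
pose l : seq C := (b%:C - 'i%C - x%:C) :: [seq a%:C - x%:C | a <- t].
(* As [cprod (b :: t)] is (X - b) [cprod t], adding i [cprod t] moves the root b to b - i; a common
   root x of both convolutions makes the pairing vanish. *)
pose q := (cprod (b :: t) + 'i%C *: cprod t) \Po ('X + x%:C%:P).
have qE : q = rprod l.
  rewrite /l /rprod big_cons big_map -[\prod_(_ <- t) _](big_map (fun a => a%:C) xpredT (fun a => 'X - (a - x%:C)%:P)).
  have -> : \prod_(i <- [seq a%:C | a <- t]) ('X - (i - x%:C)%:P) = cprod t \Po ('X + x%:C%:P).
    by rewrite cprodE rprod_comp /rprod [RHS]big_map.
  rewrite /q /cprod big_cons comp_polyD comp_polyZ comp_polyM comp_polyB comp_polyX comp_polyC.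
  by rewrite -mul_polyC -mulrDl !polyCB; congr (_ * _); ring.
have l_uniq : uniq l.
  rewrite /= map_inj_uniq ?t_uniq ?andbT; last by move=> a a' /addIr/complexI.
  apply/mapP => -[a _ /addIr/(congr1 (@complex.Im R))] /= /eqP.
  by rewrite sub0r oppr_eq0 oner_eq0.
have szq : size q = (size s).+1 by rewrite qE size_rprod /= size_map szs -szt.
have szS : size (cprod s) = n.+1 by rewrite size_cprod szs.
have szt' : size t = n.-1 by rewrite -szt.
have q_root z : root q z -> z \in l by rewrite qE root_prod_XsubC.
have q0 : (dconv (size s) (cprod s) q).[0] = 0.
  rewrite szs /q dconv_compXaddr ?szS //; last first.
    apply: leq_trans (size_polyD _ _) _; rewrite geq_max size_cprod szt leqnn /=.
    by apply: leq_trans (size_scale_leq _ _) _; rewrite size_cprod szt' prednK // leqnSn.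
  rewrite horner_comp hornerD hornerX hornerC add0r linearD linearZ /= hornerD hornerZ.
  rewrite -!map_rprod -!map_dconv !horner_map /=.
  by rewrite (rootP H0) (rootP K0) rmorph0 mulr0 addr0.
have [||a] := grace_boundary szq _ _ q0.
- move=> z /q_root; rewrite inE => /predU1P[->|/mapP[a _ ->]] /=.
    by rewrite !sub0r subr0 oppr_le0 ler01.
  by rewrite subr0.
- exists (b%:C - 'i%C - x%:C); rewrite qE root_prod_XsubC mem_head; split=> //=.
  by rewrite !sub0r subr0 oppr_lt0 ltr01.
rewrite szs qE mu_prod_XsubC !count_uniq_mem // => h.
have hh := leq_trans h (leq_add (leq_b1 _) (leq_b1 _)).
by have := leq_trans hh (ltnW n_gt2); rewrite ltnn.
Qed.

(** In the collision fiber one root vector is constantly A and the other is B except at j0.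
    Replacing the entry [b j0] by B changes its factor by (b j0 - B) t. This splits the convolution,
    after the translation by (A + B) t, into T, from all of [be], and t times S, from [be] without
    the index j0. The variable y here will be y - y0 t. *)
Lemma normal_form (al be : 'I_n -> R) (A B : R) (b : 'I_n -> R) (j0 : 'I_n) :
  injective al -> injective be -> b j0 != B -> (forall j, j != j0 -> b j = B) ->
  exists k sg th, [/\ k != 0, uniq sg, size sg = n.-1, size th = n &
     (forall x, x \in sg -> x \notin th) /\
     forall (D : idomainType) (io : {rmorphism R -> D}) (x y t : D), y != 0 ->
       (dconv n (\prod_(i < n) ('X - (io (al i) * y + io A * t)%:P))
                (\prod_(j < n) ('X - (io (be j) * y + io (b j) * t)%:P))).[x]
     = n`!%:R * (io k * t * \prod_(s <- sg) (x - io (A + B) * t - io s * y)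
        + \prod_(s <- th) (x - io (A + B) * t - io s * y))].
Proof.
move=> al_inj be_inj bj0 bj.
pose be' := [seq be j | j <- enum 'I_n & j != j0].
have s_uniq : uniq (codom al) by rewrite map_inj_uniq ?enum_uniq.
have be'_uniq : uniq be' by rewrite map_inj_uniq; [apply: filter_uniq; apply: enum_uniq|].
have perm_be : perm_eq (be j0 :: be') (codom be).
  rewrite codomE -[be j0 :: _]/(map be (j0 :: _)); apply: perm_map.
  rewrite perm_sym; apply: perm_trans (perm_to_rem (mem_enum _ j0)) _.
  by rewrite perm_cons rem_filter ?enum_uniq // perm_refl.
have szbe : size (be j0 :: be') = n by rewrite (perm_size perm_be) size_codomI.
have szbe' : size be' = n.-1 by rewrite -szbe.
have rprod_be : rprod (be j0 :: be') = rprod (codom be) by apply: perm_big.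
have [th [szth thE]] := mconv_split al be.
have {}thE : dconv n (rprod (codom al)) (rprod (be j0 :: be')) = n`!%:R *: rprod th.
  by rewrite rprod_be -thE /mconv scalerA mulfV ?fact_neq0 // scale1r.
have simple (s : seq R) : uniq s -> simple_real (rprod s).
  by move=> us; exists s; rewrite // lead_coef_prod_XsubC scale1r.
have [|||||szK [sg sg_uniq sgE]] := @dconv_simple R n n n.-1 n.-1 (rprod (codom al)) (rprod be') _ _ _ _ _ (simple _ s_uniq) (simple _ be'_uniq); rewrite ?size_rprod ?size_codomI ?szbe' ?leq_pred //.
set K := dconv n _ _ in szK sgE; set k0 := lead_coef K in sgE.
have k0_neq0 : k0 != 0 by rewrite lead_coef_eq0 -size_poly_eq0 szK.
have szsg : size sg = n.-1.
  by apply: succn_inj; rewrite -size_rprod -szK sgE size_scale.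
(* k0 is the leading coefficient of the convolution with the index j0 left out; the division by n!
   compensates the factor n! in the statement. *)
exists (- (b j0 - B) * k0 / n`!%:R), sg, th; split=> //; last split.
- by rewrite !mulf_neq0 ?invr_neq0 ?fact_neq0 // oppr_eq0 subr_eq0.
- move=> x xsg; apply/negP => xth.
  apply: (@no_common_root (codom al) (be j0) be' x); rewrite ?size_codomI //.
    by rewrite thE rootZ ?fact_neq0 // root_prod_XsubC.
  by rewrite -/K sgE rootZ // root_prod_XsubC.
move=> D io x y t y0.
have -> : \prod_(i < n) ('X - (io (al i) * y + io A * t)%:P)
   = hprod io y (codom al) \Po ('X - (io A * t)%:P).
  by rewrite hprod_shift codomE big_map enumT.
pose sh s := hprod io y s \Po ('X - (io B * t)%:P).
have -> : \prod_(j < n) ('X - (io (be j) * y + io (b j) * t)%:P)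
   = sh (be j0 :: be') - (io (b j0 - B) * t) *: sh be'.
  rewrite /sh !hprod_shift big_cons (bigD1 j0) //= -mul_polyC -mulrBl.
  rewrite big_map big_filter big_enum_cond /=; congr (_ * _).
    by rewrite rmorphB /= !(polyCD, polyCM, polyCN, polyCB); ring.
  by apply: eq_bigr => j jj0; rewrite (bj j jj0).
rewrite linearB linearZ /= /sh.
have XB a : 'X - a%:P = 'X + (- a)%:P :> {poly D} by rewrite polyCN.
have shE s : (size s <= n)%N -> dconv n (hprod io y (codom al) \Po ('X - (io A * t)%:P))
    (hprod io y s \Po ('X - (io B * t)%:P))
  = dconv n (hprod io y (codom al)) (hprod io y s) \Po ('X - (io (A + B) * t)%:P).
  move=> szs; rewrite !XB dconv_compXaddl dconv_compXaddr ?size_hprod ?size_codomI ?ltnS //.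
  rewrite -comp_polyA comp_polyD comp_polyX comp_polyC -addrA -polyCD.
  by congr (_ \Po ('X + _%:P)); rewrite rmorphD; ring.
rewrite !shE ?szbe ?szbe' ?leq_pred //.
have dE s3 s k : size s = size s3 -> dconv n (rprod (codom al)) (rprod s) = k *: rprod s3 ->
    dconv n (hprod io y (codom al)) (hprod io y s) = io k *: hprod io y s3.
  by have := @dconv_hprod _ _ io y (codom al) s s3 k y0; rewrite size_codomI.
rewrite (dE th _ n`!%:R) ?szbe // (dE sg _ k0) ?szbe' // !comp_polyZ.
rewrite hornerD hornerN !hornerZ !hprod_shift !horner_prod.
have evE (s : seq R) : \prod_(i <- s) ('X - (io i * y + io (A + B) * t)%:P).[x]
   = \prod_(i <- s) (x - io (A + B) * t - io i * y).
  by apply: eq_bigr => i _; rewrite hornerXsubC; ring.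
have kE : n`!%:R * io (- (b j0 - B) * k0 / n`!%:R) = - (io (b j0 - B) * io k0).
  by rewrite -(rmorph_nat io) -rmorphM mulrCA mulfV ?fact_neq0 // mulr1 rmorphM rmorphN mulNr.
rewrite !evE rmorph_nat mulrDr !mulrA kE.
by rewrite -!mulrA; ring.
Qed.
End NormalForm.

Section CollisionForm.
Variable K : fieldType.
Implicit Types (c s k : K) (sg th : seq K).

(** The line X = s Y through [c : y0 : 1], where X = x - c t and Y = y - y0 t. *)
Definition lform c (y0 : K) s : {mpoly K[3]} :=
  'X_0 - c%:MP * 'X_2 - s%:MP * ('X_1 - y0%:MP * 'X_2).

Definition cform c (y0 : K) k sg th : {mpoly K[3]} :=
  k%:MP * 'X_2 * \prod_(s <- sg) lform c y0 s + \prod_(s <- th) lform c y0 s.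
End CollisionForm.

Section HformNormal.
Variables (R : realType) (n : nat).
Hypothesis n_gt2 : (2 < n)%N.
Variables (alpha beta : 'rV[R]_n) (w : 'rV[R]_(n + n)).
Hypotheses (alpha_inj : injective (fun i => alpha 0 i))
  (beta_inj : injective (fun i => beta 0 i)).
Local Notation u := (fun i => lsubmx w 0 i).
Local Notation v := (fun i => rsubmx w 0 i).
Local Notation fibw := (fib (fun i => alpha 0 i) (fun i => beta 0 i) u v).

Definition pencil_prod (a : 'rV[R]_n) (u' : 'rV[R]_n) : {poly {mpoly R[3]}} :=
  \prod_(i < n) ('X - ((a 0 i)%:MP * 'X_1 + (u' 0 i)%:MP * 'X_2)%:P).

Lemma hform_dconv : n`!%:R * hform alpha beta w =
  (dconv n (pencil_prod alpha (lsubmx w)) (pencil_prod beta (rsubmx w))).['X_0].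
Proof.
pose f := comp_mpoly [tuple 'X_1; 'X_2] : {mpoly R[2]} -> {mpoly R[3]}.
have fC c : f c%:MP = c%:MP by exact: comp_mpolyC.
have f0 : f 'X_0 = 'X_1 by rewrite /f comp_mpolyXU.
have f1 : f 'X_1 = 'X_2 by rewrite /f comp_mpolyXU.
have fE (a u' : 'rV[R]_n) :
  \prod_(i < n) ('X - (f (a 0 i)%:MP * f 'X_0 + f (u' 0 i)%:MP * f 'X_1)%:P) = pencil_prod a u'.
  by apply: eq_bigr => i _; rewrite !fC f0 f1.
have E := map_hpoly f alpha beta w.
rewrite -!fE -E hornerZ; congr (_ * _).
Qed.

Lemma size_pencil_prod a u' : size (pencil_prod a u') = n.+1.
Proof. by rewrite size_prod_XsubC /index_enum -enumT size_enum_ord. Qed.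

Definition mpC : {rmorphism R -> {mpoly R[3]}} := @mpolyC 3 R.

Lemma pencil_prod_shift (a u' : 'rV[R]_n) (y0 : R) (b : 'I_n -> R) :
  (forall i, a 0 i * y0 + u' 0 i * 1 = b i) -> pencil_prod a u' =
  \prod_(i < n) ('X - (mpC (a 0 i) * ('X_1 - y0%:MP * 'X_2) + mpC (b i) * 'X_2)%:P).
Proof.
move=> ab; apply: eq_bigr => i _; congr ('X - _%:P).
by rewrite /mpC /= -ab mulr1 mpolyCD mpolyCM; ring.
Qed.

Lemma cform_mpC c (y0 : R) k (sg th : seq R) : cform c y0 k sg th =
  mpC k * 'X_2 * \prod_(s <- sg) ('X_0 - mpC c * 'X_2 - mpC s * ('X_1 - y0%:MP * 'X_2))
  + \prod_(s <- th) ('X_0 - mpC c * 'X_2 - mpC s * ('X_1 - y0%:MP * 'X_2)).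
Proof. by []. Qed.

Lemma card_pred1_except (b : 'I_n -> R) B : count_mem B (codom b) = n.-1 ->
  exists2 j0, b j0 != B & forall j, j != j0 -> b j = B.
Proof.
rewrite count_codom => cB; have := cardC [pred j | b j == B]; rewrite cB card_ord => h.
have /mem_card1[j0 j0E] : #|[predC [pred j | b j == B]]| = 1%N.
  by move: h n_gt2; set k := #|_|; clearbody k; lia.
exists j0; first by have := j0E j0; rewrite !inE eqxx.
by move=> j jj0; have := j0E j; rewrite !inE (negPf jj0) => /negbFE/eqP.
Qed.

Lemma hform_normal : in_Sigma alpha beta (n - 1) w -> w \notin Lspace alpha beta ->
  exists c y0 k sg th, [/\ k != 0, uniq sg, size sg = n.-1, size th = n &
    [/\ forall x, x \in sg -> x \notin th, hform alpha beta w = cform c y0 k sg th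
      & mup c (fibw y0 1) = n.-1]].
Proof.
have n_gt0 : (0 < n)%N by apply: ltnW; apply: ltnW.
have r_gt1 : (1 < n - 1)%N by lia.
move=> /(in_SigmaP n_gt2 w alpha_inj beta_inj r_gt1)[y0 [s [c [sE cs]]]] wL.
have mE : mup c (fibw y0 1) = n.-1.
  rewrite sE mup_rprod; apply/eqP; rewrite eqn_leq -[X in _ && (X <= _)%N]subn1 cs andbT.
  exact: (collision_le n_gt2 c wL sE).
pose A i := alpha 0 i * y0 + u i * 1; pose B i := beta 0 i * y0 + v i * 1.
have [|a] := @mconv_cluster R n n_gt0 A B c; first by rewrite -/(fibw y0 1) mE -subn1.
rewrite -/(fibw y0 1) mE => abE.
have lin_neq0 : 'X_1 - y0%:MP * 'X_2 != 0 :> {mpoly R[3]}.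
  apply/eqP => /(congr1 (meval (tnth [tuple 0; 1; 0]))).
  by rewrite mevalB mevalM !mevalXU mevalC meval0 !(tnth_nth 0) /= mulr0 subr0 => /eqP; rewrite oner_eq0.
have nfact : n`!%:R != 0 :> {mpoly R[3]}.
  by rewrite -(prednK (fact_gt0 n)) mpoly_natr_neq0.
(* Multiplicity n - 1 leaves only the cluster sizes n and n - 1, in either order; the second order
   is reduced to the first by [dconvC]. *)
have split_case k l : (k <= n -> l <= n -> k + l = n + n.-1 -> (k = n /\ l = n.-1) \/ (k = n.-1 /\ l = n))%N by lia.
have [[cA cB]|[cA cB]] := split_case _ _ (count_codom_le _ _) (count_codom_le _ _) abE.
- have Aa := (count_codom_full A a).1 cA.
  have [j0 bj0 bj] := card_pred1_except cB.
  have [k [sg [th [k0 sg_uniq szsg szth [dis NF]]]]] := normal_form n_gt2 a alpha_inj beta_inj bj0 bj.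
  exists c, y0, k, sg, th; split=> //; split=> //; apply: (mulfI nfact).
  rewrite hform_dconv (pencil_prod_shift Aa) (@pencil_prod_shift beta _ y0 B) // cform_mpC.
  by rewrite subrKC in NF; rewrite -(NF _ mpC 'X_0 _ 'X_2 lin_neq0).
have Bb := (count_codom_full B (c - a)).1 cB.
have [j0 aj0 aj] := card_pred1_except cA.
have [k [sg [th [k0 sg_uniq szsg szth [dis NF]]]]] := normal_form n_gt2 (c - a) beta_inj alpha_inj aj0 aj.
exists c, y0, k, sg, th; split=> //; split=> //; apply: (mulfI nfact).
rewrite hform_dconv dconvC ?size_pencil_prod //.
rewrite (pencil_prod_shift Bb) (@pencil_prod_shift alpha _ y0 A) // cform_mpC.
by rewrite subrK in NF; rewrite -(NF _ mpC 'X_0 _ 'X_2 lin_neq0).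
Qed.
End HformNormal.

(** * Geometry of the normal form *)

Section CollisionFormGeometry.
Variable K : fieldType.
Variables (c y0 k : K) (sg th : seq K).
Hypotheses (k_neq0 : k != 0) (sg_gt1 : (1 < size sg)%N) (th_gt1 : (1 < size th)%N)
  (sg_th : forall x, x \in sg -> x \notin th).
Local Notation f := (cform c y0 k sg th).

Lemma lform_eval (v : 'I_3 -> K) s :
  (lform c y0 s).@[v] = (v 0 - c * v 2) - s * (v 1 - y0 * v 2).
Proof. by rewrite /lform !mevalB !mevalM !mevalB !mevalM !mevalC !mevalXU. Qed.

Lemma cform_eval (v : 'I_3 -> K) : f.@[v] =
  k * v 2 * \prod_(s <- sg) (lform c y0 s).@[v] + \prod_(s <- th) (lform c y0 s).@[v].
Proof. by rewrite /cform mevalD !mevalM mevalC mevalXU !rmorph_prod. Qed.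

Lemma mderivXU n i j : ('X_j)^`M(i) = (j == i)%:R :> {mpoly K[n]}.
Proof.
rewrite mderivX mnm1E; have [->|ji] := eqVneq j i; last by rewrite scale0r.
by rewrite scale1r (_ : (U_(i) - U_(i) = 0)%MM) ?mpolyX0 //; apply/mnmP => l; rewrite mnmBE subnn mnm0E.
Qed.

(** Differentiation in t with X = x - c t and Y = y - y0 t held fixed. It kills every [lform] and so
    extracts S from t S + T. *)
Definition radial (p : {mpoly K[3]}) := c%:MP * p^`M(0) + y0%:MP * p^`M(1) + p^`M(2).

Lemma radialM p q : radial (p * q) = radial p * q + p * radial q.
Proof. by rewrite /radial !mderivM; ring. Qed.

Lemma radialD p q : radial (p + q) = radial p + radial q.
Proof. by rewrite /radial !mderivD; ring. Qed.

Lemma radialC a : radial a%:MP = 0.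
Proof. by rewrite /radial !mderivC !mulr0 !addr0. Qed.

Lemma radial_lform s : radial (lform c y0 s) = 0.
Proof.
rewrite /radial /lform !mderivB !mderiv_mulC !mderivB !mderiv_mulC !mderivXU /=.
by ring.
Qed.

Lemma radial_prod l : radial (\prod_(s <- l) lform c y0 s) = 0.
Proof.
elim: l => [|s l IH]; first by rewrite big_nil -mpolyC1 radialC.
by rewrite big_cons radialM radial_lform IH mul0r mulr0 addr0.
Qed.

Lemma radial_cform : radial f = k%:MP * \prod_(s <- sg) lform c y0 s.
Proof.
have radX : radial 'X_2 = 1 by rewrite /radial !mderivXU /= !mulr0 !add0r.
by rewrite /cform radialD !radialM !radial_prod radialC radX mul0r mulr0 add0r mulr1 !addr0.
Qed.

Lemma mderiv_prod_vanish (v : 'I_3 -> K) i (l : seq K) (p : {mpoly K[3]}) : (1 < size l)%N ->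
  (forall s, (lform c y0 s).@[v] = 0) -> ((p * \prod_(s <- l) lform c y0 s)^`M(i)).@[v] = 0.
Proof.
case: l => [|s1 [|s2 l]] //= _ v0; rewrite !big_cons mulrCA mderivM mevalD !mevalM !v0.
by rewrite !(mul0r, mulr0, addr0).
Qed.

Lemma proj_ptE (x y t : K) : (proj_pt x y t 0 0 = x) * (proj_pt x y t 0 1 = y) * (proj_pt x y t 0 2 = t).
Proof. by rewrite /proj_pt !mxE !(tnth_nth 0). Qed.

Lemma I3P (P : 'I_3 -> Prop) : P 0 -> P 1 -> P 2 -> forall j, P j.
Proof.
move=> P0 P1 P2 [[|[|[|//]]] jlt].
- by rewrite (_ : Ordinal jlt = 0) //; apply: val_inj.
- by rewrite (_ : Ordinal jlt = 1) //; apply: val_inj.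
- by rewrite (_ : Ordinal jlt = 2) //; apply: val_inj.
Qed.

(** At a singular point the radial derivative gives S = 0 and the equation then gives T = 0; since
    [sg] and [th] are disjoint, this forces X = Y = 0. Conversely both products have at least two
    factors, all vanishing at the point. *)
Lemma cform_singular (P : 'rV[K]_3) :
  singular_point f P <-> exists2 e : K, e != 0 & P = e *: proj_pt c y0 1.
Proof.
split=> [[P0 fP dP]|[e e0 ->]].
  set X := P 0 0 - c * P 0 2; set Y := P 0 1 - y0 * P 0 2.
  have prod0 l : \prod_(s <- l) (lform c y0 s).@[P 0] = 0 -> exists2 s, s \in l & X = s * Y.
    move=> /eqP; rewrite prodf_seq_eq0 => /hasP[s sl /=]; rewrite lform_eval subr_eq0 => /eqP h.
    by exists s.
  have : (radial f).@[P 0] = 0.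
    by rewrite /radial !mevalD !mevalM !dP !mulr0 !addr0.
  rewrite radial_cform mevalM mevalC rmorph_prod => /eqP; rewrite mulf_eq0 (negPf k_neq0) => /eqP S0.
  have [s s_sg XsY] := prod0 _ S0.
  have [t t_th XtY] : exists2 t, t \in th & X = t * Y.
    by apply: prod0; move: fP; rewrite cform_eval S0 mulr0 add0r.
  have Y0 : Y = 0.
    apply/eqP; apply: contraT => Y0; have st : s = t by apply: (mulIf Y0); rewrite -XsY -XtY.
    by have := sg_th s_sg; rewrite st t_th.
  have X0 : X = 0 by rewrite XsY Y0 mulr0.
  have PE : P = P 0 2 *: proj_pt c y0 1.
    apply/rowP; apply: I3P; rewrite !mxE -/(proj_pt _ _ _ _ _) ?proj_ptE.
    - by rewrite !(tnth_nth 0) /= mulrC; apply/eqP; rewrite -subr_eq0 -/X X0.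
    - by rewrite !(tnth_nth 0) /= mulrC; apply/eqP; rewrite -subr_eq0 -/Y Y0.
    - by rewrite !(tnth_nth 0) /= mulr1.
  exists (P 0 2) => //; apply: contraNneq P0 => P2.
  by rewrite PE P2 scale0r.
set Q := e *: _; have PE j : Q 0 j = e * proj_pt c y0 1 0 j by rewrite mxE.
have l0 s : (lform c y0 s).@[Q 0] = 0 by rewrite lform_eval !PE !proj_ptE; ring.
split.
- apply: contraNneq e0 => /rowP/(_ 2); rewrite PE proj_ptE mulr1 mxE => ->; exact: eqxx.
- rewrite cform_eval; case: (sg) sg_gt1 => [|s1 ?] // _; case: (th) th_gt1 => [|s2 ?] // _.
  by rewrite !big_cons !l0 !mul0r mulr0 addr0.
- move=> i; rewrite /cform mderivD mevalD mderiv_prod_vanish // add0r.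
  by rewrite -[\prod_(_ <- _) _]mul1r mderiv_prod_vanish.
Qed.

Definition lform2 (s : K) : {mpoly K[2]} := 'X_0 - s%:MP * 'X_1.

Lemma lform2_homog s : lform2 s \is 1.-homog.
Proof.
rewrite rpredB //; first by rewrite dhomogX /= mdeg1.
by rewrite mul_mpolyC rpredZ // dhomogX /= mdeg1.
Qed.

Lemma prod_lform2_homog l : \prod_(s <- l) lform2 s \is (size l).-homog.
Proof.
elim: l => [|s l IH]; first by rewrite big_nil dhomog1.
by rewrite big_cons -[size _]/(1 + size l)%N dhomogM ?lform2_homog.
Qed.

Lemma lform2_eval (v : 'I_2 -> K) s : (lform2 s).@[v] = v 0 - s * v 1.
Proof. by rewrite /lform2 mevalB mevalM mevalC !mevalXU. Qed.

Lemma cform_local : local_equation 2 f (proj_pt c y0 1) =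
  k%:MP * \prod_(s <- sg) lform2 s + \prod_(s <- th) lform2 s.
Proof.
rewrite /local_equation; set T := [tuple _ | j < 3].
have T2 : tnth T 2 = 1.
  by rewrite tnth_mktuple; case: unliftP => // j /eqP; rewrite (negPf (neq_lift _ _)).
have T0 : tnth T 0 = c%:MP + 'X_0.
  rewrite tnth_mktuple; case: unliftP => [j /(congr1 val)/= h|//].
  rewrite !proj_ptE divr1; congr (_ + 'X_ _); apply: val_inj => /=.
  by move: h; case: j => -[|[|//]].
have T1 : tnth T 1 = y0%:MP + 'X_1.
  rewrite tnth_mktuple; case: unliftP => [j /(congr1 val)/= h|//].
  rewrite !proj_ptE divr1; congr (_ + 'X_ _); apply: val_inj => /=.
  by move: h; case: j => -[|[|//]].
have XE i : 'X_i \mPo T = tnth T i by rewrite comp_mpolyXU (tnth_nth 0).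
have lE s : lform c y0 s \mPo T = lform2 s.
  rewrite /lform /lform2 !(rmorphB, rmorphM) /= !comp_mpolyC !XE T0 T1 T2; ring.
have prodE l : (\prod_(s <- l) lform c y0 s) \mPo T = \prod_(s <- l) lform2 s.
  by rewrite rmorph_prod; apply: eq_bigr => s _; rewrite /= lE.
by rewrite /cform rmorphD !rmorphM /= !prodE XE T2 comp_mpolyC mulr1.
Qed.

End CollisionFormGeometry.

Lemma cform_ordinary (K : fieldType) (c y0 k : K) (sg th : seq K) : k != 0 ->
  (0 < size sg)%N -> uniq sg -> size th = (size sg).+1 ->
  ordinary_point (size sg) (cform c y0 k sg th) (proj_pt c y0 1).
Proof.
move=> k0 sg_gt0 sg_uniq szth; exists 2; first by rewrite proj_ptE oner_eq0.
rewrite /= cform_local; set S := k%:MP * _; set T := \prod_(s <- th) _.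
have S_homog : S \is (size sg).-homog.
  by rewrite /S mul_mpolyC rpredZ // prod_lform2_homog.
have T_homog : T \is (size sg).+1.-homog by rewrite -szth prod_lform2_homog.
have pT : pihomog mdeg (size sg) T = 0.
  by apply: pihomog_ne0 T_homog; rewrite gtn_eqF.
have pS : pihomog mdeg (size sg) S = S by apply: pihomog_dE.
split=> [d d_lt||].
- rewrite pihomogD (pihomog_ne0 _ S_homog) ?gtn_eqF // (pihomog_ne0 _ T_homog) ?addr0 //.
  by rewrite gtn_eqF // ltnW.
- rewrite pihomogD pS pT addr0; apply/eqP => /(congr1 (meval (tnth [tuple 1; 0]))).
  rewrite mevalM mevalC rmorph_prod meval0 /= big1_seq => [|s _]; last first.
    by rewrite lform2_eval !(tnth_nth 0) /= mulr0 subr0.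
  by move/eqP; rewrite mulr1 (negPf k0).
(* The constant k is absorbed into the first linear factor. *)
pose ka (a : 'I_(size sg)) := if val a == 0%N then k else 1.
have ka0 a : ka a != 0 by rewrite /ka; case: ifP; rewrite ?oner_eq0.
exists (fun a => (ka a)%:MP * lform2 sg`_a); split=> [a|a b ab e|].
- by rewrite mul_mpolyC rpredZ // lform2_homog.
- apply: contraNneq ab => /(congr1 (meval (tnth [tuple sg`_b; 1]))).
  rewrite mevalZ !mevalM !mevalC !lform2_eval !(tnth_nth 0) /= !mulr1 subrr !mulr0.
  move/eqP; rewrite mulf_eq0 (negPf (ka0 a)) subr_eq0 /= nth_uniq // => /eqP ba.
  by apply/eqP/val_inj.
rewrite pihomogD pS pT addr0 /S big_split /=.
have -> : \prod_(a < size sg) (ka a)%:MP_[2] = k%:MP.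
  rewrite /ka; case: (size sg) sg_gt0 => // m _.
  rewrite big_ord_recl big1 /= ?mulr1 // => i _; exact: mpolyC1.
by congr (_ * _); rewrite (big_nth 0) big_mkord.
Qed.

Lemma mpoly_rmorph_eq (K : comNzRingType) n (S : nzRingType)
    (F G : {rmorphism {mpoly K[n]} -> S}) :
  (forall a, F a%:MP = G a%:MP) -> (forall i, F 'X_i = G 'X_i) -> F =1 G.
Proof.
move=> FGC FGX p; rewrite (mpolyE p) !rmorph_sum; apply: eq_bigr => m _.
rewrite -mul_mpolyC !rmorphM FGC; congr (_ * _).
rewrite mpolyXE_id !rmorph_prod; apply: eq_bigr => i _.
by rewrite !rmorphXn FGX.
Qed.

Lemma size_mul2 (A : idomainType) (p q : {poly A}) :
  size (p * q) = 2 -> size p = 1%N \/ size q = 1%N.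
Proof.
move=> pq; have p0 : p != 0 by apply/eqP => p0; move: pq; rewrite p0 mul0r size_poly0.
have q0 : q != 0 by apply/eqP => q0; move: pq; rewrite q0 mulr0 size_poly0.
move: pq; rewrite size_mul //; have := size_poly_gt0 p; have := size_poly_gt0 q.
by rewrite p0 q0; lia.
Qed.

(** * Irreducibility over a closed field *)

Section Irreducible.
Variable K : closedFieldType.
Variables (c y0 k : K) (sg th : seq K).
Hypotheses (k_neq0 : k != 0) (sg_th : forall x, x \in sg -> x \notin th).
Local Notation f := (cform c y0 k sg th).
Local Notation P1 := {poly K}.
Local Notation P2 := {poly {poly K}}.
Local Notation P3 := {poly {poly {poly K}}}.

Definition io3 : {rmorphism K -> P3} := polyC \o (polyC \o polyC).

(* In the coordinates X = x - c t, Y = y - y0 t the form is linear in t: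
   P3 is K[Y][X][t]. *)
Definition to_poly3 : {rmorphism {mpoly K[3]} -> P3} :=
  mmap io3 (tnth [tuple 'X%:P + io3 c * 'X; 'X%:P%:P + io3 y0 * 'X; 'X]).

Definition of_poly1 : {rmorphism P1 -> {mpoly K[3]}} :=
  horner_eval ('X_1 - y0%:MP * 'X_2) \o map_poly (@mpolyC 3 K).
Definition of_poly2 : {rmorphism P2 -> {mpoly K[3]}} :=
  horner_eval ('X_0 - c%:MP * 'X_2) \o map_poly of_poly1.
Definition of_poly3 : {rmorphism P3 -> {mpoly K[3]}} :=
  horner_eval 'X_2 \o map_poly of_poly2.

Lemma of_poly1C a : of_poly1 a%:P = a%:MP.
Proof. by rewrite /of_poly1 /= map_polyC /horner_eval hornerC. Qed.
Lemma of_poly1X : of_poly1 'X = 'X_1 - y0%:MP * 'X_2.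
Proof. by rewrite /of_poly1 /= map_polyX /horner_eval hornerX. Qed.
Lemma of_poly2C a : of_poly2 a%:P = of_poly1 a.
Proof. by rewrite /of_poly2 /= map_polyC /horner_eval hornerC. Qed.
Lemma of_poly2X : of_poly2 'X = 'X_0 - c%:MP * 'X_2.
Proof. by rewrite /of_poly2 /= map_polyX /horner_eval hornerX. Qed.
Lemma of_poly3C a : of_poly3 a%:P = of_poly2 a.
Proof. by rewrite /of_poly3 /= map_polyC /horner_eval hornerC. Qed.
Lemma of_poly3X : of_poly3 'X = 'X_2.
Proof. by rewrite /of_poly3 /= map_polyX /horner_eval hornerX. Qed.

Lemma of_poly3_io a : of_poly3 (io3 a) = a%:MP.
Proof. by rewrite -[io3 a]/(a%:P%:P%:P) of_poly3C of_poly2C of_poly1C. Qed.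

Lemma to_poly3C a : to_poly3 a%:MP = io3 a.
Proof. by rewrite /to_poly3 /= mmapC. Qed.

Lemma to_poly3X i : to_poly3 'X_i =
  tnth [tuple 'X%:P + io3 c * 'X; 'X%:P%:P + io3 y0 * 'X; 'X] i.
Proof. by rewrite /to_poly3 /= mmapX mmap1U. Qed.

Lemma of_to_poly3 p : of_poly3 (to_poly3 p) = p.
Proof.
apply: (@mpoly_rmorph_eq _ _ _ (of_poly3 \o to_poly3) idfun) => [a|].
  by rewrite -[LHS]/(of_poly3 (to_poly3 a%:MP)) to_poly3C of_poly3_io.
suff h i : of_poly3 (to_poly3 'X_i) = 'X_i by [].
move: i; apply: I3P; rewrite to_poly3X (tnth_nth 0) [nth _ _ _]/=.
- by rewrite rmorphD rmorphM of_poly3C of_poly2X of_poly3_io of_poly3X subrK.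
- by rewrite rmorphD rmorphM of_poly3C of_poly2C of_poly1X of_poly3_io of_poly3X subrK.
- by rewrite of_poly3X.
Qed.

Definition lpoly2 (s : K) : P2 := 'X - (s *: 'X)%:P.

Lemma to_poly3_lform s : to_poly3 (lform c y0 s) = (lpoly2 s)%:P.
Proof.
rewrite /lform !(rmorphB, rmorphM) /= !to_poly3C !to_poly3X !(tnth_nth 0) /=.
by rewrite /lpoly2 -mul_polyC !(polyCB, polyCM); ring.
Qed.

Lemma to_poly3_cform : to_poly3 f =
  (k%:P *: \prod_(s <- sg) lpoly2 s)%:P * 'X + (\prod_(s <- th) lpoly2 s)%:P.
Proof.
have prodE l : to_poly3 (\prod_(s <- l) lform c y0 s) = (\prod_(s <- l) lpoly2 s)%:P.
  by rewrite !rmorph_prod; apply: eq_bigr => s _; rewrite to_poly3_lform.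
rewrite /cform rmorphD !rmorphM /= !prodE to_poly3C to_poly3X (tnth_nth 0) /=.
by rewrite -mul_polyC polyCM mulrAC.
Qed.

Lemma lpoly2_monic l : \prod_(s <- l) lpoly2 s \is monic.
Proof. exact: monic_prod_XsubC. Qed.

Lemma const_unit (g : {mpoly K[3]}) a : a != 0 -> to_poly3 g = io3 a -> g \is a GRing.unit.
Proof.
move=> a0 ga; have -> : g = a%:MP by rewrite -[g]of_to_poly3 ga of_poly3_io.
by apply: (rmorph_unit (@mpolyC 3 K)); rewrite unitfE.
Qed.

(** The product over [th] is monic in X, so the leading coefficient of g is a nonzero constant and
    setting Y = 1 keeps its degree. A root of the specialized g would lie in both [sg] and [th]. *)
Lemma common_factor_const (g p q : P2) :
  g * p = k%:P *: \prod_(s <- sg) lpoly2 s -> g * q = \prod_(s <- th) lpoly2 s ->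
  exists2 a : K, a != 0 & g = a%:P%:P.
Proof.
move=> gp gq; have lg : lead_coef g \is a GRing.unit.
  apply/unitrPr; exists (lead_coef q); rewrite -lead_coefM gq.
  exact/monicP/lpoly2_monic.
have [a a0 aE] : exists2 a : K, a != 0 & lead_coef g = a%:P.
  move: lg; rewrite poly_unitE unitfE => /andP[/eqP sz1 a0].
  by exists (lead_coef g)`_0 => //; apply: size1_polyC; rewrite sz1.
exists a => //; pose ev := map_poly (horner_eval 1) : P2 -> P1.
have evprod l : ev (\prod_(s <- l) lpoly2 s) = \prod_(s <- l) ('X - s%:P).
  rewrite /ev rmorph_prod; apply: eq_bigr => s _.
  by rewrite /lpoly2 /= rmorphB /= map_polyX map_polyC /= /horner_eval hornerZ hornerX mulr1.
have szg : size (ev g) = size g.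
  by apply: size_map_poly_id0; rewrite aE /horner_eval hornerC.
have [sz1|sz1] := eqVneq (size g) 1%N.
  rewrite {1}(size1_polyC (p := g)) ?sz1 //; congr (_%:P).
  by rewrite -aE /lead_coef sz1.
have [|z gz] := closed_rootP (ev g) _; first by rewrite szg.
have zth : z \in th.
  rewrite -root_prod_XsubC -evprod -gq /ev rmorphM rootM.
  by rewrite -/(ev g) gz.
have zsg : z \in sg.
  have : root (ev (k%:P *: \prod_(s <- sg) lpoly2 s)) z.
    by rewrite -gp /ev rmorphM rootM -/(ev g) gz.
  rewrite /ev map_polyZ /= /horner_eval hornerC rootZ //.
  by rewrite -/(ev _) evprod root_prod_XsubC.
by have := sg_th zsg; rewrite zth.
Qed.

(** The form has degree 1 in t, so in a product one factor is free of t; it divides both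
    coefficients and is constant because they are coprime. *)
Lemma cform_irreducible : irreducible_mpoly f.
Proof.
have kS0 : k%:P *: \prod_(s <- sg) lpoly2 s != 0.
  by rewrite -mul_polyC mulf_neq0 ?polyC_eq0 // monic_neq0 // lpoly2_monic.
have sz2 : size (to_poly3 f) = 2.
  set S := k%:P *: _ in kS0 *; have szS : size (S%:P * 'X) = 2.
    by rewrite size_mulX ?polyC_eq0 // size_polyC kS0.
  by rewrite to_poly3_cform size_polyDl szS // size_polyC; case: (_ != _).
have half (g h : {mpoly K[3]}) : f = g * h -> size (to_poly3 g) = 1%N -> g \is a GRing.unit.
  move=> fE sz1; have [g0 g0E] : exists g0, to_poly3 g = g0%:P.
    by exists (to_poly3 g)`_0; apply: size1_polyC; rewrite sz1.
  have := to_poly3_cform; rewrite fE rmorphM g0E => E.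
  have E1 := congr1 (fun p : P3 => p`_1) E; have E0 := congr1 (fun p : P3 => p`_0) E.
  rewrite coefCM coefD coefCM coefX coefC mulr1 addr0 in E1.
  rewrite coefCM coefD coefCM coefX coefC mulr0 add0r in E0.
  have [a a0 gE] := common_factor_const E1 E0.
  by apply: (const_unit a0); rewrite g0E gE.
split.
- by apply/eqP => f0; move: sz2; rewrite f0 rmorph0 size_poly0.
- apply/negP => /(rmorph_unit to_poly3); rewrite poly_unitE sz2 => //.
move=> g h fE; have gh := sz2; rewrite {1}fE rmorphM in gh.
have [g1|h1] := size_mul2 gh; [left; exact: (half g h)|right; apply: (half h g) => //].
by rewrite mulrC.
Qed.
End Irreducible.

(** * The rational parametrization *)

Section Normalization.
Variable R : realType.
Local Notation C := R[i].

Lemma complexify_cform (c y0 k : R) (sg th : seq R) :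
  complexify (cform c y0 k sg th)
  = cform c%:C y0%:C k%:C [seq s%:C | s <- sg] [seq s%:C | s <- th].
Proof.
have lE s : map_mpoly (real_complex R) (lform c y0 s) = lform c%:C y0%:C s%:C.
  by rewrite /lform !(rmorphB, rmorphM) /= !map_mpolyC !map_mpolyX.
have pE (l : seq R) : map_mpoly (real_complex R) (\prod_(s <- l) lform c y0 s)
    = \prod_(s <- [seq s%:C | s <- l]) lform c%:C y0%:C s.
  by rewrite rmorph_prod big_map; apply: eq_bigr => s _; apply: lE.
by rewrite /complexify /cform rmorphD !rmorphM /= !pE map_mpolyC map_mpolyX.
Qed.

Variables (c y0 k : R) (sg th : seq R).
Hypotheses (k_neq0 : k != 0) (szth : size th = (size sg).+1)
  (sg_th : forall x, x \in sg -> x \notin th).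
Local Notation f := (cform c y0 k sg th).

Let S : {mpoly R[2]} := k%:MP * \prod_(s <- sg) lform2 s.
Let T : {mpoly R[2]} := \prod_(s <- th) lform2 s.

(* The line through the singular point with direction (X : Y) = (s : r) meets
   the curve t S(X, Y) + T(X, Y) = 0 again at (X, Y, t) = (s S, r S, - T). *)
Definition paramF : 3.-tuple {mpoly R[2]} :=
  [tuple 'X_0 * S - c%:MP * T; 'X_1 * S - y0%:MP * T; - T].

(** Projection from the singular point [c : y0 : 1]. *)
Definition paramG : 2.-tuple {mpoly R[3]} :=
  [tuple 'X_0 - c%:MP * 'X_2; 'X_1 - y0%:MP * 'X_2].

Lemma paramF_homog i : tnth paramF i \is (size th).-homog.
Proof.
have hS : S \is (size sg).-homog by rewrite /S mul_mpolyC rpredZ // prod_lform2_homog.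
have hT a : a%:MP * T \is (size th).-homog by rewrite mul_mpolyC rpredZ // prod_lform2_homog.
have hX (j : 'I_2) : 'X_j * S \is (size th).-homog.
  by rewrite szth -[(size sg).+1]/(1 + size sg)%N dhomogM // dhomogX /= mdeg1.
move: i; apply: I3P; rewrite (tnth_nth 0) /=.
- by apply: rpredB; [exact: hX|exact: hT].
- by apply: rpredB; [exact: hX|exact: hT].
- by rewrite rpredN prod_lform2_homog.
Qed.

Lemma paramG_homog i : tnth paramG i \is 1.-homog.
Proof.
have hX (j : 'I_3) : ('X_j : {mpoly R[3]}) \is 1.-homog by rewrite dhomogX /= mdeg1.
by case: i => -[|[|//]] ilt; rewrite (tnth_nth 0) /=; apply: rpredB; rewrite ?mul_mpolyC ?rpredZ //; apply: hX.
Qed.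

(** S and T have no common zero on the projective line, and where T = 0 the first two forms are S
    times the coordinates. *)
Lemma paramF_nonvanishing (v : 'rV[C]_2) : v != 0 ->
  exists i, (complexify (tnth paramF i)).@[v 0] != 0.
Proof.
move=> v0.
have [cS cSE] : exists a, (map_mpoly (real_complex R) S).@[v 0] = a by eexists.
have [cT cTE] : exists a, (map_mpoly (real_complex R) T).@[v 0] = a by eexists.
have lE s : (map_mpoly (real_complex R) (lform2 s)).@[v 0] = v 0 0 - s%:C * v 0 1.
  rewrite /lform2 rmorphB rmorphM /= map_mpolyC !map_mpolyX.
  by rewrite mevalB mevalM mevalC !mevalXU.
have pE l : (map_mpoly (real_complex R) (\prod_(s <- l) lform2 s)).@[v 0]
    = \prod_(s <- l) (v 0 0 - s%:C * v 0 1).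
  by rewrite !rmorph_prod; apply: eq_bigr => s _; apply: lE.
have root_prod l : \prod_(s <- l) (v 0 0 - s%:C * v 0 1) = 0 ->
    exists2 s : R, s \in l & v 0 0 = s%:C * v 0 1.
  by move/eqP; rewrite prodf_seq_eq0 => /hasP[s sl /=]; rewrite subr_eq0 => /eqP; exists s.
have [T0|T0] := eqVneq cT 0; last first.
  by exists 2; rewrite (tnth_nth 0) [nth _ _ _]/= /complexify rmorphN mevalN oppr_eq0 cTE.
have v01 : v 0 0 != 0 \/ v 0 1 != 0.
  have [v00|] := eqVneq (v 0 0) 0; last by left.
  right; apply: contraNneq v0 => v01; apply/eqP/rowP => -[[|[|//]] jlt]; rewrite mxE.
    by rewrite -[RHS]v00; congr (v 0 _); apply: val_inj.
  by rewrite -[RHS]v01; congr (v 0 _); apply: val_inj.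
have S0 : cS != 0.
  apply/eqP; rewrite -cSE /S rmorphM /= map_mpolyC mevalM mevalC pE => /eqP.
  rewrite mulf_eq0 fmorph_eq0 (negPf k_neq0) /= => /eqP/root_prod[s s_sg sE].
  move: T0; rewrite -cTE pE => /root_prod[t t_th tE].
  have v1 : v 0 1 != 0 by case: v01 => //; rewrite sE mulf_eq0 negb_or => /andP[].
  have /complexI st : s%:C = t%:C by apply: (mulIf v1); rewrite -sE -tE.
  by have := sg_th s_sg; rewrite st t_th.
have FE (i : 'I_2) a (p q : {mpoly R[2]}) : (map_mpoly (real_complex R) ('X_i * p - a%:MP * q)).@[v 0]
    = v 0 i * (map_mpoly (real_complex R) p).@[v 0] - a%:C * (map_mpoly (real_complex R) q).@[v 0].
  rewrite rmorphB !rmorphM /= map_mpolyX map_mpolyC.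
  move: (map_mpoly _ p) (map_mpoly _ q) => p' q'.
  by rewrite mevalB !mevalM mevalC mevalXU.
have E0 : (complexify (tnth paramF 0)).@[v 0] = v 0 0 * cS.
  by rewrite -[RHS]subr0 -(mulr0 c%:C) -T0 -cTE -cSE; apply: FE.
have E1 : (complexify (tnth paramF 1)).@[v 0] = v 0 1 * cS.
  by rewrite -[RHS]subr0 -(mulr0 y0%:C) -T0 -cTE -cSE; apply: FE.
case: v01 => h; first by exists 0; rewrite E0 mulf_neq0.
by exists 1; rewrite E1 mulf_neq0.
Qed.

(** Every [lform] pulls back to S times an [lform2]. With one factor more in [th] than in [sg], the
    two terms become - S^(size th) T and S^(size th) T. *)
Lemma cform_paramF : f \mPo paramF = 0.
Proof.
have XE i : 'X_i \mPo paramF = tnth paramF i by rewrite comp_mpolyXU (tnth_nth 0).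
have lE s : lform c y0 s \mPo paramF = S * lform2 s.
  rewrite /lform /lform2 !(rmorphB, rmorphM) /= !comp_mpolyC !XE !(tnth_nth 0) /=; ring.
have pE l : (\prod_(s <- l) lform c y0 s) \mPo paramF = S ^+ size l * \prod_(s <- l) lform2 s.
  elim: l => [|s l IH]; first by rewrite !big_nil rmorph1 mulr1.
  by rewrite !big_cons rmorphM /= IH lE exprS mulrACA.
rewrite /cform rmorphD !rmorphM /= !pE comp_mpolyC XE (tnth_nth 0) /= szth exprS -/T.
have -> : k%:MP * - T * (S ^+ size sg * \prod_(s <- sg) lform2 s) = - (S * S ^+ size sg * T).
  by rewrite {2}/S; ring.
by rewrite addNr.
Qed.

Lemma paramG_paramF i : tnth paramG i \mPo paramF = S * 'X_i.
Proof.
have XE j : 'X_j \mPo paramF = tnth paramF j by rewrite comp_mpolyXU (tnth_nth 0).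
case: i => -[|[|//]] ilt; rewrite [tnth paramG _](tnth_nth 0) /= rmorphB rmorphM /= comp_mpolyC !XE !(tnth_nth 0) /=.
  by rewrite (_ : Ordinal ilt = 0); [ring|apply: val_inj].
by rewrite (_ : Ordinal ilt = 1); [ring|apply: val_inj].
Qed.

(** Substituting [paramG] turns S into S3 and T into f - t S3, so modulo f the composite is S3 times
    the identity; the multipliers Q are the coordinates (c, y0, 1). *)
Lemma paramF_paramG : exists Q : 'I_3 -> {mpoly R[3]}, exists S3,
  forall i, tnth paramF i \mPo paramG = 'X_i * S3 - Q i * f.
Proof.
have XE j : 'X_j \mPo paramG = tnth paramG j by rewrite comp_mpolyXU (tnth_nth 0).
have lE s : lform2 s \mPo paramG = lform c y0 s.
  by rewrite /lform2 rmorphB rmorphM /= comp_mpolyC !XE !(tnth_nth 0).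
have pE l : (\prod_(s <- l) lform2 s) \mPo paramG = \prod_(s <- l) lform c y0 s.
  by rewrite rmorph_prod; apply: eq_bigr => s _; apply: lE.
pose S3 := k%:MP * \prod_(s <- sg) lform c y0 s.
have SE : S \mPo paramG = S3 by rewrite /S rmorphM /= comp_mpolyC pE.
have TE : T \mPo paramG = f - 'X_2 * S3 by rewrite /T pE /cform /S3; ring.
have cE (j : 'I_2) a p q : ('X_j * p - a%:MP * q) \mPo paramG
    = tnth paramG j * (p \mPo paramG) - a%:MP * (q \mPo paramG).
  by rewrite rmorphB !rmorphM /= comp_mpolyC XE.
exists (tnth [tuple c%:MP; y0%:MP; 1]), S3; apply: I3P.
- by rewrite [LHS]cE SE TE !(tnth_nth 0) /=; ring.
- by rewrite [LHS]cE SE TE !(tnth_nth 0) /=; ring.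
- have -> : tnth paramF 2 \mPo paramG = - (T \mPo paramG) by rewrite -rmorphN.
  by rewrite TE (tnth_nth 0) /=; ring.
Qed.

Lemma cform_normalization : normalization_is_P1 f.
Proof.
exists (size th), 1%N, paramF, paramG; split.
- by split; [apply: paramF_homog|apply: paramG_homog].
- exact: paramF_nonvanishing.
- exact: cform_paramF.
- exists S; last exact: paramG_paramF.
  apply/eqP => /(congr1 (meval (tnth [tuple 1; 0]))).
  rewrite mevalM mevalC rmorph_prod meval0 /= big1_seq => [|s _]; last first.
    by rewrite lform2_eval !(tnth_nth 0) /= mulr0 subr0.
  by move/eqP; rewrite mulr1 (negPf k_neq0).
move=> i j; have [Q [S3 QE]] := paramF_paramG.
exists (Q j * 'X_i - Q i * 'X_j); rewrite !QE; ring.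
Qed.
End Normalization.

Theorem corollary7p7 (R : realType) (n : nat) (hn : (3 <= n)%N)
    (alpha beta : 'rV[R]_n)
    (alpha_inj : injective (fun i => alpha 0 i))
    (beta_inj : injective (fun i => beta 0 i))
    (w : 'rV[R]_(n + n)) :
  [/\ w \notin Lspace alpha beta ->
        (2 * n - 2 <= nonreal_zeros (Ddisc alpha beta w))%N,
      nonreal_zeros (Ddisc alpha beta w) = (2 * n - 2)%N <->
        in_Sigma alpha beta (n - 1) w /\ w \notin Lspace alpha beta
    & in_Sigma alpha beta (n - 1) w /\ w \notin Lspace alpha beta ->
      [/\ absolutely_irreducible (hform alpha beta w),
          normalization_is_P1 (hform alpha beta w)
        & exists x y t : R,
          [/\ real_collision_fiber alpha beta w y t,
              ordinary_point (n - 1) (complexify (hform alpha beta w))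
                (proj_pt x%:C y%:C t%:C)
            & forall P : 'rV[R[i]]_3,
                singular_point (complexify (hform alpha beta w)) P <->
                exists2 c : R[i], c != 0 & P = c *: proj_pt x%:C y%:C t%:C]]].
Proof.
have [bound bound_eq] := nonreal_bound hn w alpha_inj beta_inj.
split=> // -[w_sigma wL].
have [c [y0 [k [sg [th [k0 sg_uniq szsg szth [sg_th hE mE]]]]]]] :=
  hform_normal hn alpha_inj beta_inj w_sigma wL.
have szth' : size th = (size sg).+1 by rewrite szth szsg prednK // ltnW // ltnW.
have sg_gt1 : (1 < size sg)%N by rewrite szsg -subn1; lia.
pose toC := map (real_complex R).
have kC : k%:C != 0 by rewrite fmorph_eq0.
have sg_thC z : z \in toC sg -> z \notin toC th.
  by case/mapP => x xsg ->; rewrite mem_map ?sg_th //; apply: complexI.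
rewrite hE; split.
- by rewrite /absolutely_irreducible complexify_cform; apply: cform_irreducible.
- exact: cform_normalization.
(* The (n - 1)-fold root c of the fiber over [y0 : 1] is the point common to all the lines
   [lform c y0 s]. *)
exists c, y0, 1; split.
- have c2 : has_root_mult 2 (hfiber alpha beta w y0 1).
    exists c; rewrite hfiber_fib -mup_geq ?mE -?szsg //.
    by have [s [_ ->]] := fib_split alpha beta w y0 1; apply: rprod_neq0.
  split=> // [|y' t' _ [c' hc']]; first by rewrite xpair_eqE oner_eq0 andbF.
  have [s' [_ sE']] := fib_split alpha beta w y' t'.
  pose F := fib (fun i => alpha 0 i) (fun i => beta 0 i)
    (fun i => lsubmx w 0 i) (fun i => rsubmx w 0 i).
  have mc' : (1 < mup c' (F y' t'))%N.
    by rewrite hfiber_fib in hc'; rewrite mup_geq // /F sE' rprod_neq0.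
  have mc : (1 < mup c (F y0 1%R))%N by rewrite mE -szsg.
  by apply: (collision_unique _ alpha_inj beta_inj mc' mc); apply: ltnW; apply: ltnW.
- rewrite complexify_cform rmorph1 subn1 -szsg -(size_map (real_complex R)).
  apply: cform_ordinary; rewrite ?size_map //; first exact: ltnW.
  by rewrite map_inj_uniq //; apply: complexI.
move=> P; rewrite complexify_cform rmorph1.
by apply: cform_singular; rewrite ?size_map // szth' ltnW.
Qed.
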